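(* Let $n\ge 1$, and let $\{(\Gamma_k\backslash \mathbb{H}_n,\mathfrak{v}_k,\langle\cdot,\cdot\rangle_k)\}_{k\in\mathbb{N}}$ be a sequence of compact Heisenberg manifolds with left invariant (bracket generating) sub-Riemannian metrics of corank $1$ which converges in the Gromov--Hausdorff topology. Assume that there are constants $D,V>0$ such that for all $k$: (1) $\mathrm{diam}(\Gamma_k\backslash \mathbb{H}_n,\mathfrak{v}_k,\langle\cdot,\cdot\rangle_k)\leq D$; (2) $\mathrm{meas}(\Gamma_k\backslash \mathbb{H}_n,\mathfrak{v}_k,\langle\cdot,\cdot\rangle_k)\geq V$, where $\mathrm{meas}$ is the total Popp measure. Then the Gromov--Hausdorff limit is isometric to a compact Heisenberg manifold with a left invariant sub-Riemannian metric, of the same dimension $2n+1$.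
   Context: The Heisenberg Lie group $\mathbb{H}_n$ is $\mathbb{C}^n\times\mathbb{R}$ with product $(\mathbf{w},z)\cdot(\mathbf{w}',z')=(\mathbf{w}+\mathbf{w}',\,z+z'+\tfrac12\,\mathrm{Im}(\mathbf{w}\cdot\mathbf{w}'))$, where $\mathrm{Im}(\mathbf{w}\cdot\mathbf{w}')=\sum_i(x_iy_i'-y_ix_i')$ for $\mathbf w=(x_i+\sqrt{-1}\,y_i)_i$, $\mathbf w'=(x'_i+\sqrt{-1}\,y'_i)_i$; its Lie algebra is $\mathfrak{h}_n$. A compact Heisenberg manifold is a quotient $\Gamma\backslash\mathbb{H}_n$ with $\Gamma<\mathbb{H}_n$ a lattice. A left invariant sub-Riemannian metric on $\mathbb{H}_n$ is a pair $(\mathfrak{v},\langle\cdot,\cdot\rangle)$ with $\mathfrak{v}\subset\mathfrak{h}_n$ a subspace and $\langle\cdot,\cdot\rangle$ a scalar product on $\mathfrak{v}$, extended to a left invariant distribution and fibre metric by left translation. Its corank is $\dim(\mathfrak{h}_n/\mathfrak{v})$; corank $0$ is the Riemannian case, and ''sub-Riemannian metric'' with no corank specified covers all coranks. It is bracket generating if iterated brackets of $\mathfrak{v}$ span $\mathfrak{h}_n$. The distance $dist(x,y)$ is the infimum of the lengths $\int_0^1\sqrt{\langle\dot c,\dot c\rangle}\,dt$ of absolutely continuous paths $c$ from $x$ to $y$ tangent a.e. to the distribution. A sub-Riemannian metric on $\Gamma\backslash\mathbb{H}_n$ is left invariant if its pullback to $\mathbb{H}_n$ is left invariant; the quotient carries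 the induced metric and distance. Popp's volume (corank $1$): if $U_1,\dots,U_{2n}$ is a left invariant orthonormal frame of $\mathfrak{v}$, completed by a left invariant field $U_{2n+1}$ to a frame with dual coframe $\nu^1,\dots,\nu^{2n+1}$, and $c_{ij}$ is the $U_{2n+1}$-component of $[U_i,U_j]$, then $\mathrm{dvol}_{sR}=\big(\sum_{i,j=1}^{2n}c_{ij}^2\big)^{-1/2}\,\nu^1\wedge\cdots\wedge\nu^{2n+1}$ (up to sign, independent of choices). The total Popp measure is $\left|\int_{\Gamma\backslash\mathbb{H}_n}\mathrm{dvol}_{sR}\right|$. *)

(* Defs.v *)
From HB Require Import structures.
From mathcomp Require Import all_boot all_order all_algebra.
From mathcomp Require Import all_classical all_reals all_analysis.

Set Implicit Arguments.
Unset Strict Implicit.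
Unset Printing Implicit Defensive.

Import Order.TTheory GRing.Theory Num.Theory.
Import numFieldNormedType.Exports.

Local Open Scope classical_set_scope.
Local Open Scope ring_scope.

(* The group H_n = C^n x R is written in the real coordinates
   (x_1, .., x_n, y_1, .., y_n, z), with w = x + i y.  The exponential map is
   the identity in these coordinates, so the same row vectors also stand for
   the elements of the Lie algebra h_n. *)
Notation heis R n := 'rV[R]_(n + n + 1)%N.

Section Heisenberg.
Context {R : realType} {n : nat}.
Implicit Types (u v w g h : heis R n).

Definition hx g : 'rV[R]_n := lsubmx (lsubmx g).
Definition hy g : 'rV[R]_n := rsubmx (lsubmx g).
Definition hcenter (r : R) : heis R n := row_mx 0 r%:M.

(* Im (w . w') *)
Definition hsymp g h : R :=
  \sum_(i < n) (hx g 0 i * hy h 0 i - hy g 0 i * hx h 0 i).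

Definition hmul g h : heis R n := g + h + hcenter (hsymp g h / 2).
Definition hinv g : heis R n := - g.

(* Differentiating hmul: the left invariant fields extending u and v have
   for bracket the left invariant field extending hbracket u v. *)
Definition hbracket u v : heis R n := hcenter (hsymp u v).

Record sr_metric := SRMetric {
  sr_space : {vspace heis R n};
  (* only the values on sr_space are meaningful *)
  sr_prod : heis R n -> heis R n -> R;
  sr_prodC : {in sr_space &, forall u v, sr_prod u v = sr_prod v u};
  sr_prod_linear : forall a : R, {in sr_space & &, forall u v w,
    sr_prod (a *: u + v) w = a * sr_prod u w + sr_prod v w};
  sr_prod_gt0 : {in sr_space, forall u, u != 0 -> 0 < sr_prod u u} }.

Implicit Type M : sr_metric.

Definition corank M : nat := (\dim {: heis R n} - \dim (sr_space M))%N.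

Inductive iterated_bracket (V : {vspace heis R n}) : heis R n -> Prop :=
| IterBase u : u \in V -> iterated_bracket V u
| IterBracket u v : iterated_bracket V u -> iterated_bracket V v ->
    iterated_bracket V (hbracket u v).

Definition bracket_generating M : Prop :=
  exists2 us : seq (heis R n),
    {in us, forall u, iterated_bracket (sr_space M) u} & <<us>>%VS = fullv.

(* A list of pairs (a_1, b_1), .., (a_m, b_m) satisfying the two conditions is
   a finite family of non-overlapping intervals of [a, b], listed from left
   to right. *)
Definition abs_continuous (a b : R) (c : R -> heis R n) : Prop :=
  forall e : R, 0 < e -> exists2 d : R, 0 < d &
    forall s : seq (R * R),
      all (fun p => [&& a <= p.1, p.1 <= p.2 & p.2 <= b]) s ->
      pairwise (fun p q => p.2 <= q.1) s ->
      \sum_(p <- s) (p.2 - p.1) < d ->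
      \sum_(p <- s) `|c p.2 - c p.1| < e.

(* The velocity of c at time t, brought back to the Lie algebra by the
   differential of the left translation by (c t)^-1. *)
Definition left_velocity (c : R -> heis R n) (t : R) : heis R n :=
  derive1 (fun s => hmul (hinv (c t)) (c s)) t.

Definition horizontal M (c : R -> heis R n) : Prop :=
  abs_continuous 0 1 c /\
  {ae lebesgue_measure, forall t : R, t \in `]0, 1[ ->
     derivable c t 1 /\ left_velocity c t \in sr_space M}.

Definition sr_length M (c : R -> heis R n) : \bar R :=
  \int[lebesgue_measure]_(t in `[0, 1])
    (Num.sqrt (sr_prod M (left_velocity c t) (left_velocity c t)))%:E.

Definition lattice (G : set (heis R n)) : Prop :=
  [/\ G 0,
      (forall g h, G g -> G h -> G (hmul g h)),
      (forall g, G g -> G (hinv g)),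
      (forall g, G g -> \forall h \near g, G h -> h = g) &
      (* cocompactness *)
      exists2 K : set (heis R n), compact K &
        forall x, exists g k, [/\ G g, K k & x = hmul g k]].

Definition heis_quot (G : set (heis R n)) : Type :=
  {A : set (heis R n) | exists x, A = [set hmul g x | g in G]}.

(* Horizontal paths in the quotient by G are the projections of horizontal
   paths in H_n; the latter start and end anywhere in the two given orbits. *)
Definition sr_dist M (G : set (heis R n)) (A B : heis_quot G) : \bar R :=
  ereal_inf [set sr_length M c | c in
    [set c | [/\ horizontal M c, sval A (c 0) & sval B (c 1)]]].

Definition sr_diam M (G : set (heis R n)) : \bar R :=
  ereal_sup [set r | exists A B : heis_quot G, r = sr_dist M A B].

Definition fundamental_domain (G F : set (heis R n)) : Prop :=
  <<s [set U | open U] >> F /\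
  forall A : heis_quot G, exists! x, F x /\ sval A x.

(* Row i of U is the i-th vector of the frame. *)
Definition adapted_frame M (U : 'M[R]_(n + n + 1)) : Prop :=
  [/\ U \in unitmx,
      (forall i : 'I_(n + n), row (lshift 1 i) U \in sr_space M) &
      (forall i j : 'I_(n + n),
         sr_prod M (row (lshift 1 i) U) (row (lshift 1 j) U) = (i == j)%:R)].

(* b *m invmx U lists the components of b in the frame U. *)
Definition structure_const (U : 'M[R]_(n + n + 1)) (i j : 'I_(n + n)) : R :=
  (hbracket (row (lshift 1 i) U) (row (lshift 1 j) U) *m invmx U)
    0 (rshift (n + n) 0).

(* The coframe dual to U has nu^1 /\ .. /\ nu^(2n+1) equal to (\det U)^-1
   times the Lebesgue form, which is left invariant. *)
Definition popp_density_in (U : 'M[R]_(n + n + 1)) : R :=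
  (Num.sqrt (\sum_i \sum_j structure_const U i j ^+ 2))^-1 * `|\det U|^-1.

(* When the corank is 1, the value does not depend on the frame chosen. *)
Definition popp_density M : R :=
  popp_density_in (get [set U | adapted_frame M U]).

End Heisenberg.

Arguments sr_metric : clear implicits.

(* The Lebesgue integral over R^m of a nonnegative Borel function, as an
   iterated integral. *)
Fixpoint leb_integral {R : realType} (m : nat) :
    ('rV[R]_m -> \bar R) -> \bar R :=
  match m with
  | 0 => fun f => f 0
  | m'.+1 => fun f => (\int[lebesgue_measure]_t
      leb_integral (fun v : 'rV[R]_m' => f (row_mx (t%:M : 'rV[R]_1) v)))%E
  end.

Definition leb_volume {R : realType} (m : nat) (F : set 'rV[R]_m) : \bar R :=
  leb_integral (fun x => (\1_F x)%:E).

(* The volume is the same for all fundamental domains. *)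
Definition popp_measure {R : realType} {n : nat}
    (M : sr_metric R n) (G : set (heis R n)) : \bar R :=
  ((popp_density M)%:E *
   leb_volume (get [set F | fundamental_domain G F]))%E.

Definition hausdorff_dist {R : realType} (Z : metricType R) (A B : set Z) :
    \bar R :=
  maxe (ereal_sup [set ereal_inf [set (mdist a b)%:E | b in B] | a in A])
       (ereal_sup [set ereal_inf [set (mdist a b)%:E | a in A] | b in B]).

(* Metric spaces are given here by a carrier and a distance function, which
   may take the value +oo; with a +oo distance there is no embedding. *)
Definition gh_dist {R : realType} (X : Type) (dX : X -> X -> \bar R)
    (Y : Type) (dY : Y -> Y -> \bar R) : \bar R :=
  ereal_inf [set r | exists (Z : metricType R) (f : X -> Z) (g : Y -> Z),
    [/\ (forall x x', (mdist (f x) (f x'))%:E = dX x x'),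
        (forall y y', (mdist (g y) (g y'))%:E = dY y y') &
        r = hausdorff_dist (range f) (range g)]].

(* Main.v *)
Require Import Defs.
From HB Require Import structures.
From mathcomp Require Import all_boot all_order all_algebra fingroup perm.
From mathcomp Require Import all_classical all_reals all_analysis.
From mathcomp Require Import measurable_realfun.
From mathcomp Require Import ring lra zify.

Set Implicit Arguments.
Unset Strict Implicit.
Unset Printing Implicit Defensive.

Import Order.TTheory GRing.Theory Num.Theory.
Import numFieldNormedType.Exports.

Local Open Scope classical_set_scope.
Local Open Scope ring_scope.

(* In orthonormal coordinates of the horizontal space, a lattice Gamma_k has
   generators whose projections form a matrix A_k, bounded because of the diameter
   bound.  Let W_k be the symplectic form in these coordinates divided by the
   generator of the centre of Gamma_k.  The volume of a fundamental domain is at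
   most |det A_k| times this generator, so the lower bound on the Popp measure
   bounds W_k.  The commutators of the generators give an integer matrix
   N_k = A_k W_k A_k^T, invertible and bounded, hence constant along an
   ultrafilter.  Two lattices with the same N_k are related by an affine
   isomorphism of H_n preserving the horizontal spaces, so all the Gamma_k in
   question can be replaced by a single Gamma' and a single horizontal space, on
   which only the scalar product varies.  It is determined by A_k, and A_k
   converges along the ultrafilter to a matrix which is invertible because N_k is:
   the limit scalar product is (1 + o(1))-comparable with the k-th one, and so are
   the distances.  Therefore X is approximated arbitrarily well by the quotient
   with the limit metric, and an ultralimit of approximations is an isometry. *)

(** * Absolutely continuous functions *)

(** Bounded diameter alone allows collapse: the projected generators may degenerate while all [A_k]
    stay bounded. The two hypotheses meet in the integrality of [N_k]: its determinant is a nonzero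
    integer, so |det A_k|^2 |det W_k| >= 1, and upper bounds on [A_k] and [W_k] become lower bounds
    on their determinants. The same identity gives A_k^-1 = W_k A_k^T N_k^-1, so the inverses
    converge together with the matrices.

    Two features of the definitions shape the analysis. Length is the integral of a speed whose
    measurability is not established, so every lower bound on lengths goes through an inequality for
    absolutely continuous functions with an arbitrary nonnegative majorant of the derivative. Volume
    is an iterated integral, so volumes are estimated through maps and boxes that are triangular in
    the coordinates, where slicing reduces everything to one variable.

    The limit keeps the horizontal space of one of the metrics of the sequence, so it stays bracket
    generating. *)

Section Integrals.
Import HBNNSimple.
Context {R : realType}.
Local Notation leb := (@lebesgue_measure R).

(** The integral of a nonnegative function is a supremum over simple functions, so neither [f] nor
    [g] has to be measurable: a simple function below [f], divided by [K] and set to 0 on the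
    exceptional null set, lies below [g]. *)
Lemma ae_le_integral (D : set R) (f g : R -> R) (K : R) : 0 < K ->
  (forall t, 0 <= f t) -> (forall t, 0 <= g t) ->
  {ae leb, forall t, D t -> f t <= K * g t} ->
  (\int[leb]_(t in D) (f t)%:E <= K%:E * \int[leb]_(t in D) (g t)%:E)%E.
Proof.
move=> K0 f0 g0 [N [mN N0 subN]].
rewrite (@ge0_integralE _ _ _ leb D (EFin \o f)); last by move=> x _; rewrite lee_fin f0.
rewrite (@ge0_integralE _ _ _ leb D (EFin \o g)); last by move=> x _; rewrite lee_fin g0.
apply: ge_ereal_sup => _ [h /= hf <-].
have mCN := measurableC mN.
have Ki0 : 0 <= K^-1 by rewrite invr_ge0 ltW.
pose h' := scale_nnsfun (proj_nnsfun h mCN) Ki0.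
have -> : sintegral leb h = (K%:E * sintegral leb h')%E.
  have mh (k : {nnsfun _ >-> R}) :
    measurable_fun setT (EFin \o (k : measurableTypeR R -> R)).
    exact/measurable_EFinP.
  have h0 (k : {nnsfun _ >-> R}) x : (0 <= ((k : measurableTypeR R -> R) x)%:E)%E.
    by rewrite lee_fin.
  rewrite -!integralT_nnsfun.
  rewrite (ge0_negligible_integral mN measurableT (mh h) (fun x _ => h0 h x) N0).
  rewrite -(ge0_integralZl leb measurableT (mh h') (fun x _ => h0 _ x)) ?lee_fin ?ltW//.
  rewrite integral_mkcond; apply: eq_integral => x _.
  rewrite patchE /= mindicE setTD.
  case: ifP => _; first by rewrite -EFinM /= mulr1 mulrA divff ?gt_eqF// mul1r.
  by rewrite -EFinM mulr0 mulr0 mulr0.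
rewrite lee_pmul2l ?lte_fin//.
apply: ereal_sup_ubound; exists h' => //= x.
rewrite mindicE patchE.
case: (boolP (x \in ~` N)) => xN; last first.
  by rewrite mulr0 mulr0; case: ifP; rewrite ?lee_fin.
rewrite mulr1; have := hf x; rewrite patchE.
case: ifP => xD; rewrite !lee_fin; last first.
  move=> hx0; have -> : h x = 0 by apply/eqP; rewrite eq_le hx0 /=.
  by rewrite mulr0.
move=> /le_trans H; rewrite ler_pdivrMl//; apply: H.
apply: contrapT => nfg; move: xN; rewrite inE; apply; apply: subN => /= H.
by apply: nfg; apply: H; rewrite inE in xD.
Qed.

(** At the supremum x of the points where [P] holds, a point s just to the left satisfies [P], and
    the step carries it across x. The step only compares points on the two sides of x, because later
    only increments around a fixed point are controlled. *)
Lemma real_induction (P : R -> Prop) (a b : R) : a <= b -> P a ->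
  (forall x, a <= x <= b -> exists2 d, 0 < d & forall s t,
     a <= s <= x -> x <= t <= b -> x - d < s -> t < x + d -> P s -> P t) ->
  P b.
Proof.
move=> ab Pa step.
pose S := [set t | a <= t <= b /\ P t].
have Sa : S a by split => //; rewrite lexx.
have ubS : ubound S b by move=> t [/andP[]].
have supS : has_sup S by split; [exists a|exists b].
set x := sup S.
have xab : a <= x <= b.
  by apply/andP; split; [apply: ub_le_sup => //; exists b|apply: ge_sup => //; exists a].
have [d d0 Hd] := step x xab.
have [s [sab Ps] xs] := sup_adherent d0 supS.
have sx : s <= x by apply: ub_le_sup; [exists b|].
case/andP: xab => ax xb; case/andP: sab => as_ sb.
have Px t : x <= t <= b -> t < x + d -> P t.
  by move=> xt td; apply: (Hd s t) => //; rewrite as_.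
have [xd|xd] := leP (x + d) b; last by apply: Px => //; rewrite xb lexx.
have St : S (x + d / 2).
  split; last by apply: Px; lra.
  by apply/andP; split; lra.
have : x + d / 2 <= x by apply: ub_le_sup => //; exists b.
lra.
Qed.
End Integrals.

Section AbsoluteContinuity.
Context {R : realType}.
Local Notation leb := (@lebesgue_measure R).

(** [abs_continuous] with values in any normed space, to be applied to real functions of a path as
    well. *)
Definition ac (V : normedModType R) (a b : R) (c : R -> V) : Prop :=
  forall e : R, 0 < e -> exists2 d : R, 0 < d &
    forall s : seq (R * R),
      all (fun p => [&& a <= p.1, p.1 <= p.2 & p.2 <= b]) s ->
      pairwise (fun p q => p.2 <= q.1) s ->
      \sum_(p <- s) (p.2 - p.1) < d ->
      \sum_(p <- s) `|c p.2 - c p.1| < e.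

Lemma measure_itv_split (nu : {measure set (measurableTypeR R) -> \bar R})
    (a s t : R) : a <= s -> s <= t ->
  nu `]a, t]%classic = (nu `]a, s]%classic + nu `]s, t]%classic)%E.
Proof.
move=> as_ st; rewrite -measureU; last 3 first.
- exact: measurable_itv.
- exact: measurable_itv.
- apply/seteqP; split => // x [] /=; rewrite !in_itv /= => /andP[_ xs] /andP[sx _].
  by move: (lt_le_trans sx xs); rewrite ltxx.
congr (nu _); apply/seteqP; split => x /=; rewrite !in_itv /=.
  move=> /andP[ax xt]; have [xs|sx] := leP x s; [left|right].
    by rewrite ?ax ?xs.
  by rewrite ?sx ?xt.
by case=> /andP[? ?]; apply/andP; split; lra.
Qed.

Lemma itv_diff_open (O : set R) (t : R) : open O -> O t ->
  exists2 d, 0 < d & forall s s', t - d < s -> s <= s' -> s' < t + d ->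
    `]s, s'] `<=` O.
Proof.
move=> oO Ot.
have /nbhs_ballP[d /= d0 dO] : nbhs t O by apply: open_nbhs_nbhs.
exists d => // s s' ds ss' s'd x /=; rewrite in_itv /= => /andP[sx xs'].
apply: dO; rewrite /ball /= ltr_distlC; apply/andP; split; lra.
Qed.

(** Real induction on t, carrying a finite family of intervals in [a, t] of total length at most
    that of N in ]a, t], such that the increment of [f] is at most nu ]a, t] plus the increments
    over the family. Around a point of [N] the new interval joins the family; elsewhere its
    increment is paid by [nu]. At b the family is shorter than [dN], so absolute continuity bounds
    its share by e. *)
Lemma ac_measure_bound (a b e : R) (f : R -> R)
    (nu : {measure set (measurableTypeR R) -> \bar R}) (N : set R) (dN : R) :
  a <= b -> 0 < e -> open N -> (leb N < dN%:E)%E ->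
  (forall s : seq (R * R),
      all (fun p => [&& a <= p.1, p.1 <= p.2 & p.2 <= b]) s ->
      pairwise (fun p q => p.2 <= q.1) s ->
      \sum_(p <- s) (p.2 - p.1) < dN ->
      \sum_(p <- s) `|f p.2 - f p.1| < e) ->
  (forall t, a <= t <= b -> N t \/ exists c d, [/\ 0 < d,
      (forall s, a <= s <= b -> `|s - t| < d -> `|f s - f t| <= c * `|s - t|) &
      (forall s s', t - d < s -> s <= s' -> s' < t + d ->
         ((c * (s' - s))%:E <= nu `]s, s']%classic)%E)]) ->
  (`|f b - f a|%:E <= nu `]a, b]%classic + e%:E)%E.
Proof.
move=> ab e0 oN Nlt acf loc.
have mN : measurable (N : set (measurableTypeR R)) by exact: open_measurable.
pose lN := [the {measure set (measurableTypeR R) -> \bar R} of mrestr leb mN].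
pose P t := exists s : seq (R * R), [/\
  all (fun p => [&& a <= p.1, p.1 <= p.2 & p.2 <= t]) s,
  pairwise (fun p q => p.2 <= q.1) s,
  ((\sum_(p <- s) (p.2 - p.1))%:E <= lN `]a, t]%classic)%E &
  (`|f t - f a|%:E <= nu `]a, t]%classic + (\sum_(p <- s) `|f p.2 - f p.1|)%:E)%E].
suff [s [sall spair slen sf]] : P b.
  apply: (le_trans sf); apply: leeD2l; rewrite lee_fin ltW//.
  apply: acf => //; rewrite -lte_fin; apply: le_lt_trans slen _.
  apply: le_lt_trans Nlt; rewrite /= /mrestr; apply: le_measure; rewrite ?inE//.
  by apply: measurableI => //; exact: measurable_itv.
apply: (@real_induction R P a b ab).
  exists [::]; split => //.
  - by rewrite big_nil.
  - by rewrite big_nil adde0 subrr normr0.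
move=> x axb; case: (loc x axb) => [Nx|].
  have [d d0 Hd] := itv_diff_open oN Nx.
  exists d => // s t /andP[as_ sx] /andP[xt tb] ds td [l [lall lpair llen lf]].
  have st : s <= t by apply: le_trans xt.
  exists (rcons l (s, t)); split.
  - rewrite all_rcons /= as_ st lexx /=; apply: sub_all lall => p /and3P[-> -> /=].
    by move=> /le_trans; apply.
  - rewrite pairwise_rcons lpair andbT; apply: sub_all lall => p /=.
    by move=> /and3P[].
  - rewrite big_rcons /= EFinD (measure_itv_split _ as_ st); apply: leeD => //.
    have -> : lN `]s, t]%classic = leb `]s, t]%classic.
      by congr (leb _); rewrite setIidl//; exact: (Hd s t).
    rewrite lebesgue_measure_itv /=; case: ifPn => //.
    by rewrite lte_fin -leNgt => ts; rewrite lee_fin subr_le0.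
  - rewrite big_rcons /= (measure_itv_split _ as_ st) EFinD.
    apply: (@le_trans _ _ ((`|f t - f s|)%:E + (`|f s - f a|)%:E)%E).
      rewrite -EFinD lee_fin; apply: le_trans (ler_normD _ _).
      by rewrite addrA subrK.
    rewrite addeA [leRHS]addeC; apply: leeD => //; apply: le_trans lf _.
    by apply: leeD => //; rewrite leeDl.
move=> [c [d [d0 fd nud]]].
exists d => // s t /andP[as_ sx] /andP[xt tb] ds td [l [lall lpair llen lf]].
have st : s <= t by apply: le_trans xt.
exists l; split => //.
- by apply: sub_all lall => p /and3P[-> -> /=] /le_trans; apply.
- by apply: le_trans llen _; rewrite (measure_itv_split _ as_ st) leeDl.
- rewrite (measure_itv_split _ as_ st).
  apply: (@le_trans _ _ ((`|f t - f s|)%:E + (`|f s - f a|)%:E)%E).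
    rewrite -EFinD lee_fin; apply: le_trans (ler_normD _ _).
    by rewrite addrA subrK.
  rewrite addeC -addeA [X in (_ <= _ + X)%E]addeC addeA; apply: leeD => //.
  apply: le_trans (nud s t ds st td); rewrite lee_fin.
  apply: le_trans (ler_distD (f x) _ _) _.
  rewrite [`|f x - _|]distrC.
  have h1 : `|f t - f x| <= c * `|t - x|.
    by apply: fd; [apply/andP; split => //; lra|rewrite ger0_norm; lra].
  have h2 : `|f s - f x| <= c * `|s - x|.
    by apply: fd; [apply/andP; split => //; lra|rewrite distrC ger0_norm; lra].
  apply: le_trans (lerD h1 h2) _.
  rewrite ger0_norm ?subr_ge0// distrC ger0_norm ?subr_ge0//.
  by rewrite -mulrDr; have -> : t - x + (x - s) = t - s by ring.
Qed.

End AbsoluteContinuity.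

Section DerivativeMeasurable.
Context {R : realType}.
Local Notation leb := (@lebesgue_measure R).

Lemma ac_unif (V : normedModType R) (a b : R) (f : R -> V) : ac a b f ->
  forall e, 0 < e -> exists2 d, 0 < d & forall s t, a <= s <= b -> a <= t <= b ->
    `|s - t| < d -> `|f s - f t| < e.
Proof.
move=> acf e e0; have [d d0 Hd] := acf e e0; exists d => //.
have main s t : a <= s <= b -> a <= t <= b -> s <= t -> `|s - t| < d ->
    `|f s - f t| < e.
  move=> /andP[as_ sb] /andP[at_ tb] st; rewrite distrC ger0_norm ?subr_ge0// => std.
  have := Hd [:: (s, t)]; rewrite /= !big_seq1 /= as_ st tb /= distrC; exact.
move=> s t sab tab std; have [st|/ltW ts] := leP s t; first exact: main.
by rewrite distrC; apply: main => //; rewrite distrC.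
Qed.

(** Composition with [clamp a b] extends a function on [a, b] to the line by its end values,
    preserving continuity. *)
Definition clamp (a b t : R) := Num.max a (Num.min t b).

Lemma clamp_itv a b t : a <= b -> a <= clamp a b t <= b.
Proof.
by move=> ab; rewrite /clamp le_max lexx /= ge_max ab ge_min lexx orbT.
Qed.

Lemma clamp_id a b t : a <= t <= b -> clamp a b t = t.
Proof.
by move=> /andP[at_ tb]; rewrite /clamp min_l// max_r.
Qed.

Lemma clamp_lip a b s t : a <= b -> `|clamp a b s - clamp a b t| <= `|s - t|.
Proof.
move=> ab; rewrite /clamp; apply: (@le_trans _ _ `|Num.min s b - Num.min t b|).
  move: (Num.min s b) (Num.min t b) => x y.
  have := ler_norm (x - y); have := ler_norm (- (x - y)); rewrite normrN ler_norml.
  by move=> ? ?; have [?|?] := leP a x; have [?|?] := leP a y; apply/andP; split; lra.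
have := ler_norm (s - t); have := ler_norm (- (s - t)); rewrite normrN ler_norml.
by move=> ? ?; have [?|?] := leP s b; have [?|?] := leP t b; apply/andP; split; lra.
Qed.

Lemma ac_clamp_continuous (a b : R) (f : R -> R) : a <= b -> ac a b f ->
  continuous (fun t => f (clamp a b t)).
Proof.
move=> ab acf t; apply/cvgrPdist_lt => e e0.
have [d d0 Hd] := ac_unif acf e0.
near=> s; apply: Hd; rewrite ?clamp_itv//.
apply: le_lt_trans (clamp_lip _ _ ab) _.
near: s; exact: (@cvgr_dist_lt _ _ _ _ _ id t _ d).
Unshelve. all: by end_near.
Qed.

Lemma derivable_cvg (V : normedModType R) (f : R -> V) t : derivable f t 1 ->
  (fun h => h^-1 *: (f (h + t) - f t)) @ 0^' --> derive1 f t.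
Proof.
rewrite /derive1 /derivable.
set d := (fun _ : R => _); set d' := (fun _ : R => _).
suff -> : d = d' by [].
by rewrite funeqE => k; rewrite /d /d' /= [k%:A]mulr1.
Qed.

(** The derivative is the pointwise limit of the difference quotients with steps 1 / (m + 1) of the
    continuous extension; at a point of ]a, b[ these steps eventually end inside [a, b]. *)
Lemma ac_measurable_derive (a b : R) (f : R -> R) (E : set R) :
  a <= b -> ac a b f -> E `<=` `]a, b[ ->
  (forall t, E t -> derivable f t 1) ->
  measurable_fun (E : set (measurableTypeR R)) (derive1 f).
Proof.
move=> ab acf Eab df.
pose F (t : R) := f (clamp a b t).
have cF := ac_clamp_continuous ab acf.
have mF : measurable_fun setT (F : measurableTypeR R -> measurableTypeR R).
  exact: continuous_measurable_fun.
pose h (m : nat) (t : R) := m.+1%:R * (F (t + m.+1%:R^-1) - F t).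
apply: (@measurable_fun_cvg _ _ _ _ h) => [m|t Et].
  apply: measurable_funM => //; apply: measurable_funB.
    apply: measurable_funTS.
    apply: (measurableT_comp mF).
    by apply: measurable_funD => //; exact: measurable_cst.
  exact: measurable_funTS.
have dft := derivable_cvg (df t Et).
have inv0 : (fun m : nat => m.+1%:R^-1 : R) @ \oo --> 0^'.
  move=> A /nbhs_ballP [e /= e0 eA].
  suff : \forall m \near \oo, A (m.+1%:R^-1) by [].
  near=> m; apply: eA => /=; last first.
    by rewrite invr_eq0 pnatr_eq0.
  rewrite /ball /= sub0r normrN ger0_norm ?invr_ge0//.
  near: m; exact: near_infty_natSinv_lt (PosNum e0).
have := cvg_comp _ _ inv0 dft; apply: cvg_trans; apply: near_eq_cvg.
have /Eab := Et; rewrite /= in_itv /= => /andP[at_ tb].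
near=> m; rewrite /h /F /= invrK clamp_id; last first.
  have : m.+1%:R^-1 < b - t.
    near: m; rewrite -subr_gt0 in tb; exact: near_infty_natSinv_lt (PosNum tb).
  have : 0 < m.+1%:R^-1 :> R by rewrite invr_gt0.
  move: (m.+1%:R^-1) => x ? ?; apply/andP; split; lra.
have -> : clamp a b t = t by apply: clamp_id; rewrite (ltW at_) (ltW tb).
by rewrite [t + _]addrC.
Unshelve. all: by end_near.
Qed.
End DerivativeMeasurable.

Section AcIntegral.
Context {R : realType}.
Local Notation leb := (@lebesgue_measure R).

(* The level set A_j of points where j eta <= |f'| < (j + 1) eta is covered by an
   open set O_j of almost the same measure.  The measure nu with density
   (j + 2) eta on O_j bounds the increments of f near the points of A_j, absolute
   continuity bounds those near the exceptional null set, and real induction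
   chains them up. *)
Lemma ac_le_integral_eta (a b eta : R) (f h : R -> R) : a <= b -> 0 < eta ->
  ac a b f -> (forall t, 0 <= h t) ->
  {ae leb, forall t, t \in `]a, b[ -> derivable f t 1 /\ `|derive1 f t| <= h t} ->
  (`|f b - f a|%:E <= \int[leb]_(t in `[a, b]) (h t)%:E +
     (2 * eta * (b - a) + eta + eta)%:E)%E.
Proof.
move=> ab eta0 acf h0 [N0 [mN0 lN0 badN0]].
pose E : set (measurableTypeR R) := `]a, b[ `\` N0.
have mE : measurable E by apply: measurableD => //; exact: measurable_itv.
have EP t : E t -> derivable f t 1 /\ `|derive1 f t| <= h t.
  move=> [tab tN]; apply: contrapT => bad; apply: tN; apply: badN0 => /= good.
  by apply: bad; apply: good.
have mf' : measurable_fun E (derive1 f : measurableTypeR R -> R).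
  apply: (ac_measurable_derive ab acf); first by move=> t [].
  by move=> t /EP[].
pose g (t : measurableTypeR R) := `|derive1 f t|.
have mg : measurable_fun E (g : measurableTypeR R -> R).
  by apply: measurableT_comp => //.
pose A (j : nat) : set (measurableTypeR R) :=
  E `&` g @^-1` `[j%:R * eta, j.+1%:R * eta[.
have mA j : measurable (A j) by apply: mg => //; exact: measurable_itv.
have lA j : (leb (A j) < +oo)%E.
  apply: (@le_lt_trans _ _ (leb `]a, b[%classic)).
    by apply: le_measure; rewrite ?inE// => t [[]].
  by rewrite lebesgue_measure_itv /=; case: ifP => _; rewrite -?EFinB ltry.
(* On [A j] the derivative is below (j + 1) eta in absolute value; one more eta absorbs the error of
   the difference quotient. *)
pose c (j : nat) := j.+2%:R * eta.
have c0 j : 0 < c j by rewrite mulr_gt0.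
(* With this excess, the part of [Oj j] outside [A j] has weight at most eta / 2^(j+1) for the
   density [c j], hence eta over all j. *)
have /choice [Oj OP] : forall j, exists U, [/\ open U, A j `<=` U &
    (leb (U `\` A j) < (eta / (2 ^ j.+1)%:R / c j)%:E)%E].
  move=> j; have e0 : 0 < eta / (2 ^ j.+1)%:R / c j.
    by rewrite divr_gt0// divr_gt0// ltr0n expn_gt0.
  exact: (@lebesgue_regularity_outer R (A j) _ (mA j) (lA j) e0).
have mO j : measurable (Oj j : set (measurableTypeR R)).
  by apply: open_measurable; case: (OP j).
pose nuj j : {measure set (measurableTypeR R) -> \bar R} :=
  mscale (NngNum (ltW (c0 j))) (mrestr leb (mO j)).
pose nu : {measure set (measurableTypeR R) -> \bar R} := mseries nuj 0.
have [dN dN0 acd] := acf eta eta0.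
(* No bound on the derivative is known on [Z]; being null, it lies in an open set of measure less
   than [dN]. *)
pose Z : set (measurableTypeR R) := N0 `|` ([set a] `|` [set b]).
have mZ : measurable Z.
  by apply: measurableU => //; apply: measurableU; exact: measurable_set1.
have lZ : leb Z = 0%E.
  have ms1 (x : R) : measurable ([set x] : set (measurableTypeR R)).
    exact: measurable_set1.
  have ls1 (x : R) : leb [set x] = 0%E by exact: lebesgue_measure_set1.
  have m2 := measurableU _ _ (ms1 a) (ms1 b).
  exact: (null_set_setU mN0 m2 lN0 (null_set_setU (ms1 a) (ms1 b) (ls1 a) (ls1 b))).
have [N [oN ZN lN]] : exists U, [/\ open U, Z `<=` U & (leb (U `\` Z) < dN%:E)%E].
  have lZo : (leb Z < +oo)%E by rewrite lZ ltry.
  exact: (@lebesgue_regularity_outer R Z _ mZ lZo dN0).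
have {}lN : (leb N < dN%:E)%E.
  apply: le_lt_trans lN; rewrite -(setDUK ZN).
  have mN : measurable (N : set (measurableTypeR R)) by exact: open_measurable.
  apply: (@le_trans _ _ (leb Z + leb (N `\` Z))%E).
    by apply: measureU2 => //; exact: measurableD.
  by rewrite lZ add0e setDUK.
have nuge j s s' : s <= s' -> `]s, s'] `<=` Oj j ->
    ((c j * (s' - s))%:E <= nu `]s, s']%classic)%E.
  move=> ss' sO; rewrite /nu /= /mseries.
  rewrite (@nneseriesD1 R _ j xpredT)//.
  have -> : nuj j `]s, s']%classic = (c j * (s' - s))%:E.
    have -> : nuj j `]s, s']%classic = ((c j)%:E * leb (`]s, s'] `&` Oj j))%E by [].
    rewrite setIidl// [RHS]EFinM; congr (_ * _)%E.
    rewrite lebesgue_measure_itv /=; case: ifPn => //.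
    rewrite lte_fin -leNgt => s's.
    by have -> : s = s' by [apply/eqP; rewrite eq_le ss' s's]; rewrite subrr.
  by rewrite leeDl//; exact: nneseries_ge0.
(* [c j] is at most [g + 2 * eta] on [A j]; the last eta is the total excess of the sets [Oj j]. *)
have nab : (nu `]a, b]%classic <= \int[leb]_(t in E) (g t + 2 * eta)%:E + eta%:E)%E.
  have -> : E = \bigcup_j A j.
    apply/seteqP; split => [t Et|t [j _ []//]].
    exists (Num.truncn (g t / eta)) => //; split => //.
    have /andP[gj gj1] := truncn_itv (divr_ge0 (normr_ge0 (derive1 f t)) (ltW eta0)).
    by rewrite /= in_itv /= -ler_pdivlMr// -ltr_pdivrMr// gj.
  have mg2 : measurable_fun E (fun t => (g t + 2 * eta)%:E).
    by apply/measurable_EFinP; apply: measurable_funD => //; exact: measurable_cst.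
  have g20 t : (0 <= (g t + 2 * eta)%:E)%E.
    by rewrite lee_fin; apply: addr_ge0; [exact: normr_ge0|rewrite mulr_ge0// ltW].
  have AE : \bigcup_j A j `<=` E by move=> t [j _ []].
  rewrite ge0_integral_bigcup//; last 2 first.
  - by apply: measurable_funS AE _ => //; exact: bigcup_measurable.
  - apply/trivIsetP => i j _ _ ij; apply/seteqP; split => // t [[_ +] [_ +]].
    rewrite /= !in_itv /= -!ler_pdivlMr// -!ltr_pdivrMr// => ti tj.
    by move/eqP: ij; apply; rewrite -(truncn_def ti) -(truncn_def tj).
  apply: le_trans (epsilon_trick xpredT _ (ltW eta0)); last first.
    by move=> j; exact: integral_ge0.
  rewrite /nu /= /mseries; apply: lee_nneseries => // j _.
  have -> : nuj j `]a, b]%classic = ((c j)%:E * leb (`]a, b] `&` Oj j))%E by [].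
  have [oO AO lO] := OP j.
  apply: (@le_trans _ _ ((c j)%:E * (leb (A j) + (eta / (2 ^ j.+1)%:R / c j)%:E))%E).
    rewrite lee_pmul2l ?lte_fin//.
    apply: (@le_trans _ _ (leb (Oj j))).
      by apply: le_measure; rewrite ?inE//; apply: measurableI.
    apply: (@le_trans _ _ (leb (A j) + leb (Oj j `\` A j))%E).
      rewrite -{1}(setDUK AO); apply: measureU2 => //; exact: measurableD.
    by apply: leeD => //; exact: ltW.
  rewrite muleDr// ?fin_num_adde_defl//; apply: leeD; last first.
    by rewrite -EFinM mulrCA divff ?gt_eqF// mulr1.
  rewrite -integral_cst//; apply: ge0_le_integral => //.
  - by move=> t _; rewrite lee_fin ltW.
  - by apply: measurable_funS mg2 => // t [].
  - move=> t [_]; rewrite /= in_itv /= => /andP[jg _].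
    by rewrite lee_fin /c -[j.+2]addn2 natrD mulrDl lerD2r.
have := @ac_measure_bound R a b eta f nu N dN ab eta0 oN lN acd.
have loc t : a <= t <= b -> N t \/ exists c d, [/\ 0 < d,
      (forall s, a <= s <= b -> `|s - t| < d -> `|f s - f t| <= c * `|s - t|) &
      (forall s s', t - d < s -> s <= s' -> s' < t + d ->
         ((c * (s' - s))%:E <= nu `]s, s']%classic)%E)].
  move=> /andP[at_ tb]; have [Zt|NZt] := pselect (Z t); [left; exact: ZN|right].
  have Et : E t.
    split; last by move=> ?; apply: NZt; left.
    rewrite /= in_itv /= !lt_neqAle at_ tb !andbT; apply/andP; split; apply/eqP => tE.
      by apply: NZt; right; left.
    by apply: NZt; right; right.
  have [dft _] := EP t Et.
  pose j := Num.truncn (g t / eta).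
  have /andP[gj gj1] : j%:R <= g t / eta < j.+1%:R.
    by apply: truncn_itv; apply: divr_ge0; [exact: normr_ge0|exact: ltW].
  have At : A j t.
    by split => //; rewrite /= in_itv /= -ler_pdivlMr// -ltr_pdivrMr// gj.
  have [oO /(_ _ At) Ot _] := OP j.
  have [d1 d10 Hd1] := itv_diff_open oO Ot.
  have [d2 d20 Hd2] : exists2 d, 0 < d &
      forall s, `|s - t| < d -> `|f s - f t| <= c j * `|s - t|.
    have := derivable_cvg dft => /cvgrPdist_lt/(_ _ eta0) /nbhs_ballP[d /= d0 Hd].
    exists d => // s std; have [->|st] := eqVneq s t.
      by rewrite !subrr normr0 mulr0.
    have st0 : s - t != 0 by rewrite subr_eq0.
    have := Hd (s - t); rewrite /ball /= sub0r normrN => /(_ std st0).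
    rewrite subrK => Hs; rewrite -ler_pdivrMr ?normr_gt0// mulrC -normfV -normrM.
    have : `|(s - t)^-1 * (f s - f t)| < g t + eta.
      rewrite -[X in `|X|](subrK (derive1 f t)).
      by apply: le_lt_trans (ler_normD _ _) _; rewrite addrC ltrD2l distrC.
    move=> /ltW/le_trans; apply; rewrite /c.
    move: gj1; rewrite ltr_pdivrMr// => /ltW gj1.
    by rewrite -[j.+2]addn1 natrD mulrDl mul1r lerD2r.
  exists (c j), (Num.min d1 d2); split; first by rewrite lt_min d10.
    by move=> s _; rewrite lt_min => /andP[_]; exact: Hd2.
  move=> s s' ds ss' s'd; apply: nuge => //; apply: Hd1 => //.
    by apply: le_lt_trans ds; rewrite lerD2l lerN2 ge_min lexx.
  by apply: lt_le_trans s'd _; rewrite lerD2l ge_min lexx.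
move=> /(_ loc) /le_trans; apply; rewrite !EFinD !addeA; apply: leeD => //.
apply: (le_trans nab); apply: leeD => //.
have mge : measurable_fun E (EFin \o g) by exact/measurable_EFinP.
have g0 t : E t -> (0 <= (EFin \o g) t)%E by move=> _; rewrite lee_fin normr_ge0.
have e20 t : E t -> (0 <= (cst (2 * eta)%:E : R -> \bar R) t)%E.
  by move=> _; rewrite lee_fin mulr_ge0// ltW.
have -> : (\int[leb]_(t in E) (g t + 2 * eta)%:E =
    \int[leb]_(t in E) (g t)%:E + (2 * eta)%:E * leb E)%E.
  under eq_integral do rewrite EFinD.
  rewrite (ge0_integralD leb mE g0 mge e20 (measurable_cst _)).
  by rewrite integral_cst.
apply: leeD; last first.
  rewrite [leRHS]EFinM lee_pmul2l ?lte_fin ?mulr_gt0//.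
  apply: (@le_trans _ _ (leb `]a, b[%classic)).
    by apply: le_measure; rewrite ?inE// => t [].
  by rewrite lebesgue_measure_itv /=; case: ifP => //; rewrite lee_fin subr_ge0.
(* [g] is bounded by [h] only on [E]; setting it to 0 elsewhere makes the comparison hold at every
   point. *)
pose g' t := if t \in E then g t else 0.
have -> : (\int[leb]_(t in E) (g t)%:E = \int[leb]_(t in `[a, b]) (g' t)%:E)%E.
  rewrite [LHS]integral_mkcond [RHS]integral_mkcond; apply: eq_integral => t _.
  rewrite !patchE /g'; case: (boolP (t \in E)) => tE; last by case: ifP.
  rewrite ifT// inE /=; move: tE; rewrite inE => -[+ _].
  by rewrite /= !in_itv /= => /andP[at_ tb]; rewrite !ltW.
rewrite -[leRHS]mul1e; apply: ae_le_integral => //.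
  by move=> t; rewrite /g'; case: ifP => // _; exact: normr_ge0.
apply: aeW => t _; rewrite mul1r /g'; case: ifPn => //.
by rewrite inE => /EP[].
Qed.

(** The source of all lower bounds on lengths: [h] will be a multiple of the speed of a horizontal
    path, and [f] a linear function of the path. *)
Lemma ac_le_integral (a b : R) (f h : R -> R) : a <= b ->
  ac a b f -> (forall t, 0 <= h t) ->
  {ae leb, forall t, t \in `]a, b[ -> derivable f t 1 /\ `|derive1 f t| <= h t} ->
  (`|f b - f a|%:E <= \int[leb]_(t in `[a, b]) (h t)%:E)%E.
Proof.
move=> ab acf h0 aeP; apply/lee_addgt0Pr => e e0.
have k0 : 0 < 2 * (b - a) + 2 by lra.
have /(ac_le_integral_eta ab)/(_ acf h0 aeP) : 0 < e / (2 * (b - a) + 2).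
  exact: divr_gt0.
move=> /le_trans; apply; apply: leeD => //; rewrite lee_fin.
by rewrite le_eqVlt; apply/orP; left; apply/eqP; field; rewrite gt_eqF.
Qed.
End AcIntegral.

(** * Borel sets and iterated integrals on row vectors *)

Section RowVectors.
Context {R : realType}.

Lemma coord_le_norm m (x : 'rV[R]_m) i : `|x 0 i| <= `|x|.
Proof.
rewrite [leRHS]mx_normrE.
exact: (le_bigmax _ (fun ij : 'I_1 * 'I_m => `|x ij.1 ij.2|) (0, i)).
Qed.

Lemma norm_le_coord m (x : 'rV[R]_m) e : 0 <= e ->
  (forall i, `|x 0 i| <= e) -> `|x| <= e.
Proof.
move=> e0 xe; rewrite [leLHS]mx_normrE; apply: bigmax_le => // -[i j] _ /=.
by rewrite (ord1 i).
Qed.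

Lemma norm_lt_coord m (x : 'rV[R]_m) e : 0 < e ->
  (forall i, `|x 0 i| < e) -> `|x| < e.
Proof.
move=> e0 xe; rewrite [ltLHS]mx_normrE; apply: bigmax_lt => // -[i j] _ /=.
by rewrite (ord1 i).
Qed.

Definition borelRV m := g_sigma_algebraType [set U : set 'rV[R]_m | open U].

Lemma borel_open m (U : set 'rV[R]_m) : open U -> measurable (U : set (borelRV m)).
Proof. exact: sub_gen_smallest. Qed.

Lemma borel_continuous m (f : 'rV[R]_m -> R) : continuous f ->
  measurable_fun setT (f : borelRV m -> measurableTypeR R).
Proof.
move=> /continuousP cf; apply: (measurability _ (RGenOpens.measurableE R)).
move=> _ [_ [a [b ->] <-]]; rewrite setTI; apply: borel_open.
exact/cf/interval_open.
Qed.

Lemma rat_ball m (x : 'rV[R]_m) (e : R) : 0 < e ->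
  exists q : 'rV[rat]_m * rat, [/\ 0 < ratr q.2 :> R,
    `|x - map_mx ratr q.1| < ratr q.2 :> R & ratr q.2 < e].
Proof.
move=> e0; have [r] := rat_in_itvoo e0; rewrite in_itv /= => /andP[r0 re].
have /choice [q Hq] : forall i, exists q : rat, `|x 0 i - ratr q| < ratr r :> R.
  move=> i; have xi : x 0 i < x 0 i + ratr r by rewrite ltrDl.
  have [q] := rat_in_itvoo xi; rewrite in_itv /= => /andP[q1 q2]; exists q.
  by rewrite ltr_distlC; apply/andP; split; lra.
exists (\row_i q i, r); split => //=.
by apply: norm_lt_coord => // i; rewrite !mxE.
Qed.

(** An open set is the union of the countably many rational balls it contains, and a ball of the sup
    norm is a product of intervals. *)
Lemma measurable_row d (T : measurableType d) m (f : T -> 'rV[R]_m) :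
  (forall i, measurable_fun setT (fun t => f t 0 i : measurableTypeR R)) ->
  measurable_fun setT (f : T -> borelRV m).
Proof.
move=> mf; apply: (@measurability _ _ T (borelRV m) setT f [set U | open U] erefl).
move=> _ [U oU <-]; rewrite setTI.
pose Q (q : 'rV[rat]_m * rat) : set T :=
  [set t | `|f t - map_mx ratr q.1| < ratr q.2 :> R].
pose W := [set q : 'rV[rat]_m * rat | 0 < ratr q.2 :> R /\
   forall y : 'rV[R]_m, `|y - map_mx ratr q.1| < ratr q.2 :> R -> U y].
have mQ q : W q -> measurable (Q q).
  move=> [q0 _].
  have -> : Q q = \bigcap_(i in [set: 'I_m])
      [set t | `|f t 0 i - ratr (q.1 0 i)| < ratr q.2 :> R].
    apply/seteqP; split => t /=.
      move=> ft i _ /=; apply: le_lt_trans ft.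
      by have := coord_le_norm (f t - map_mx ratr q.1) i; rewrite !mxE.
    by move=> ft; apply: norm_lt_coord => // i; rewrite !mxE; exact: ft.
  apply: fin_bigcap_measurable => // i _.
  have : measurable_fun setT (fun t => `|f t 0 i - ratr (q.1 0 i)| : measurableTypeR R).
    apply: (measurableT_comp (@normr_measurable R setT)).
    by apply: measurable_funB; [exact: mf|exact: measurable_cst].
  move=> /(_ measurableT _ (measurable_itv `]-oo, ratr q.2[)).
  by rewrite setTI; congr (measurable _); apply/seteqP; split => t /=; rewrite in_itv.
have -> : f @^-1` U = \bigcup_(q in W) Q q.
  apply/seteqP; split => t /=; last by move=> [q [_ qU]] /qU.
  move=> Uf; have /nbhs_ballP[e /= e0 eU] : nbhs (f t) U by apply: open_nbhs_nbhs.
  have e20 : 0 < e / 2 by lra.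
  have [q [q0 xq qe]] := rat_ball (f t) e20.
  exists q => //; split => // y yq; apply: eU; rewrite -ball_normE /=.
  rewrite -(subrK (map_mx ratr q.1) (f t)) -addrA.
  by apply: le_lt_trans (ler_normD _ _) _; rewrite [X in _ + X]distrC; lra.
rewrite bigcup_mkcond; apply: countable_bigcupT_measurable => // q.
by case: ifP => // /set_mem; exact: mQ.
Qed.

End RowVectors.

(** * The Heisenberg group *)

Section HeisenbergAlgebra.
Context {R : realType} {n : nat}.
Implicit Types (u v w g h k : heis R n) (a r s : R).

(** [hw] is the projection modulo the centre, a group homomorphism; [hz] is the central coordinate,
    additive for [+] but only up to [hsymp] for [hmul]. *)
Definition hw g : 'rV[R]_(n + n) := lsubmx g.
Definition hz g : R := g 0 (rshift (n + n) 0).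
Definition hlift (x : 'rV[R]_(n + n)) : heis R n := row_mx x 0.

Lemma hxE g i : hx g 0 i = g 0 (lshift 1 (lshift n i)).
Proof. by rewrite !mxE. Qed.

Lemma hyE g i : hy g 0 i = g 0 (lshift 1 (rshift n i)).
Proof. by rewrite !mxE. Qed.

Lemma hwE g i : hw g 0 i = g 0 (lshift 1 i).
Proof. by rewrite mxE. Qed.

Lemma hw_hlift x : hw (hlift x) = x.
Proof. exact: row_mxKl. Qed.

Lemma hx_hlift x : hx (hlift x) = lsubmx x.
Proof. by rewrite /hx -[lsubmx (hlift x)]/(hw _) hw_hlift. Qed.

Lemma hy_hlift x : hy (hlift x) = rsubmx x.
Proof. by rewrite /hy -[lsubmx (hlift x)]/(hw _) hw_hlift. Qed.

Lemma hz_hlift x : hz (hlift x) = 0.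
Proof. by rewrite /hz /hlift row_mxEr mxE. Qed.

Lemma hcenterEl r i : (hcenter r : heis R n) 0 (lshift 1 i) = 0.
Proof. by rewrite /hcenter row_mxEl mxE. Qed.

Lemma hcenterEr r : hz (hcenter r : heis R n) = r.
Proof. by rewrite /hz /hcenter row_mxEr mxE eqxx mulr1n. Qed.

Lemma hw_center r : hw (hcenter r : heis R n) = 0.
Proof. exact: row_mxKl. Qed.

Lemma heisP g h : hw g = hw h -> hz g = hz h -> g = h.
Proof.
move=> gh1 gh2; rewrite -[g]hsubmxK -[h]hsubmxK; congr row_mx => //.
by apply/rowP => i; rewrite !mxE (ord1 i).
Qed.

Lemma hwD g h : hw (g + h) = hw g + hw h. Proof. exact: linearD. Qed.
Lemma hwB g h : hw (g - h) = hw g - hw h. Proof. exact: linearB. Qed.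
Lemma hwN g : hw (- g) = - hw g. Proof. exact: linearN. Qed.
Lemma hwZ a g : hw (a *: g) = a *: hw g. Proof. exact: linearZ. Qed.
Lemma hw0 : hw (0 : heis R n) = 0. Proof. exact: linear0. Qed.
Lemma hzD g h : hz (g + h) = hz g + hz h. Proof. by rewrite /hz !mxE. Qed.
Lemma hzN g : hz (- g) = - hz g. Proof. by rewrite /hz !mxE. Qed.
Lemma hzZ a g : hz (a *: g) = a * hz g. Proof. by rewrite /hz !mxE. Qed.
Lemma hz0 : hz (0 : heis R n) = 0. Proof. by rewrite /hz !mxE. Qed.

Lemma hw_sum (I : Type) (s : seq I) (P : pred I) (F : I -> heis R n) :
  hw (\sum_(i <- s | P i) F i) = \sum_(i <- s | P i) hw (F i).
Proof. exact: linear_sum. Qed.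

Lemma heis_split g : g = hlift (hw g) + hcenter (hz g).
Proof.
by apply: heisP; rewrite ?hwD ?hzD ?hw_hlift ?hw_center ?addr0// hz_hlift hcenterEr add0r.
Qed.

Lemma hcenterD r s : hcenter (r + s) = hcenter r + hcenter s :> heis R n.
Proof.
by apply: heisP; rewrite ?hwD ?hw_center ?addr0// hzD !hcenterEr.
Qed.

Lemma hcenterN r : hcenter (- r) = - hcenter r :> heis R n.
Proof.
by apply: heisP; rewrite ?hwN ?hw_center ?oppr0// hzN !hcenterEr.
Qed.

Lemma hcenterZ a r : hcenter (a * r) = a *: hcenter r :> heis R n.
Proof.
by apply: heisP; rewrite ?hwZ ?hw_center ?scaler0// hzZ !hcenterEr.
Qed.

Lemma hcenter0 : hcenter 0 = 0 :> heis R n.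
Proof. by rewrite -(mul0r 0) hcenterZ scale0r. Qed.

Lemma hw0_center g : hw g = 0 -> g = hcenter (hz g).
Proof. by move=> g0; apply: heisP; rewrite ?hw_center ?hcenterEr. Qed.

Lemma hsympC g h : hsymp g h = - hsymp h g.
Proof.
rewrite /hsymp -sumrN; apply: eq_bigr => i _; ring.
Qed.

Lemma hsympDl u v w : hsymp (u + v) w = hsymp u w + hsymp v w.
Proof.
rewrite /hsymp -big_split; apply: eq_bigr => i _ /=; rewrite !hxE !hyE !mxE; ring.
Qed.

Lemma hsympDr u v w : hsymp u (v + w) = hsymp u v + hsymp u w.
Proof. by rewrite ![hsymp u _]hsympC hsympDl opprD. Qed.

Lemma hsympZl a u w : hsymp (a *: u) w = a * hsymp u w.
Proof.
rewrite /hsymp mulr_sumr; apply: eq_bigr => i _ /=; rewrite !hxE !hyE !mxE; ring.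
Qed.

Lemma hsympZr a u w : hsymp u (a *: w) = a * hsymp u w.
Proof. by rewrite ![hsymp u _]hsympC hsympZl mulrN. Qed.

Lemma hsympNl u w : hsymp (- u) w = - hsymp u w.
Proof. by rewrite -scaleN1r hsympZl mulN1r. Qed.

Lemma hsympNr u w : hsymp u (- w) = - hsymp u w.
Proof. by rewrite -scaleN1r hsympZr mulN1r. Qed.

Lemma hsymp0l u : hsymp 0 u = 0.
Proof. by rewrite -(scale0r 0) hsympZl mul0r. Qed.

Lemma hsymp0r u : hsymp u 0 = 0.
Proof. by rewrite hsympC hsymp0l oppr0. Qed.

Lemma hsymp_diag u : hsymp u u = 0.
Proof. by rewrite /hsymp big1// => i _; rewrite mulrC subrr. Qed.

Lemma hsymp_centerl r u : hsymp (hcenter r) u = 0.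
Proof.
by rewrite /hsymp big1// => i _; rewrite !hxE !hyE !hcenterEl !mul0r subrr.
Qed.

Lemma hsymp_centerr r u : hsymp u (hcenter r) = 0.
Proof. by rewrite hsympC hsymp_centerl oppr0. Qed.

Lemma hsymp_suml (I : Type) (s : seq I) (P : pred I) (F : I -> heis R n) w :
  hsymp (\sum_(i <- s | P i) F i) w = \sum_(i <- s | P i) hsymp (F i) w.
Proof.
by elim/big_ind2 : _ => [|x a y b <- <-|//]; rewrite ?hsymp0l ?hsympDl.
Qed.

Lemma hsymp_sumr (I : Type) (s : seq I) (P : pred I) (F : I -> heis R n) w :
  hsymp w (\sum_(i <- s | P i) F i) = \sum_(i <- s | P i) hsymp w (F i).
Proof.
by elim/big_ind2 : _ => [|x a y b <- <-|//]; rewrite ?hsymp0r ?hsympDr.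
Qed.

Lemma hsymp_hw g h : hsymp g h = hsymp (hlift (hw g)) (hlift (hw h)).
Proof.
by rewrite {1}(heis_split g) {1}(heis_split h) hsympDl !hsympDr !hsymp_centerl
  !hsymp_centerr !addr0.
Qed.

(** Pairing (x, y) with (-y, x) gives |x|^2 + |y|^2. *)
Lemma hsymp_nondegenerate g : (forall h, hsymp g h = 0) -> hw g = 0.
Proof.
move=> /(_ (hlift (row_mx (- hy g) (hx g)))); rewrite /hsymp.
under eq_bigr => i _.
  rewrite hx_hlift hy_hlift row_mxKl row_mxKr [(- hy g) 0 i]mxE mulrN opprK -!expr2; over.
move=> /eqP; rewrite psumr_eq0; last by move=> i _; rewrite addr_ge0// sqr_ge0.
move=> /allP g0; apply/rowP => i.
have {}g0 j : hx g 0 j = 0 /\ hy g 0 j = 0.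
  have := g0 j (mem_index_enum j); rewrite /= paddr_eq0 ?sqr_ge0// !sqrf_eq0.
  by case/andP => /eqP -> /eqP ->.
rewrite -[hw g]hsubmxK -[lsubmx (hw g)]/(hx g) -[rsubmx (hw g)]/(hy g) [RHS]mxE.
by case: (split_ordP i) => j ->; have [h1 h2] := g0 j; [rewrite row_mxEl|rewrite row_mxEr].
Qed.

Lemma hw_mul g h : hw (hmul g h) = hw g + hw h.
Proof. by rewrite /hmul !hwD hw_center addr0. Qed.

Lemma hz_mul g h : hz (hmul g h) = hz g + hz h + hsymp g h / 2.
Proof. by rewrite /hmul !hzD hcenterEr. Qed.

Lemma hsymp_mulr g h k : hsymp g (hmul h k) = hsymp g h + hsymp g k.
Proof. by rewrite /hmul !hsympDr hsymp_centerr addr0. Qed.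

Lemma hsymp_mull g h k : hsymp (hmul g h) k = hsymp g k + hsymp h k.
Proof. by rewrite /hmul !hsympDl hsymp_centerl addr0. Qed.

Lemma hmulA g h k : hmul g (hmul h k) = hmul (hmul g h) k.
Proof.
by apply: heisP; rewrite ?hw_mul ?addrA// !hz_mul hsymp_mulr hsymp_mull; ring.
Qed.

Lemma hmul0g g : hmul 0 g = g.
Proof. by rewrite /hmul hsymp0l mul0r hcenter0 add0r addr0. Qed.

Lemma hmulg0 g : hmul g 0 = g.
Proof. by rewrite /hmul hsymp0r mul0r hcenter0 !addr0. Qed.

Lemma hmulVg g : hmul (hinv g) g = 0.
Proof.
by rewrite /hmul /hinv hsympNl hsymp_diag oppr0 mul0r hcenter0 addNr addr0.
Qed.

Lemma hmulgV g : hmul g (hinv g) = 0.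
Proof.
by rewrite /hmul /hinv hsympNr hsymp_diag oppr0 mul0r hcenter0 addrN addr0.
Qed.

Lemma hmulKg g h : hmul (hinv g) (hmul g h) = h.
Proof. by rewrite hmulA hmulVg hmul0g. Qed.

Lemma hmulVKg g h : hmul g (hmul (hinv g) h) = h.
Proof. by rewrite hmulA hmulgV hmul0g. Qed.

Lemma hmulgK g h : hmul (hmul h g) (hinv g) = h.
Proof. by rewrite -hmulA hmulgV hmulg0. Qed.

Lemma hmulgKV g h : hmul (hmul h (hinv g)) g = h.
Proof. by rewrite -hmulA hmulVg hmulg0. Qed.

Lemma hinvK g : hinv (hinv g) = g.
Proof. exact: opprK. Qed.

Lemma hinvM g h : hinv (hmul g h) = hmul (hinv h) (hinv g).
Proof.
rewrite /hinv /hmul hsympNl hsympNr opprK hsympC mulNr hcenterN.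
by rewrite !opprD opprK [- g - h]addrC.
Qed.

Lemma hmul_centerr g r : hmul g (hcenter r) = g + hcenter r.
Proof. by rewrite /hmul hsymp_centerr mul0r hcenter0 addr0. Qed.

Lemma hmul_centerl g r : hmul (hcenter r) g = g + hcenter r.
Proof. by rewrite /hmul hsymp_centerl mul0r hcenter0 addr0 addrC. Qed.

Lemma hw_inv g : hw (hinv g) = - hw g.
Proof. exact: hwN. Qed.

End HeisenbergAlgebra.

(** * Volume of fundamental domains *)

Section LebIntegral.
Context {R : realType}.
Local Notation leb := (@lebesgue_measure R).
Local Open Scope ereal_scope.

Lemma ge0_le_integral_nomeas d (T : measurableType d) (mu : {measure set T -> \bar R})
    (f g : T -> \bar R) :
  (forall x, 0 <= f x) -> (forall x, f x <= g x) ->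
  \int[mu]_x f x <= \int[mu]_x g x.
Proof.
move=> f0 fg; have g0 x : 0 <= g x by apply: le_trans (fg x).
rewrite ge0_integralE// ge0_integralE// !patch_setT; apply: ereal_sup_le.
by move=> _ [h /= hf <-]; exists h => //= x; apply: le_trans (fg x).
Qed.

(** The image of Lebesgue measure under a translation agrees with it on intervals, hence is Lebesgue
    measure. *)
Lemma lebesgue_integral_shift (G : R -> \bar R) (a : R) :
  measurable_fun setT (G : measurableTypeR R -> \bar R) -> (forall t, 0 <= G t) ->
  \int[leb]_t G (t + a)%R = \int[leb]_t G t.
Proof.
move=> mG G0.
pose phi (t : measurableTypeR R) : measurableTypeR R := (t + a)%R.
have mphi : measurable_fun setT phi.
  by apply: measurable_funD => //; exact: measurable_cst.
pose mu0 : {measure set (measurableTypeR R) -> \bar R} := pushforward leb phi.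
pose mu := mu0 mphi.
have muE A : measurable A -> A `<=` setT -> mu A = leb A.
  move=> mA _; apply/esym; apply: lebesgue_measure_unique => // _ [[x y] _ <-] /=.
  rewrite /pushforward.
  have -> : phi @^-1` `]x, y] = `](x - a)%R, (y - a)%R]%classic.
    by apply/seteqP; split => t /=; rewrite !in_itv /= /phi ltrBlDr lerBrDr.
  rewrite !lebesgue_measure_itv /= !lte_fin ltrD2r; case: ifP => // _.
  by rewrite -!EFinB; congr EFin; ring.
transitivity (\int[mu]_t G t); last exact: eq_measure_integral.
by rewrite (ge0_integral_pushforward mphi)// preimage_setT.
Qed.

(** The scalar becomes the first coordinate, the outermost variable of [leb_integral]. *)
Definition rcons1 {m} (t : R) (v : 'rV[R]_m) : 'rV[R]_m.+1 :=
  row_mx (t%:M : 'rV[R]_1) v.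

Lemma rcons1_0 m t (v : 'rV[R]_m) : rcons1 t v 0%R ord0 = t.
Proof.
rewrite /rcons1; have -> : ord0 = lshift m (0%R : 'I_1) by apply: val_inj.
transitivity ((t%:M : 'rV[R]_1) ord0 ord0); last by rewrite mxE eqxx mulr1n.
exact: (@row_mxEl _ _ _ m).
Qed.

Lemma rcons1_S m t (v : 'rV[R]_m) i : rcons1 t v 0%R (lift ord0 i) = v 0%R i.
Proof.
rewrite /rcons1; have -> : lift ord0 i = rshift 1 i by apply: val_inj.
exact: (@row_mxEr _ _ 1).
Qed.

Lemma measurable_rcons1 d (T : measurableType d) m (f : T -> R) (g : T -> 'rV[R]_m) :
  measurable_fun setT (f : T -> measurableTypeR R) ->
  (forall i, measurable_fun setT (fun t => g t 0%R i : measurableTypeR R)) ->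
  measurable_fun setT ((fun t => rcons1 (f t) (g t)) : T -> borelRV m.+1).
Proof.
move=> mf mg; apply: measurable_row => i; have [j ->|->] := unliftP ord0 i.
  rewrite (_ : (fun t => _) = (fun t => g t 0%R j)); first exact: mg.
  by apply/funext => t; rewrite rcons1_S.
rewrite (_ : (fun t => _) = f)//.
by apply/funext => t; rewrite rcons1_0.
Qed.

Lemma measurable_coord m (i : 'I_m) :
  measurable_fun setT ((fun x => x 0%R i) : borelRV m -> measurableTypeR R).
Proof. by apply: borel_continuous; exact: coord_continuous. Qed.

Lemma leb_integral_ge0 m (f : 'rV[R]_m -> \bar R) : (forall x, 0 <= f x) ->
  0 <= leb_integral f.
Proof.
elim: m f => [|m IH] f f0 /=; first exact: f0.
by apply: integral_ge0 => t _; apply: IH.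
Qed.

(** Tonelli's theorem, one variable at a time. The parameter space is arbitrary so that the
    induction can move a coordinate from the integrand to the parameter. *)
Lemma leb_integral_measurable m d (T : measurableType d)
    (f : T * borelRV m -> \bar R) :
  measurable_fun setT f -> (forall x, 0 <= f x) ->
  measurable_fun setT (fun t => leb_integral (fun v : 'rV[R]_m => f (t, v))).
Proof.
elim: m d T f => [|m IH] d T f mf f0 /=.
  exact: (measurable_fun_pair1 _ mf).
pose f' (x : (T * measurableTypeR R) * borelRV m) := f (x.1.1, rcons1 x.1.2 x.2).
have mf' : measurable_fun setT f'.
  apply: (measurableT_comp mf); apply: measurable_fun_pair.
    by apply: measurableT_comp => //.
  apply: measurable_rcons1 => [|i]; first exact: measurableT_comp.
  exact: (measurableT_comp (measurable_coord i)).
have := IH _ _ f' mf' (fun _ => f0 _).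
move=> mF; apply: (@measurable_fun_fubini_tonelli_F _ _ _ _ _ leb _ mF) => x.
by apply: leb_integral_ge0 => v; exact: f0.
Qed.

Lemma leb_integral_le m (f g : 'rV[R]_m -> \bar R) : (forall x, 0 <= f x) ->
  (forall x, f x <= g x) -> leb_integral f <= leb_integral g.
Proof.
elim: m f g => [|m IH] f g f0 fg /=; first exact: fg.
by apply: ge0_le_integral_nomeas => t; [exact: leb_integral_ge0|exact: IH].
Qed.

Lemma eq_leb_integral m (f g : 'rV[R]_m -> \bar R) : f =1 g ->
  leb_integral f = leb_integral g.
Proof. by move/funext ->. Qed.

Lemma leb_integral_nneseries m (f : nat -> borelRV m -> \bar R) :
  (forall k, measurable_fun setT (f k)) -> (forall k x, 0 <= f k x) ->
  leb_integral (fun v : 'rV[R]_m => \sum_(0 <= k <oo) f k v) =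
  \sum_(0 <= k <oo) leb_integral (f k).
Proof.
elim: m f => [//|m IH] f mf f0 /=.
have mf' k t : measurable_fun setT ((fun v => f k (rcons1 t v)) : borelRV m -> \bar R).
  apply: (measurableT_comp (mf k)); apply: measurable_rcons1 => [|i].
    exact: measurable_cst.
  exact: measurable_coord.
have mF k : measurable_fun setT
    ((fun t => leb_integral (fun v : 'rV[R]_m => f k (rcons1 t v))) :
       measurableTypeR R -> \bar R).
  pose f' (x : measurableTypeR R * borelRV m) := f k (rcons1 x.1 x.2).
  apply: (@leb_integral_measurable m _ _ f') => [|x]; last exact: f0.
  apply: (measurableT_comp (mf k)); apply: measurable_rcons1 => // i.
  exact: (measurableT_comp (measurable_coord i)).
rewrite -(integral_nneseries leb measurableT mF); last first.
  by move=> k t _; exact: leb_integral_ge0.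
apply: eq_integral => t _.
by rewrite (IH (fun k v => f k (rcons1 t v))).
Qed.

(** Each coordinate is translated by an amount that depends only on the preceding ones. Left
    translations of H_n have this form because the central coordinate comes last. *)
Definition triangular_shift m (T : 'rV[R]_m -> 'rV[R]_m) :=
  forall (i : 'I_m) (x y : 'rV[R]_m), (forall j : 'I_m, (j < i)%N -> x 0%R j = y 0%R j) ->
    (T x 0 i - x 0 i = T y 0 i - y 0 i)%R.

(** The first coordinate is translated by the constant [a]; once it is fixed, the others undergo a
    triangular shift [S t] again. So invariance in one variable suffices. *)
Lemma leb_integral_triangular_shift m (T : 'rV[R]_m -> 'rV[R]_m)
    (f : borelRV m -> \bar R) :
  triangular_shift T -> measurable_fun setT f -> (forall x, 0 <= f x) ->
  leb_integral (fun v : 'rV[R]_m => f (T v)) = leb_integral f.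
Proof.
elim: m T f => [|m IH] T f tT mf f0 /=.
  by congr f; apply/rowP => -[].
pose a := (T 0%R 0%R ord0).
pose S t (v : 'rV[R]_m) : 'rV[R]_m := \row_i T (rcons1 t v) 0%R (lift ord0 i).
have TE t v : T (rcons1 t v) = rcons1 (t + a)%R (S t v).
  apply/rowP => i; have [j ->|->] := unliftP ord0 i; first by rewrite rcons1_S mxE.
  have := tT ord0 (rcons1 t v) 0%R (fun j => fun H => False_ind _ (notF H)).
  by rewrite !rcons1_0 mxE subr0 => /eqP; rewrite subr_eq addrC => /eqP.
have tS t : triangular_shift (S t).
  move=> i x y xy.
  have := tT (lift ord0 i) (rcons1 t x) (rcons1 t y).
  rewrite [S t x _ _]mxE [S t y _ _]mxE !rcons1_S; apply => j; have [k ->|->] := unliftP ord0 j.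
    by rewrite !rcons1_S /= /bump /= !add1n ltnS; exact: xy.
  by rewrite !rcons1_0.
pose G t := leb_integral (fun v => f (rcons1 t v)).
have mG : measurable_fun setT (G : measurableTypeR R -> \bar R).
  pose f' (x : measurableTypeR R * borelRV m) := f (rcons1 x.1 x.2).
  apply: (@leb_integral_measurable m _ _ f') => [|x]; last exact: f0.
  apply: (measurableT_comp mf); apply: measurable_rcons1 => // i.
  exact: (measurableT_comp (measurable_coord i)).
transitivity (\int[leb]_t G (t + a)%R); last first.
  by apply: lebesgue_integral_shift => // t; exact: leb_integral_ge0.
apply: eq_integral => t _.
rewrite /G -[RHS](IH (S t) (fun v => f (rcons1 (t + a)%R v)))//.
  by apply: eq_leb_integral => v; rewrite -TE.
apply: (measurableT_comp mf); apply: measurable_rcons1 => [|i].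
  exact: measurable_cst.
exact: measurable_coord.
Qed.
End LebIntegral.

(** * Volume of a fundamental domain against that of a covering set *)

Section FundamentalVolume.
Context {R : realType} {n : nat}.
Implicit Types (G F : set (heis R n)).
Local Open Scope ereal_scope.

Lemma measurable_hmul (g : heis R n) :
  measurable_fun setT (hmul g : borelRV (n + n + 1) -> borelRV (n + n + 1)).
Proof.
apply: measurable_row => i.
have -> : (fun t => hmul g t 0%R i) = (fun t => g 0%R i + t 0%R i + hsymp g t / 2 *
    (hcenter 1%R : heis R n) 0%R i)%R.
  by apply/funext => t; rewrite /hmul -[(hsymp g t / 2)%R in LHS]mulr1 hcenterZ !mxE.
have mc := measurable_coord.
apply: measurable_funD.
  by apply: measurable_funD; [exact: measurable_cst|exact: mc].
apply: measurable_funM; last exact: measurable_cst.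
apply: measurable_funM; last exact: measurable_cst.
rewrite /hsymp; apply: measurable_sum => j.
have mhx : measurable_fun setT ((fun t => hx t 0%R j) : borelRV (n + n + 1) -> measurableTypeR R).
  apply: (@eq_measurable_fun _ _ _ _ _
    (fun t : borelRV _ => (t : 'rV[R]_(n + n + 1)) 0%R (lshift 1 (lshift n j)))).
    by move=> t _; rewrite hxE.
  exact: mc.
have mhy : measurable_fun setT ((fun t => hy t 0%R j) : borelRV (n + n + 1) -> measurableTypeR R).
  apply: (@eq_measurable_fun _ _ _ _ _
    (fun t : borelRV _ => (t : 'rV[R]_(n + n + 1)) 0%R (lshift 1 (rshift n j)))).
    by move=> t _; rewrite hyE.
  exact: mc.
by apply: measurable_funB; apply: measurable_funM => //; exact: measurable_cst.
Qed.

Lemma triangular_shift_hmul (g : heis R n) : triangular_shift (hmul g).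
Proof.
move=> i x y; have [j ->|j ->] := split_ordP i => xy.
  by rewrite -!hwE !hw_mul; rewrite !mxE !addrK.
have xyl (l : 'I_(n + n)) : x 0%R (lshift 1 l) = y 0%R (lshift 1 l).
  by apply: xy; rewrite /= ltn_addr.
have -> : j = 0%R by rewrite ord1.
rewrite -!/(hz _) !hz_mul; have -> : hsymp g x = hsymp g y; last by ring.
rewrite /hsymp; apply: eq_bigr => k _; by rewrite !hxE !hyE !xyl.
Qed.

Lemma nneseries_single (f : nat -> \bar R) k : (forall j, 0 <= f j) ->
  (forall j, j != k -> f j = 0) -> \sum_(0 <= j <oo) f j = f k.
Proof.
move=> f0 fk; by rewrite (nneseriesD1 (n := k))// eseries0 ?adde0// => j _ /fk.

Qed.

(** Unfolding over G: 1_F(x) <= sum_g 1_F(x) 1_F0(g x) because the orbit of x meets [F0]. Left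
    translation by g preserves volume and turns the terms into 1_F(g^-1 x) 1_F0(x), whose sum is at
    most 1_F0(x) because the translates of [F] are disjoint. The terms are [p] and [q], indexed by
    an enumeration of G. *)
Lemma fundamental_domain_volume_le G F (F0 : set (heis R n)) :
  (forall g h, G g -> G h -> G (hmul g h)) -> (forall g, G g -> G (hinv g)) ->
  countable G -> fundamental_domain G F ->
  measurable (F0 : set (borelRV (n + n + 1))) ->
  (forall x, exists2 g, G g & F0 (hmul g x)) ->
  leb_volume F <= leb_volume F0.
Proof.
move=> GM GV /countable_injP [code codeI] [mF FP] mF0 F0P.
have {}mF : measurable (F : set (borelRV (n + n + 1))) by [].
have Funiq x g h : G g -> G h -> F (hmul g x) -> F (hmul h x) -> g = h.
  move=> Gg Gh Fg Fh.
  have orb : exists y, [set hmul k x | k in G] = [set hmul k y | k in G] by exists x.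
  have [z [_ zuniq]] := FP (exist _ _ orb).
  have zg : z = hmul g x by apply: zuniq; split => //=; exists g.
  have zh : z = hmul h x by apply: zuniq; split => //=; exists h.
  by rewrite -[g](hmulgK x) -zg zh hmulgK.
pose D k := exists2 g, G g & code g = k.
pose gam k := get [set g | G g /\ code g = k].
have gamP k : D k -> G (gam k) /\ code (gam k) = k.
  by move=> [g Gg gk]; apply: (@getPex _ [set g | G g /\ code g = k]); exists g.
have gamK g : G g -> gam (code g) = g.
  move=> Gg; have [] := gamP (code g); first by exists g.
  by move=> Gc cc; apply: codeI => //; exact: mem_set.
(* An integer that codes no element of G contributes 0. *)
pose p k x : \bar R := if pselect (D k) then (\1_F x * \1_F0 (hmul (gam k) x))%:E else 0.
pose q k x : \bar R := if pselect (D k) then (\1_F (hmul (hinv (gam k)) x) * \1_F0 x)%:E else 0.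
have p0 k x : 0 <= p k x by rewrite /p; case: pselect => //= _; rewrite lee_fin mulr_ge0.
have q0 k x : 0 <= q k x by rewrite /q; case: pselect => //= _; rewrite lee_fin mulr_ge0.
have mi0 : measurable_fun setT (\1_F0 : borelRV (n + n + 1) -> R) by exact: measurable_indic.
have mi : measurable_fun setT (\1_F : borelRV (n + n + 1) -> R) by exact: measurable_indic.
have mp k : measurable_fun setT (p k : borelRV (n + n + 1) -> \bar R).
  rewrite /p; case: pselect => [Dk|nDk] /=; last exact: measurable_cst.
  apply/measurable_EFinP/measurable_funM; first exact: measurable_indic.
  exact: (measurableT_comp mi0 (measurable_hmul _)).
have mq k : measurable_fun setT (q k : borelRV (n + n + 1) -> \bar R).
  rewrite /q; case: pselect => [Dk|nDk] /=; last exact: measurable_cst.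
  apply/measurable_EFinP/measurable_funM; last exact: measurable_indic.
  exact: (measurableT_comp mi (measurable_hmul _)).
have pq k : leb_integral (p k) = leb_integral (q k).
  rewrite -(leb_integral_triangular_shift (triangular_shift_hmul (gam k)) (mq k))//.
  apply: eq_leb_integral => x; rewrite /p /q; case: pselect => //= _.
  by rewrite hmulKg.
apply: (@le_trans _ _ (\sum_(0 <= k <oo) leb_integral (p k))).
  rewrite -leb_integral_nneseries//; apply: leb_integral_le => x.
    by rewrite lee_fin.
  rewrite indicE; case: (boolP (x \in F)) => [xF|_]; last exact: nneseries_ge0.
  have [g Gg gF0] := F0P x.
  have Dg : D (code g) by exists g.
  rewrite (nneseriesD1 (n := code g))//; apply: le_trans (leeDl _ _).
    rewrite /p; case: pselect => //= _; rewrite gamK// !indicE xF mem_set//.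
    by rewrite mulr1.
  exact: nneseries_ge0.
under eq_eseriesr do rewrite pq.
rewrite -leb_integral_nneseries//; apply: leb_integral_le => x.
  exact: nneseries_ge0.
have [[k Dk Fk]|noF] := pselect (exists2 k, D k & F (hmul (hinv (gam k)) x)).
  have [Gk ck] := gamP k Dk.
  rewrite (nneseries_single (k := k))//.
    rewrite /q; case: pselect => //= _; rewrite lee_fin.
    by rewrite -[leRHS]mul1r; apply: ler_wpM2r => //; rewrite indicE lern1; case: (_ \in _).
  move=> j jk; rewrite /q; case: pselect => //= Dj; rewrite indicE memNset ?mul0r// => Fj.
  have [Gj cj] := gamP j Dj.
  have := Funiq x _ _ (GV _ Gj) (GV _ Gk) Fj Fk.
  by move=> /(congr1 hinv); rewrite !hinvK => jkE; rewrite -cj jkE ck eqxx in jk.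
rewrite eseries0 ?lee_fin// => k _ _; rewrite /q; case: pselect => //= Dk.
by rewrite indicE memNset ?mul0r// => Fk; apply: noF; exists k.
Qed.
End FundamentalVolume.

Section ParallelepipedVolume.
Context {R : realType}.
Local Notation leb := (@lebesgue_measure R).

Lemma leb_integral0 m : leb_integral (fun _ : 'rV[R]_m => 0%E) = 0%E.
Proof. by elim: m => //= m ->; rewrite integral0. Qed.

Definition paral m (U : 'M[R]_m) (b : 'rV[R]_m) : set 'rV[R]_m :=
  [set x | exists2 y : 'rV[R]_m, (forall i, 0 <= y 0 i <= 1) & x = y *m U + b].

(** Slicing by the first coordinate t: only row 0 of [U] contributes to it, so t determines y_0, and
    the slice is the parallelepiped of the remaining minor, translated by a vector depending on t.
    The offset [b] is there for this induction. *)
Lemma leb_volume_paral m (U : 'M[R]_m) (b : 'rV[R]_m) :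
  (forall i j : 'I_m, (j < i)%N -> U i j = 0) -> (forall i, U i i != 0) ->
  (leb_volume (paral U b) <= (\prod_i `|U i i|)%:E)%E.
Proof.
elim: m U b => [|m IH] U b Utri Udiag.
  rewrite big_ord0 /leb_volume /= lee_fin indicE; by case: (_ \in _).
rewrite big_ord_recl /leb_volume /=.
pose u := U ord0 ord0; pose U' := \matrix_(i < m, j < m) U (lift ord0 i) (lift ord0 j).
pose J := `[b 0 ord0 + Num.min 0 u, b 0 ord0 + Num.max 0 u]%classic.
pose P := \prod_(i < m) `|U (lift ord0 i) (lift ord0 i)|.
have P0 : 0 <= P by apply: prodr_ge0.
have u0 : u != 0 by exact: Udiag.
have mJ : measurable (J : set (measurableTypeR R)) by exact: measurable_itv.
apply: (@le_trans _ _ (\int[leb]_t (P * \1_J t)%:E)%E); last first.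
  under eq_integral do rewrite EFinM.
  have mi : measurable_fun setT (EFin \o (\1_J : measurableTypeR R -> R)).
    by apply/measurable_EFinP; exact: measurable_indic.
  have i0 t : setT t -> (0 <= (EFin \o (\1_J : measurableTypeR R -> R)) t)%E.
    by move=> _; rewrite lee_fin.
  rewrite (ge0_integralZl leb measurableT mi i0) ?lee_fin//.
  rewrite integral_indic// setIT EFinM muleC; apply: lee_wpmul2r; first by rewrite lee_fin.
  pose lo := b 0 ord0 + Num.min 0 u; pose hi := b 0 ord0 + Num.max 0 u.
  suff : (lebesgue_measure `[lo, hi]%classic <= `|u|%:E)%E by [].
  rewrite /lo /hi lebesgue_measure_itv /= lte_fin ltrD2l.
  case: ifP => _; last by rewrite lee_fin.
  rewrite -EFinB lee_fin /u; have [h|h] := leP 0 (U ord0 ord0).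
    by rewrite ger0_norm//; lra.
  by rewrite ltr0_norm//; lra.
apply: ge0_le_integral_nomeas => t.
  by apply: leb_integral_ge0 => v; rewrite lee_fin.
pose y0 := (t - b 0 ord0) / u.
have inP v : paral U b (rcons1 t v) -> J t /\
    paral U' (\row_j (b 0 (lift ord0 j) + y0 * U ord0 (lift ord0 j))) v.
  move=> [y yi xE].
  have tE : t = y 0 ord0 * u + b 0 ord0.
    rewrite -[LHS](rcons1_0 t v) xE !mxE big_ord_recl big1 ?addr0// => i _.
    by rewrite Utri ?mulr0.
  have y0E : y 0 ord0 = y0 by rewrite /y0 tE addrK mulfK.
  split.
    have /andP[h0 h1] := yi ord0.
    rewrite /J /= in_itv /= tE [_ * _ + _]addrC !lerD2l.
    have [hu|hu] := leP 0 u; apply/andP; split; nra.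
  exists (\row_i y 0 (lift ord0 i)) => [i|]; first by rewrite mxE.
  apply/rowP => j; rewrite -[LHS](rcons1_S t v) xE !mxE big_ord_recl -y0E.
  rewrite addrAC addrC; congr (_ + _); last by rewrite addrC.
  by apply: eq_bigr => i _; rewrite !mxE.
have [tJ|tJ] := pselect (J t); last first.
  rewrite indicE memNset// mulr0.
  rewrite (@eq_leb_integral _ _ _ (fun=> 0%E)) ?leb_integral0// => v.
  by rewrite indicE memNset// => /inP[].
rewrite indicE mem_set// mulr1.
have U'tri (i j : 'I_m) : (j < i)%N -> U' i j = 0.
  by move=> ji; rewrite mxE Utri// !lift0 ltnS.
have U'diag i : U' i i != 0 by rewrite mxE.
have := IH U' (\row_j (b 0 (lift ord0 j) + y0 * U ord0 (lift ord0 j))) U'tri U'diag.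
under eq_bigr do rewrite mxE.
apply: le_trans; apply: leb_integral_le => v; first by rewrite lee_fin.
rewrite lee_fin !indicE; case: (boolP (_ \in paral U b)) => //= /set_mem/inP[_ ?].
by rewrite mem_set.
Qed.
End ParallelepipedVolume.

(** * Lattices *)

Lemma det_upper (R : comUnitRingType) m (U : 'M[R]_m) :
  (forall i j : 'I_m, (j < i)%N -> U i j = 0) -> \det U = \prod_i U i i.
Proof.
move=> Uup; rewrite -det_tr det_trig; first by apply: eq_bigr => i _; rewrite mxE.
by apply/is_trig_mxP => i j ij; rewrite mxE Uup.
Qed.

(** Replaces a basis by a triangular one with the same determinant up to sign, so that boxes can be
    measured by slicing. *)
Lemma lup_decomposition (R : realFieldType) m (B : 'M[R]_m) : B \in unitmx ->
  exists (s : 'S_m) (L U : 'M[R]_m),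
  [/\ row_perm s B = L *m U,
      forall i j : 'I_m, (i <= j)%N -> L i j = (i == j)%:R,
      forall i j : 'I_m, (j < i)%N -> U i j = 0,
      forall i, U i i != 0 & \prod_i `|U i i| = `|\det B| ].
Proof.
case: m B => [|m] B uB.
  exists 1%g, 1%:M, 1%:M; split => [|[]//|[]//|[]//|]; first by rewrite [LHS]flatmx0 [RHS]flatmx0.
  by rewrite big_ord0 det_mx00 normr1.
have := cormen_lup_correct B; have := cormen_lup_perm B; have := cormen_lup_detL B.
have := @cormen_lup_lower _ _ B; have := @cormen_lup_upper _ _ B.
case: (cormen_lup B) => [[P L] U] /= Uup Llow detL /is_perm_mxP [s ->] BLU.
have BLU' : row_perm s B = L *m U by rewrite row_permE; exact: BLU.
have detE : `|\det U| = `|\det B|.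
  have := congr1 (fun X => `|\det X|) BLU'.
  rewrite row_permE !det_mulmx detL mul1r det_perm normrM => <-.
  by rewrite normrX normrN1 expr1n mul1r.
have prodE : \prod_i `|U i i| = `|\det B| by rewrite -detE (det_upper Uup) normr_prod.
exists s, L, U; split => // i.
have : \det U != 0 by rewrite -normr_eq0 detE normr_eq0 -unitfE -unitmxE.
by rewrite (det_upper Uup) => /prodf_neq0; apply.
Qed.

Section Subgroups.
Context {R : realType} {m : nat}.
Implicit Types (Lam : set 'rV[R]_m) (x y : 'rV[R]_m) (A B L U : 'M[R]_m).

Definition subgroup Lam :=
  Lam 0 /\ forall x y, Lam x -> Lam y -> Lam (x - y).

Lemma subgroupN Lam x : subgroup Lam -> Lam x -> Lam (- x).
Proof. by move=> [L0 LB] Lx; rewrite -sub0r; apply: LB. Qed.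

Lemma subgroupD Lam x y : subgroup Lam -> Lam x -> Lam y -> Lam (x + y).
Proof. by move=> sL Lx Ly; rewrite -[y]opprK; apply: sL.2 => //; exact: subgroupN. Qed.

Lemma subgroupZ Lam x (k : int) : subgroup Lam -> Lam x -> Lam (k%:~R *: x).
Proof.
move=> sL Lx; have posZ (j : nat) : Lam (j%:R *: x).
  elim: j => [|j IH]; first by rewrite scale0r; case: sL.
  by rewrite -natr1 scalerDl scale1r; exact: subgroupD.
case: k => k; first by rewrite -pmulrn; exact: posZ.
by rewrite NegzE mulrNz scaleNr -pmulrn; apply: subgroupN.
Qed.

Lemma subgroup_sum Lam (I : Type) (s : seq I) (P : pred I) (F : I -> 'rV[R]_m) :
  subgroup Lam -> (forall i, P i -> Lam (F i)) -> Lam (\sum_(i <- s | P i) F i).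
Proof.
move=> sL LF; elim/big_ind : _ => //; first by case: sL.
by move=> x y; exact: subgroupD.
Qed.

Lemma finite_argmin (T : choiceType) (S : set T) (f : T -> R) : finite_set S -> S !=set0 ->
  exists2 s, S s & forall t, S t -> f s <= f t.
Proof.
move=> /finite_seqP[s ->] {S}; elim: s => [[] //|a s IH] _.
have [[b bs]|s0] := pselect ([set` s] !=set0); last first.
  exists a => [|t] /=; first by rewrite inE eqxx.
  by rewrite inE => /orP[/eqP->//|ts]; case: s0; exists t.
have [c cs Hc] := IH (ex_intro _ b bs).
have [ac|ca] := leP (f a) (f c).
  exists a => [|t] /=; first by rewrite inE eqxx.
  by rewrite inE => /orP[/eqP->//|ts]; apply: le_trans (Hc _ ts).
exists c => [|t] /=; first by rewrite inE cs orbT.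
by rewrite inE => /orP[/eqP->|/Hc//]; exact: ltW.
Qed.

Lemma unitmx_inj A : (forall y, y *m A = 0 -> y = 0) -> A \in unitmx.
Proof.
move=> Ainj; rewrite -row_free_unit -kermx_eq0; apply/eqP/row_matrixP => i.
rewrite row0; apply: Ainj; rewrite -row_mul mulmx_ker.
by apply/rowP => j; rewrite !mxE.
Qed.

(** Diagonal dominance: a vector y of the kernel satisfies |T| |y| <= m e |y|, which forces y =
    0. *)
Lemma unitmx_scalar_perturbation (T e : R) (E : 'M[R]_m) :
  (forall i j, `|E i j| <= e) -> m%:R * e < T -> T%:M + E \in unitmx.
Proof.
move=> Ee eT; apply: unitmx_inj => y; rewrite mulmxDr mul_mx_scalar => y0.
have Ty j : `|(T *: y) 0 j| <= m%:R * e * `|y|.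
  have -> : (T *: y) 0 j = - (y *m E) 0 j.
    by apply/eqP; rewrite -addr_eq0; move/rowP/(_ j): y0; rewrite !mxE => ->.
  rewrite normrN mxE; apply: le_trans (ler_norm_sum _ _ _) _.
  rewrite -mulrA mulr_natl -[X in _ *+ X]card_ord -sumr_const.
  apply: ler_sum => i _; rewrite normrM mulrC.
  by apply: ler_pM => //; exact: coord_le_norm.
have me0 : 0 <= m%:R * e.
  have [m0|m0] := posnP m; first by rewrite [X in X%:R]m0 mul0r.
  by rewrite mulr_ge0//; apply: le_trans (Ee (Ordinal m0) (Ordinal m0)).
have := norm_le_coord (mulr_ge0 me0 (normr_ge0 y)) Ty; rewrite normrZ => Tye.
apply/eqP; rewrite -normr_eq0; apply/eqP/le_anti; rewrite normr_ge0 andbT.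
rewrite leNgt; apply/negP => y1.
have : `|T| * `|y| < T * `|y| by apply: le_lt_trans Tye _; rewrite ltr_pM2r.
by rewrite ltr_pM2r// ltNge ler_norm.
Qed.

(** In the basis [U], row i of the permuted [B] has the coordinates of row i of the unit lower
    triangular [L]: 1 at i and 0 after i. Subtracting integer multiples of these rows, from the last
    to the first, brings every coordinate into [0, 1] without spoiling those already treated. *)
Lemma subgroup_paral Lam B : subgroup Lam -> B \in unitmx ->
  (forall i, Lam (row i B)) ->
  exists U, [/\ forall i j : 'I_m, (j < i)%N -> U i j = 0,
    forall i, U i i != 0, \prod_i `|U i i| = `|\det B| &
    forall x, exists2 l, Lam l &
      exists2 y : 'rV[R]_m, (forall i, 0 <= y 0 i <= 1) & x + l = y *m U].
Proof.
move=> sL uB LB; have [s [L [U [BLU Llow Uup Ud Udet]]]] := lup_decomposition uB.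
exists U; split => // x.
have uU : U \in unitmx.
  by rewrite unitmxE unitfE (det_upper Uup); apply/prodf_neq0 => i _.
suff [l Ll Hl] : exists2 l, Lam l & forall i, 0 <= ((x + l) *m invmx U) 0 i <= 1.
  by exists l => //; exists ((x + l) *m invmx U) => //; rewrite mulmxKV.
suff /(_ m (leqnn m)) [l Ll Hl] : forall k, (k <= m)%N -> exists2 l, Lam l &
    forall i : 'I_m, (m - k <= i)%N -> 0 <= ((x + l) *m invmx U) 0 i <= 1.
  by exists l => // i; apply: Hl; rewrite subnn.
elim=> [_|k IH km].
  exists 0; [by case: sL|by move=> i; rewrite subn0 leqNgt ltn_ord].
have [l Ll Hl] := IH (ltnW km).
have mk : (m - k.+1 < m)%N by rewrite ltn_subrL (leq_trans _ km).
pose i := Ordinal mk.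
pose c := Num.floor (((x + l) *m invmx U) 0 i).
pose r := row i (row_perm s B).
have rU : r *m invmx U = row i L by rewrite /r BLU row_mul mulmxK.
have Lr : Lam r.
  suff -> : r = row (s i) B by [].
  by apply/rowP => j; rewrite !mxE.
exists (l - c%:~R *: r); first by apply: sL.2 => //; exact: subgroupZ.
move=> j ij.
have -> : ((x + (l - c%:~R *: r)) *m invmx U) 0 j =
    ((x + l) *m invmx U) 0 j - c%:~R * L i j.
  by rewrite addrA mulmxBl -scalemxAl rU !mxE.
have [ij'|] := eqVneq i j.
  rewrite -ij' Llow// eqxx mulr1 /c.
  have := floor_itv (((x + l) *m invmx U) 0 i); rewrite intrD => /andP[? ?].
  by apply/andP; split; lra.
move=> neq; rewrite Llow// (negbTE neq) mulr0 subr0; apply: Hl.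
move: ij neq; rewrite leq_eqVlt => /orP[/eqP e|].
  by move=> /eqP[]; exact: val_inj.
by rewrite -subSn ?subSS.
Qed.
End Subgroups.

Section ShortBasis.
Context {R : realType} {m : nat}.
Implicit Types (Lam : set 'rV[R]_m) (L : 'M[R]_m).

Lemma norm_mulmx_le (y : 'rV[R]_m) L a : (forall i, `|y 0 i| <= a) -> 0 <= a ->
  `|y *m L| <= a * \sum_i \sum_j `|L i j|.
Proof.
move=> ya a0; have S0 : 0 <= a * \sum_i \sum_j `|L i j|.
  by rewrite mulr_ge0// sumr_ge0// => i _; rewrite sumr_ge0.
apply: norm_le_coord => // j; rewrite mxE.
apply: le_trans (ler_norm_sum _ _ _) _; rewrite mulr_sumr; apply: ler_sum => i _.
rewrite normrM; apply: ler_pM => //.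
by rewrite (bigD1 j)//= lerDl sumr_ge0.
Qed.

(* Row i of A *m L is, among the vectors of Lam whose coordinates in L of index
   > i vanish and those of index < i lie in [0, 1], one with the least positive
   i-th coordinate. *)
Lemma short_basis Lam L : subgroup Lam ->
  (forall K : R, finite_set (Lam `&` [set x | `|x| <= K])) ->
  L \in unitmx -> (forall i, Lam (row i L)) ->
  exists A : 'M[R]_m, [/\ forall i j, `|A i j| <= 1, A \in unitmx,
    forall i, Lam (row i (A *m L)) &
    forall x, Lam x -> exists c : 'I_m -> int,
      x = \sum_i (c i)%:~R *: row i (A *m L)].
Proof.
move=> sL fL uL LL; pose coord x : 'rV[R]_m := x *m invmx L.
have coordB x y : coord (x - y) = coord x - coord y by rewrite /coord mulmxBl.
have coordZ a x : coord (a *: x) = a *: coord x by rewrite /coord scalemxAl.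
have cB x y j : coord (x - y) 0 j = coord x 0 j - coord y 0 j.
  by rewrite coordB [LHS]mxE [X in _ + X]mxE.
have cZ a x j : coord (a *: x) 0 j = a * coord x 0 j by rewrite coordZ [LHS]mxE.
have coordL i : coord (row i L) = delta_mx 0 i.
  by rewrite /coord rowE mulmxK.
pose S (i : 'I_m) := [set x | [/\ Lam x, forall j : 'I_m, (i < j)%N -> coord x 0 j = 0,
  0 < coord x 0 i <= 1 & forall j : 'I_m, (j < i)%N -> 0 <= coord x 0 j <= 1]].
have SK i : finite_set (S i).
  apply: sub_finite_set (fL (1 * \sum_i \sum_j `|L i j|)) => x [Lx x1 x2 x3].
  split => //=; rewrite -[x](mulmxKV uL); apply: norm_mulmx_le => // j.
  have [ij|ji|/val_inj <-] := ltngtP i j.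
  - by rewrite -/(coord x) x1 ?normr0.
  - by have /andP[h0 h1] := x3 j ji; rewrite ger0_norm.
  - by case/andP: x2 => h0 h1; rewrite ger0_norm// ltW.
have S0 i : S i !=set0.
  exists (row i L); split => //= [j ij||j ji]; rewrite coordL mxE /=.
  - by rewrite -val_eqE /= gtn_eqF.
  - by rewrite eqxx ltr01 lexx.
  - by rewrite -val_eqE /= ltn_eqF// lexx ler01.
have /choice[v vP] : forall i, exists x, S i x /\ forall y, S i y -> coord x 0 i <= coord y 0 i.
  by move=> i; have [x Sx Hx] := finite_argmin (fun x => coord x 0 i) (SK i) (S0 i); exists x.
pose A : 'M[R]_m := \matrix_(i, j) coord (v i) 0 j.
have AL i : row i (A *m L) = v i.
  rewrite row_mul -[RHS](mulmxKV uL); congr (_ *m _); apply/rowP => j.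
  by rewrite !mxE.
have Aup (i j : 'I_m) : (i < j)%N -> A i j = 0.
  by move=> ij; rewrite mxE; case: (vP i) => -[_ + _ _] _; apply.
have Ad i : 0 < A i i by rewrite mxE; case: (vP i) => -[_ _ /andP[]].
exists A; split.
- move=> i j; have [[_ x1 x2 x3] _] := vP i.
  have [ij|ji|/val_inj <-] := ltngtP i j.
  + by rewrite Aup// normr0.
  + by rewrite mxE; have /andP[h0 h1] := x3 j ji; rewrite ger0_norm.
  + by rewrite mxE; case/andP: x2 => h0 h1; rewrite ger0_norm// ltW.
- rewrite unitmxE unitfE det_trig; last by apply/is_trig_mxP.
  by apply/prodf_neq0 => i _; rewrite gt_eqF.
- by move=> i; rewrite AL; case: (vP i) => -[].
suff H k : (k <= m)%N -> forall x, Lam x -> (forall j : 'I_m, (k <= j)%N -> coord x 0 j = 0) ->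
    exists c : 'I_m -> int, x = \sum_i (c i)%:~R *: row i (A *m L).
  by move=> x Lx; apply: (H m (leqnn m) x Lx) => j; rewrite leqNgt ltn_ord.
elim: k => [_ x Lx x0|k IH km x Lx xk].
  exists (fun=> 0); rewrite big1 => [|i _]; last by rewrite scale0r.
  rewrite -[x](mulmxKV uL) -/(coord x) (_ : coord x = 0) ?mul0mx//.
  by apply/rowP => j; rewrite x0// mxE.
pose i := Ordinal km.
pose al := coord (v i) 0 i.
have al0 : 0 < al by have := Ad i; rewrite mxE.
have al1 : al <= 1 by case: (vP i) => -[_ _ /andP[]].
pose q := Num.floor (coord x 0 i / al).
pose x' := x - q%:~R *: v i.
have Lv : Lam (v i) by case: (vP i) => -[].
have Lx' : Lam x' by apply: sL.2 => //; exact: subgroupZ.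
have x'j (j : 'I_m) : (k.+1 <= j)%N -> coord x' 0 j = 0.
  move=> kj; rewrite cB cZ xk ?(ltnW kj)//.
  by have := Aup i j kj; rewrite mxE => ->; rewrite mulr0 subr0.
have /andP[x'0 x'al] : 0 <= coord x' 0 i < al.
  have := floor_itv (coord x 0 i / al).
  rewrite -/q intrD ler_pdivlMr// ltr_pdivrMr// => /andP[h1 h2].
  have -> : coord x' 0 i = coord x 0 i - q%:~R * al by rewrite cB cZ.
  by apply/andP; split; lra.
have [x'i|x'i] := eqVneq (coord x' 0 i) 0.
  have [|c Hc] := IH (ltnW km) x' Lx'.
    move=> j; rewrite leq_eqVlt => /orP[/eqP e|]; last exact: x'j.
    by rewrite (_ : j = i)//; apply: val_inj.
  exists (fun j => c j + (if j == i then q else 0)).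
  under eq_bigr do rewrite intrD scalerDl.
  rewrite big_split /= -Hc (bigD1 i)//= eqxx big1 ?addr0 => [|j /negbTE ->]; last first.
    by rewrite scale0r.
  by rewrite AL /x' subrK.
(* The remainder has an i-th coordinate strictly between 0 and that of [v i]. Reducing the
   coordinates before i modulo the rows of [L] puts it in [S i], against the minimality of [v i]. *)
pose d (j : 'I_m) : int := if (j < i)%N then Num.floor (coord x' 0 j) else 0.
pose x2 := x' - \sum_j (d j)%:~R *: row j L.
have Lx2 : Lam x2.
  by apply: sL.2 => //; apply: subgroup_sum => // j _; exact: subgroupZ.
have cx2 j : coord x2 0 j = coord x' 0 j - (d j)%:~R.
  rewrite cB; congr (_ - _).
  rewrite /coord mulmx_suml summxE (bigD1 j)//= big1 => [|l lj].
    by rewrite addr0 -/(coord _) cZ coordL mxE !eqxx mulr1.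
  by rewrite -/(coord _) cZ coordL mxE eqxx /= eq_sym (negbTE lj) mulr0.
have cx2i : coord x2 0 i = coord x' 0 i by rewrite cx2 /d ltnn subr0.
have Sx2 : S i x2.
  split => //.
  - move=> j ij; rewrite cx2 /d ltnNge (ltnW ij) /= subr0; exact: x'j.
  - by rewrite cx2i lt_def x'i x'0 /= (le_trans (ltW x'al)).
  - move=> j ji; rewrite cx2 /d ji.
    by have := floor_itv (coord x' 0 j); rewrite intrD => /andP[? ?]; apply/andP; split; lra.
have [_ /(_ _ Sx2)] := vP i.
by rewrite cx2i leNgt x'al.
Qed.
End ShortBasis.

Section Lattices.
Context {R : realType}.

(** Pigeonhole: a cube of side d / 2 contains at most one point of [S], and finitely many cubes
    cover the ball of radius K. *)
Lemma separated_finite m (S : set 'rV[R]_m) (K d : R) :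
  (forall x, S x -> `|x| <= K) -> 0 < d ->
  (forall x y, S x -> S y -> `|x - y| < d -> x = y) -> finite_set S.
Proof.
move=> SK d0 Ssep; pose N := Num.truncn (2 * K / (d / 2)).
pose code (x : 'rV[R]_m) : {ffun 'I_m -> 'I_N.+1} :=
  [ffun i => inord (Num.truncn ((x 0 i + K) / (d / 2)))].
have xK x i : S x -> 0 <= (x 0 i + K) / (d / 2) <= 2 * K / (d / 2).
  move=> /SK xK; have := le_trans (coord_le_norm x i) xK; rewrite ler_norml => /andP[h1 h2].
  by rewrite divr_ge0 ?ler_pM2r ?invr_gt0//=; lra.
have codeI : {in S &, injective code}.
  move=> x y /set_mem Sx /set_mem Sy /ffunP xy.
  apply: Ssep => //; apply: norm_lt_coord => // i; have := xy i; rewrite !ffunE.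
  have /andP[x0 x1] := xK x i Sx; have /andP[y0 y1] := xK y i Sy.
  move=> /(congr1 (@nat_of_ord _)); rewrite !inordK ?ltnS ?le_truncn//.
  move=> e; have /andP[] := truncn_itv x0; have /andP[] := truncn_itv y0.
  rewrite e; have d20 : 0 < d / 2 by lra.
  move: (Num.truncn _) => T; rewrite -[T.+1%:R]natr1.
  rewrite !ler_pdivlMr// !ltr_pdivrMr// => h1 h2 h3 h4.
  by rewrite !mxE ltr_norml; apply/andP; split; lra.
by rewrite -(eq_finite_set (inj_card_eq codeI)).
Qed.

Context {n : nat}.
Implicit Types (G : set (heis R n)) (g h : heis R n).

Lemma norm_hcenter (r : R) : `|hcenter r : heis R n| <= `|r|.
Proof.
apply: norm_le_coord => // i; have [j ->|j ->] := split_ordP i.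
  by rewrite hcenterEl normr0.
by rewrite (ord1 j) -/(hz _) hcenterEr.
Qed.

Lemma hsymp_le g h : `|hsymp g h| <= (2 * n)%:R * (`|g| * `|h|).
Proof.
apply: le_trans (ler_norm_sum _ _ _) _.
rewrite mulnC natrM -mulrA mulr_natl -[X in _ *+ X]card_ord -sumr_const.
apply: ler_sum => i _; apply: le_trans (ler_normB _ _) _.
rewrite !normrM !hxE !hyE mulrDl !mul1r.
by apply: lerD; apply: ler_pM => //; exact: coord_le_norm.
Qed.

Lemma hmul_inv_le g h : `|hmul (hinv g) h| <= (1 + n%:R * `|g|) * `|h - g|.
Proof.
rewrite /hmul /hinv hsympNl.
have -> : hsymp g h = hsymp g (h - g) by rewrite hsympDr hsympNr hsymp_diag subr0.
rewrite [- g + h]addrC; apply: le_trans (ler_normD _ _) _.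
rewrite mulrDl mul1r lerD2l; apply: le_trans (norm_hcenter _) _.
rewrite normrM normrN ger0_norm ?invr_ge0//.
rewrite ler_pdivrMr//; apply: le_trans (hsymp_le _ _) _.
by rewrite natrM; lra.
Qed.

(** Left translation makes the isolation of 0 uniform on bounded sets: for g, h in the ball of
    radius K, |g^-1 h| <= (1 + n K) |h - g|, so distinct elements of G there are at least e / (1 + n
    K) apart. *)
Lemma lattice_finite G (K : R) : lattice G ->
  finite_set (G `&` [set g | `|g| <= K]).
Proof.
case=> G0 GM GV Gd _.
have /nbhs_ballP[e /= e0 He] := Gd 0 G0.
have [K0|K0] := ltP K 0.
  rewrite (_ : _ `&` _ = set0)//; apply/seteqP; split => // g [_ /= gK].
  by have := le_lt_trans (le_trans (normr_ge0 g) gK) K0; rewrite ltxx.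
have k0 : 0 < 1 + n%:R * K by rewrite ltr_wpDr// mulr_ge0.
apply: (@separated_finite _ _ K (e / (1 + n%:R * K))) => [x []//||x y [Gx xK] [Gy yK] xy].
  exact: divr_gt0.
rewrite -[x]hmulg0 -(He (hmul (hinv x) y)) ?hmulVKg//; last by apply: GM => //; exact: GV.
rewrite -ball_normE /= sub0r normrN; apply: le_lt_trans (hmul_inv_le _ _) _.
rewrite distrC -ltr_pdivlMl ?ltr_wpDr ?mulr_ge0// mulrC.
apply: lt_le_trans xy _; rewrite ler_pM2l// lef_pV2 ?posrE ?ltr_wpDr ?mulr_ge0//.
by rewrite lerD2l ler_wpM2l.
Qed.

Lemma lattice_countable G : lattice G -> countable G.
Proof.
move=> lG; have -> : G = \bigcup_(k in [set: nat]) (G `&` [set g | `|g| <= k%:R]).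
  apply/seteqP; split => [g Gg|g [k _ []//]].
  exists (Num.truncn `|g|).+1 => //; split => //=; apply/ltW.
  by have /andP[] := truncn_itv (normr_ge0 g).
apply: bigcup_countable => // k _; apply: finite_set_countable; exact: lattice_finite.
Qed.

Lemma hscale_mul (a b : R) g : hmul (a *: g) (b *: g) = (a + b) *: g.
Proof.
by rewrite /hmul hsympZl hsympZr hsymp_diag !mulr0 mul0r hcenter0 addr0 scalerDl.
Qed.

Definition hsubgroup (P : heis R n -> Prop) := [/\ P 0,
  (forall g h, P g -> P h -> P (hmul g h)) & forall g, P g -> P (hinv g)].

Lemma hsubgroupZ P (k : int) g : hsubgroup P -> P g -> P (k%:~R *: g).
Proof.
move=> [P0 PM PV] Pg; have posZ (j : nat) : P (j%:R *: g).
  elim: j => [|j IH]; first by rewrite scale0r.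
  by rewrite -natr1 -hscale_mul scale1r; exact: PM.
case: k => k; first by rewrite -pmulrn; exact: posZ.
by rewrite NegzE mulrNz scaleNr -pmulrn; apply: PV.
Qed.

Lemma lattice_hsubgroup G : lattice G -> hsubgroup G.
Proof. by case. Qed.

Definition hproj G : set 'rV[R]_(n + n) := [set x | exists2 g, G g & hw g = x].

Lemma hproj_subgroup G : hsubgroup G -> subgroup (hproj G).
Proof.
move=> [G0 GM GV]; split; first by exists 0; rewrite ?hw0.
move=> _ _ [g Gg <-] [h Gh <-]; exists (hmul g (hinv h)).
  by apply: GM => //; exact: GV.
by rewrite hw_mul hw_inv.
Qed.

Lemma hcommutator g h :
  hmul (hmul g h) (hmul (hinv g) (hinv h)) = hcenter (hsymp g h).
Proof.
apply: heisP.
  by rewrite !hw_mul !hw_inv hw_center addrACA !subrr addr0.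
rewrite !hz_mul !hsymp_mulr !hsymp_mull /hinv !hzN !hsympNl !hsympNr !hsymp_diag hcenterEr.
by rewrite (hsympC h g); lra.
Qed.

Lemma hsubgroup_commutator P g h : hsubgroup P -> P g -> P h -> P (hcenter (hsymp g h)).
Proof.
move=> [P0 PM PV] Pg Ph; rewrite -hcommutator; apply: (PM); first exact: PM.
by apply: PM; exact: PV.
Qed.

(** The generator is the least positive central coordinate, which exists because only finitely many
    are at most |r|; a remainder modulo it would be smaller. *)
Lemma lattice_center G : lattice G -> (exists2 r, r != 0 & G (hcenter r)) ->
  exists z : R, [/\ 0 < z, G (hcenter z) &
    forall r, G (hcenter r) -> exists k : int, r = k%:~R * z].
Proof.
move=> lG [r r0 Gr].
pose S := [set g | [/\ G g, hw g = 0, 0 < hz g & hz g <= `|r|]].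
have fS : finite_set S.
  apply: sub_finite_set (lattice_finite `|r| lG) => g [Gg g0 gz gr]; split => //=.
  by rewrite (hw0_center g0); apply: le_trans (norm_hcenter _) _; rewrite ger0_norm// ltW.
have S0 : S !=set0.
  have [r1|r1] := ltP 0 r.
    by exists (hcenter r); split; rewrite ?hw_center ?hcenterEr// ler_norm.
  exists (hcenter (- r)); split; rewrite ?hw_center ?hcenterEr//.
  - by rewrite hcenterN; case: lG => _ _ GV _ _; exact: GV.
  - by rewrite oppr_gt0 lt_neqAle r0.
  - by rewrite ler0_norm.
have [g [Gg g0 gz gr] gmin] := finite_argmin (fun g => hz g) fS S0.
exists (hz g); split => //; first by rewrite -(hw0_center g0).
move=> s Gs; exists (Num.floor (s / hz g)).
have := floor_itv (s / hz g); set k := Num.floor _.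
rewrite intrD ler_pdivlMr// ltr_pdivrMr// => /andP[h1 h2].
apply/eqP; rewrite eq_le h1 andbT leNgt; apply/negP => h3.
have Gk : G (hcenter (s - k%:~R * hz g)).
  have sG := lattice_hsubgroup lG; have [G0 GM GV] := sG.
  rewrite hcenterD hcenterN hcenterZ -(hw0_center g0) addrC.
  have -> : - (k%:~R *: g) + hcenter s = hmul (hinv (k%:~R *: g)) (hcenter s).
    by rewrite hmul_centerr.
  by apply: GM => //; apply: GV; exact: hsubgroupZ.
have Sk : S (hcenter (s - k%:~R * hz g)).
  split; rewrite ?hw_center ?hcenterEr//; first by rewrite subr_gt0.
  by apply: le_trans gr; lra.
by have := gmin _ Sk; rewrite hcenterEr; lra.
Qed.

End Lattices.

Section Generators.
Context {R : realType} {n : nat}.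
Implicit Types (G : set (heis R n)) (g h : heis R n).

Lemma center_reduce G (z : R) g : hsubgroup G -> 0 < z -> G (hcenter z) ->
  exists2 c : R, G (hcenter c) & 0 <= hz g + c < z.
Proof.
move=> sG z0 Gz; pose k := Num.floor (hz g / z).
exists (- (k%:~R * z)).
  rewrite hcenterN hcenterZ; have [_ _ GV] := sG; apply: GV; exact: hsubgroupZ.
have := floor_itv (hz g / z); rewrite -/k intrD ler_pdivlMr// ltr_pdivrMr//.
by move=> /andP[h1 h2]; apply/andP; split; lra.
Qed.

(** The projection modulo the centre stays discrete: a projected element has a lift with central
    coordinate in [0, z[, so a bounded part of the projection is the image of a bounded part of
    G. *)
Lemma hproj_finite G (z K : R) : lattice G -> 0 < z -> G (hcenter z) ->
  finite_set (hproj G `&` [set x | `|x| <= K]).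
Proof.
move=> lG z0 Gz; have sG := lattice_hsubgroup lG; have [_ GM _] := sG.
have [K0|K0] := ltP K 0.
  rewrite (_ : _ `&` _ = set0)//; apply/seteqP; split => // g [_ /= gK].
  by have := le_lt_trans (le_trans (normr_ge0 g) gK) K0; rewrite ltxx.
apply: sub_finite_set (finite_image (@hw R n) (lattice_finite (Num.max K z) lG)).
move=> x [[g Gg <-] /= gK]; have [c Gc /andP[c0 cz]] := center_reduce g sG z0 Gz.
exists (hmul g (hcenter c)); last by rewrite hw_mul hw_center addr0.
split; first exact: GM.
apply: norm_le_coord => [|i]; first by rewrite le_max K0.
have [j ->|j ->] := split_ordP i.
  rewrite -hwE hw_mul hw_center addr0; apply: le_trans (coord_le_norm _ _) _.
  by rewrite le_max gK.
rewrite (ord1 j) -/(hz _) hz_mul hcenterEr hsymp_centerr mul0r addr0.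
by rewrite ger0_norm// le_max (ltW cz) orbT.
Qed.

(** A symplectic form vanishing on a basis would be zero. Applied to lattice elements, this produces
    a nontrivial central commutator. *)
Lemma hsymp_basis (l : 'I_(n + n) -> heis R n) : (1 <= n)%N ->
  \matrix_i hw (l i) \in unitmx -> exists i j, hsymp (l i) (l j) != 0.
Proof.
move=> n1 uL; apply: contrapT => nH.
have l0 i j : hsymp (l i) (l j) = 0.
  by apply: contrapT => /eqP ?; apply: nH; exists i, j.
have comb g : hsymp g = hsymp (\sum_i (hw g *m invmx (\matrix_i hw (l i))) 0 i *: l i).
  apply/funext => h; rewrite hsymp_hw [RHS]hsymp_hw; congr (hsymp (hlift _) _).
  rewrite hw_sum -[LHS](mulmxKV uL) mulmx_sum_row; apply: eq_bigr => i _.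
  by rewrite hwZ rowK.
have all0 g : hw g = 0.
  apply: hsymp_nondegenerate => h; rewrite comb hsympC comb -hsympC.
  rewrite hsymp_suml big1// => i _; rewrite hsympZl hsymp_sumr big1 ?mulr0// => j _.
  by rewrite hsympZr l0 mulr0.
have i0 : 'I_(n + n) by exists 0%N; rewrite addn_gt0 n1.
have := all0 (hlift (delta_mx 0 i0)); rewrite hw_hlift => /rowP/(_ i0).
by rewrite !mxE !eqxx => /eqP; rewrite oner_eq0.
Qed.

(* The last clause says that hcenter z and the gam i generate G. *)
Lemma lattice_generators G (l : 'I_(n + n) -> heis R n) : (1 <= n)%N ->
  lattice G -> (forall i, G (l i)) -> \matrix_i hw (l i) \in unitmx ->
  exists (z : R) (gam : 'I_(n + n) -> heis R n) (A : 'M[R]_(n + n)),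
  [/\ [/\ 0 < z, G (hcenter z) & forall r, G (hcenter r) -> exists k : int, r = k%:~R * z],
      [/\ forall i, G (gam i), forall i j, `|A i j| <= 1, A \in unitmx &
          \matrix_i hw (gam i) = A *m \matrix_i hw (l i)] &
      forall P : heis R n -> Prop, hsubgroup P -> P (hcenter z) ->
        (forall i, P (gam i)) -> forall g, G g -> P g].
Proof.
move=> n1 lG Gl uL; have sG := lattice_hsubgroup lG; have [G0 GM GV] := sG.
have [i [j lij]] := hsymp_basis n1 uL.
have [|z [z0 Gz zP]] := lattice_center lG.
  by exists (hsymp (l i) (l j)) => //; exact: hsubgroup_commutator.
have Ll k : hproj G (row k (\matrix_i hw (l i))).
  by exists (l k) => //; rewrite rowK.
have [A [A1 uA AL Abasis]] := short_basis (hproj_subgroup sG)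
  (fun K => hproj_finite K lG z0 Gz) uL Ll.
have /choice[gam gamP] : forall k, exists g, G g /\ hw g = row k (A *m \matrix_i hw (l i)).
  by move=> k; have [g Gg gE] := AL k; exists g.
exists z, gam, A; split => //.
  split => //; first by move=> k; case: (gamP k).
  by apply/row_matrixP => k; rewrite rowK; case: (gamP k).
move=> P sP Pz Pgam g Gg; have [P0 PM PV] := sP.
have [c Hc] := Abasis (hw g) (ex_intro2 _ _ g Gg erefl).
(* [h] is a product of powers of the generators with the same projection as [g]; the quotient of the
   two is central, hence a power of [hcenter z]. *)
have [h [Gh Ph hh]] : exists h, [/\ G h, P h & hw h = hw g].
  rewrite Hc; elim/big_ind : _ => [|x y [h1 [G1 P1 <-]] [h2 [G2 P2 <-]]|k _].
  - by exists 0; rewrite hw0.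
  - by exists (hmul h1 h2); rewrite hw_mul; split; [exact: GM|exact: PM|].
  - exists ((c k)%:~R *: gam k); have [Gk kE] := gamP k.
    by split; [exact: hsubgroupZ|exact: hsubgroupZ|rewrite hwZ kE].
rewrite -(hmulVKg h g); apply: (PM) => //.
have hg0 : hw (hmul (hinv h) g) = 0 by rewrite hw_mul hw_inv hh addNr.
rewrite (hw0_center hg0); have [|k ->] := zP (hz (hmul (hinv h) g)).
  by rewrite -(hw0_center hg0); apply: GM => //; exact: GV.
by rewrite hcenterZ; exact: hsubgroupZ.
Qed.

Lemma measurable_paral m (U : 'M[R]_m) (b : 'rV[R]_m) : U \in unitmx ->
  measurable (paral U b : set (borelRV m)).
Proof.
move=> uU; pose f (i : 'I_m) (x : 'rV[R]_m) := \sum_j (x 0 j - b 0 j) * invmx U j i.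
have mf i : measurable_fun setT (f i : borelRV m -> measurableTypeR R).
  rewrite /f; apply: measurable_sum => j; apply: measurable_funM; last exact: measurable_cst.
  by apply: measurable_funB; [exact: measurable_coord|exact: measurable_cst].
have fE i x : f i x = ((x - b) *m invmx U) 0 i.
  by rewrite mxE; apply: eq_bigr => j _; rewrite !mxE.
have -> : paral U b = \bigcap_(i in [set: 'I_m]) (f i @^-1` `[0, 1]).
  apply/seteqP; split => [x [y yi ->] i _ /=|x xi].
    by rewrite in_itv /= fE addrK mulmxK.
  exists ((x - b) *m invmx U) => [i|]; last by rewrite mulmxKV// subrK.
  by have := xi i I; rewrite /= in_itv /= fE.
apply: fin_bigcap_measurable => // i _.
by rewrite -[X in measurable X]setTI; apply: mf => //; exact: measurable_itv.
Qed.

(** The box with horizontal part [U] and height z covers H_n under G: an element of G corrects the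
    horizontal coordinates, then a central one the last coordinate. *)
Lemma lattice_volume_le G F (z : R) (gam : 'I_(n + n) -> heis R n) :
  lattice G -> fundamental_domain G F -> 0 < z -> G (hcenter z) ->
  (forall i, G (gam i)) -> \matrix_i hw (gam i) \in unitmx ->
  (leb_volume F <= (`|\det (\matrix_i hw (gam i))| * z)%:E)%E.
Proof.
move=> lG fF z0 Gz Ggam uB; have sG := lattice_hsubgroup lG; have [G0 GM GV] := sG.
have LB k : hproj G (row k (\matrix_i hw (gam i))).
  by exists (gam k) => //; rewrite rowK.
have [U [Uup Ud Udet Ucov]] := subgroup_paral (hproj_subgroup sG) uB LB.
pose W : 'M[R]_(n + n + 1) := block_mx U 0 0 (z%:M : 'M[R]_1).
have Wup (i j : 'I_(n + n + 1)) : (j < i)%N -> W i j = 0.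
  rewrite /W; have [k ->|k ->] := split_ordP i; have [l ->|l ->] := split_ordP j => /= lt.
  - by rewrite block_mxEul Uup.
  - by rewrite block_mxEur mxE.
  - by rewrite block_mxEdl mxE.
  - by move: lt; rewrite (ord1 k) (ord1 l) ltnn.
have Wd i : W i i != 0.
  rewrite /W; have [k ->|k ->] := split_ordP i; first by rewrite block_mxEul.
  by rewrite block_mxEdr (ord1 k) mxE eqxx mulr1n gt_eqF.
have Wdet : \prod_i `|W i i| = `|\det (\matrix_i hw (gam i))| * z.
  rewrite big_split_ord /= big_ord1 -Udet /W block_mxEdr mxE eqxx mulr1n (gtr0_norm z0).
  by congr (_ * _); apply: eq_bigr => i _; rewrite block_mxEul.
have uW : W \in unitmx.
  by rewrite unitmxE unitfE (det_upper Wup); apply/prodf_neq0 => i _.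
rewrite -Wdet; apply: le_trans (leb_volume_paral 0 Wup Wd).
apply: (fundamental_domain_volume_le GM GV (lattice_countable lG) fF).
  exact: measurable_paral.
move=> x; have [_ [g Gg <-] [y yi xE]] := Ucov (hw x).
have [c Gc /andP[c0 cz]] := center_reduce (hmul g x) sG z0 Gz.
exists (hmul (hcenter c) g); first exact: GM.
exists (row_mx y ((hz (hmul g x) + c) / z)%:M).
  move=> i; have [k ->|k ->] := split_ordP i; first by rewrite row_mxEl.
  rewrite row_mxEr (ord1 k) mxE eqxx mulr1n ler_pdivlMr// ler_pdivrMr//.
  by rewrite mul0r mul1r c0 (ltW cz).
rewrite addr0 -hmulA hmul_centerl /W mul_row_block !mulmx0 addr0 add0r.
apply: heisP.
  by rewrite hwD hw_center addr0 /hw row_mxKl -xE -/(hw _) hw_mul addrC.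
rewrite hzD hcenterEr /hz row_mxEr -scalar_mxM !mxE eqxx mulr1n.
by rewrite mulfVK// gt_eqF.
Qed.
End Generators.

(** * Horizontal paths and the distance *)

Section Derivatives.
Context {R : realType}.

Definition has_deriv (V : normedModType R) (c : R -> V) (t : R) (d : V) : Prop :=
  (fun h => h^-1 *: (c (h + t) - c t)) @ 0^' --> d.

Lemma derivable_has_deriv (V : normedModType R) (c : R -> V) t :
  derivable c t 1 -> has_deriv c t (derive1 c t).
Proof. exact: derivable_cvg. Qed.

Lemma has_deriv_derivable (V : normedModType R) (c : R -> V) t d :
  has_deriv c t d -> derivable c t 1.
Proof.
move=> cd; apply/cvg_ex; exists d; move: cd; rewrite /has_deriv.
set f := (fun _ : R => _); set g := (fun _ : R => _).
suff -> : f = g by [].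
by rewrite funeqE => k; rewrite /f /g /= [k%:A]mulr1.
Qed.

Lemma has_deriv_derive1 (V : normedModType R) (c : R -> V) t d :
  has_deriv c t d -> derive1 c t = d.
Proof. by move=> cd; apply: cvg_lim. Qed.

Lemma linear_bounded m (V : normedModType R) (f : 'rV[R]_m -> V) :
  (forall x y, f (x + y) = f x + f y) -> (forall a x, f (a *: x) = a *: f x) ->
  exists2 C, 0 <= C & forall x, `|f x| <= C * `|x|.
Proof.
move=> fD fZ; have f0 : f 0 = 0 by rewrite -(scale0r 0) fZ scale0r.
exists (\sum_i `|f (delta_mx 0 i)|); first exact: sumr_ge0.
move=> x; rewrite {1}[x]row_sum_delta (big_morph f fD f0).
apply: le_trans (ler_norm_sum _ _ _) _; rewrite mulr_suml; apply: ler_sum => i _.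
by rewrite fZ normrZ mulrC; apply: ler_wpM2l => //; exact: coord_le_norm.
Qed.

Lemma has_deriv_linear m (V : normedModType R) (f : 'rV[R]_m -> V) (k : V)
    (c : R -> 'rV[R]_m) t d :
  (forall x y, f (x + y) = f x + f y) -> (forall a x, f (a *: x) = a *: f x) ->
  has_deriv c t d -> has_deriv (fun s => k + f (c s)) t (f d).
Proof.
move=> fD fZ; have fB x y : f (x - y) = f x - f y by rewrite fD -scaleN1r fZ scaleN1r.
have [C C0 fC] := linear_bounded fD fZ.
rewrite /has_deriv => /cvgrPdist_lt cd; apply/cvgrPdist_lt => e e0.
have e1 : 0 < e / (C + 1) by rewrite divr_gt0// ltr_wpDl.
have := cd _ e1; apply: filterS => h.
rewrite opprD addrACA subrr add0r -fB -fZ -fB => H.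
apply: le_lt_trans (fC _) _; apply: (@le_lt_trans _ _ ((C + 1) * `|d - h^-1 *: (c (h + t) - c t)|)).
  by apply: ler_wpM2r => //; rewrite lerDl.
by rewrite mulrC -ltr_pdivlMr// ltr_wpDl.
Qed.

Lemma ac_lip (V W : normedModType R) (a b C : R) (f : R -> V) (g : R -> W) :
  ac a b f -> (forall s t, a <= s <= b -> a <= t <= b -> `|g s - g t| <= C * `|f s - f t|) ->
  ac a b g.
Proof.
move=> acf fg e e0; have C0 : 0 < `|C| + 1 by rewrite ltr_wpDl.
have [d d0 Hd] := acf (e / (`|C| + 1)) (divr_gt0 e0 C0); exists d => // s sall spair slen.
have := Hd s sall spair slen; rewrite ltr_pdivlMr// => /le_lt_trans; apply.
rewrite mulr_suml !big_seq; apply: ler_sum => p ps.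
have /and3P[h1 h2 h3] := allP sall _ ps.
apply: le_trans (fg _ _ _ _) _; first by rewrite h3 (le_trans h1 h2).
  by rewrite h1 (le_trans h2 h3).
rewrite mulrC; apply: ler_wpM2l => //.
by apply: le_trans (ler_norm _) _; rewrite lerDl.
Qed.

Lemma ac_id (a b : R) : ac a b (fun t : R => t : R^o).
Proof.
move=> e e0; exists e => // s sall _; apply: le_lt_trans.
rewrite !big_seq; apply: ler_sum => p ps.
have /and3P[_ h2 _] := allP sall _ ps.
by rewrite ger0_norm// subr_ge0.
Qed.

Lemma ac_linear m (V : normedModType R) (f : 'rV[R]_m -> V) (k : V) a b (c : R -> 'rV[R]_m) :
  (forall x y, f (x + y) = f x + f y) -> (forall a x, f (a *: x) = a *: f x) ->
  ac a b c -> ac a b (fun s => k + f (c s)).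
Proof.
move=> fD fZ acc; have fB x y : f (x - y) = f x - f y by rewrite fD -scaleN1r fZ scaleN1r.
have [C C0 fC] := linear_bounded fD fZ.
apply: (ac_lip (C := C) acc) => s t _ _.
by rewrite opprD addrACA subrr add0r -fB; exact: fC.
Qed.

Lemma ac_sub (V : normedModType R) (a b b' : R) (f : R -> V) :
  b' <= b -> ac a b f -> ac a b' f.
Proof.
move=> bb acf e e0; have [d d0 Hd] := acf e e0; exists d => // s sall.
apply: Hd; apply: sub_all sall => p /and3P[-> -> h]; exact: le_trans h bb.
Qed.
End Derivatives.

Lemma ae_mono {R : realType} (P Q : R -> Prop) : (forall t, P t -> Q t) ->
  {ae (@lebesgue_measure R), forall t, P t} -> {ae (@lebesgue_measure R), forall t, Q t}.
Proof. by move=> PQ; apply: negligibleS => t /= nQ /PQ. Qed.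

Lemma ae_itv_closed {R : realType} (a b : R) (P : R -> Prop) :
  {ae (@lebesgue_measure R), forall t, t \in `]a, b[ -> P t} ->
  {ae (@lebesgue_measure R), forall t, t \in `[a, b] -> P t}.
Proof.
have neg (x : R) : (@lebesgue_measure R).-negligible [set x].
  by exists [set x]; split; [exact: measurable_set1|exact: lebesgue_measure_set1|].
move=> aeP; apply: negligibleS (negligibleU (negligibleU (neg a) (neg b)) aeP).
move=> t /= tP; have [->|ta] := eqVneq t a; first by left; left.
have [->|tb] := eqVneq t b; first by left; right.
right=> tP'; apply: tP; rewrite in_itv /= => /andP[h1 h2].
by apply: tP'; rewrite in_itv /= !lt_neqAle h1 h2 !andbT eq_sym ta.
Qed.

Section HorizontalPaths.
Context {R : realType} {n : nat}.
Implicit Types (M : sr_metric R n) (c : R -> heis R n).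
Local Notation leb := (@lebesgue_measure R).

(** For fixed t the map s |-> c(t)^-1 c(s) is an affine function of c(s), with the linear part
    displayed here. *)
Lemma has_deriv_left_velocity c t d : has_deriv c t d ->
  has_deriv (fun s => hmul (hinv (c t)) (c s)) t (d - hcenter (hsymp (c t) d / 2)).
Proof.
move=> cd; have := @has_deriv_linear _ _ _ (fun x => x - hcenter (hsymp (c t) x / 2))
  (- c t) c t d _ _ cd.
have -> : (fun s => - c t + (c s - hcenter (hsymp (c t) (c s) / 2))) =
    (fun s => hmul (hinv (c t)) (c s)).
  by apply/funext => s; rewrite /hmul /hinv hsympNl mulNr hcenterN addrA.
apply.
- by move=> x y; rewrite hsympDr mulrDl hcenterD opprD addrACA.
- by move=> a x; rewrite hsympZr -mulrA hcenterZ scalerBr.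
Qed.

Lemma left_velocityE c t : derivable c t 1 ->
  left_velocity c t = derive1 c t - hcenter (hsymp (c t) (derive1 c t) / 2).
Proof.
by move=> /derivable_has_deriv/has_deriv_left_velocity/has_deriv_derive1.
Qed.

(** In exponential coordinates a linear map of this kind is an endomorphism of the group and of its
    Lie algebra alike; [rho] is its factor on the centre. *)
Definition automorphism (P : 'M[R]_(n + n + 1)) (rho : R) :=
  (forall x y : heis R n, hsymp (x *m P) (y *m P) = rho * hsymp x y) /\
  (forall r : R, (hcenter r : heis R n) *m P = hcenter (rho * r)).

Lemma automorphismM P rho (x y : heis R n) : automorphism P rho ->
  hmul (x *m P) (y *m P) = hmul x y *m P.
Proof. by move=> [Ps Pc]; rewrite /hmul Ps !mulmxDl Pc mulrA. Qed.

Lemma hinv_mulmx (P : 'M[R]_(n + n + 1)) (x : heis R n) : hinv (x *m P) = hinv x *m P.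
Proof. by rewrite /hinv mulNmx. Qed.

Section Affine.
Variables (P : 'M[R]_(n + n + 1)) (rho : R) (a : heis R n).
Hypothesis autP : automorphism P rho.
Let Phi (x : heis R n) := hmul a (x *m P).
Let psi (x : heis R n) := x *m P + hcenter (hsymp a (x *m P) / 2).

Let PhiE x : Phi x = a + psi x.
Proof. by rewrite /Phi /psi /hmul addrA. Qed.

Let psiD x y : psi (x + y) = psi x + psi y.
Proof. by rewrite /psi mulmxDl hsympDr mulrDl hcenterD addrACA. Qed.

Let psiZ (k : R) x : psi (k *: x) = k *: psi x.
Proof. by rewrite /psi -scalemxAl hsympZr -mulrA hcenterZ scalerDr. Qed.

Lemma affine_left_velocity c t : derivable c t 1 ->
  derivable (Phi \o c) t 1 /\ left_velocity (Phi \o c) t = left_velocity c t *m P.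
Proof.
move=> /derivable_has_deriv cd; split.
  have := has_deriv_linear a psiD psiZ cd => /has_deriv_derivable.
  by congr (derivable _ t 1); apply/funext => s; rewrite /= PhiE.
have dc : derivable c t 1 by exact: has_deriv_derivable cd.
pose L (x : heis R n) : heis R n := x *m P.
have LD x y : L (x + y) = L x + L y by exact: mulmxDl.
have LZ (k : R) x : L (k *: x) = k *: L x by rewrite /L scalemxAl.
have H := has_deriv_linear 0 LD LZ (has_deriv_left_velocity cd).
rewrite -/(L _) (left_velocityE dc) -(has_deriv_derive1 H) /left_velocity.
congr (derive1 _ t); apply/funext => s.
rewrite add0r /L /= /Phi hinvM -hmulA hmulKg hinv_mulmx.
exact: (automorphismM _ _ autP).
Qed.

Lemma affine_horizontal M M' c : {in sr_space M, forall w, w *m P \in sr_space M'} ->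
  horizontal M c -> horizontal M' (Phi \o c).
Proof.
move=> PM [acc hc]; split.
  have := ac_linear a psiD psiZ acc; rewrite /ac /abs_continuous.
  by have -> : Phi \o c = (fun s => a + psi (c s)) by apply/funext => s; rewrite /= PhiE.
apply: ae_mono hc => t ht tI; have [dc lc] := ht tI.
have [dPc lPc] := affine_left_velocity dc; split => //.
by rewrite lPc; exact: PM.
Qed.

(** Paths in H_n from one orbit to the other are transported by [Phi], which multiplies speeds by at
    most K; left translations do not change left velocities. So only the images of the two orbits
    matter. *)
Lemma sr_dist_affine M M' (G G' : set (heis R n)) (K : R)
    (A B : heis_quot G) (A' B' : heis_quot G') : 0 < K ->
  {in sr_space M, forall w, w *m P \in sr_space M'} ->
  {in sr_space M, forall w, Num.sqrt (sr_prod M' (w *m P) (w *m P)) <=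
                            K * Num.sqrt (sr_prod M w w)} ->
  (forall x, sval A x -> sval A' (Phi x)) -> (forall x, sval B x -> sval B' (Phi x)) ->
  (sr_dist M' A' B' <= K%:E * sr_dist M A B)%E.
Proof.
move=> K0 PM PK AA BB; rewrite -lee_pdivrMl//; apply: le_ereal_inf_tmp => _ [c [hc c0 c1] <-].
rewrite lee_pdivrMl//; apply: (@le_trans _ _ (sr_length M' (Phi \o c))).
  apply: ereal_inf_lbound; exists (Phi \o c) => //; split.
  - exact: affine_horizontal hc.
  - exact: AA.
  - exact: BB.
apply: ae_le_integral => //.
have [_ hl] := hc; apply: ae_itv_closed.
apply: ae_mono hl => t ht tI; have [dc lc] := ht tI.
by have [_ ->] := affine_left_velocity dc; exact: PK.
Qed.
End Affine.
End HorizontalPaths.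

(** * Estimates of lengths in orthonormal coordinates *)

Section Coordinates.
Context {R : realType} {n : nat}.
Implicit Types (M : sr_metric R n) (c : R -> heis R n).
Local Notation leb := (@lebesgue_measure R).

(* S is the section of hw whose image is the horizontal space, and Q reads the
   components in an orthonormal frame of that space off hw. *)
Record sr_coord M (S : 'M[R]_(n + n, n + n + 1)) (Q : 'M[R]_(n + n)) : Prop := SrCoord {
  src_unit : Q \in unitmx;
  src_mem : forall x : 'rV[R]_(n + n), x *m S \in sr_space M;
  src_hw : forall x : 'rV[R]_(n + n), hw (x *m S) = x;
  src_eq : {in sr_space M, forall w, w = hw w *m S};
  src_prod : {in sr_space M, forall w,
    sr_prod M w w = \sum_i (hw w *m Q) 0 i ^+ 2} }.

Definition sr_norm M w := Num.sqrt (sr_prod M w w).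

Lemma src_coord_le M S Q w i : sr_coord M S Q -> w \in sr_space M ->
  `|(hw w *m Q) 0 i| <= sr_norm M w.
Proof.
move=> MQ wM; rewrite /sr_norm (src_prod MQ wM) -sqrtr_sqr ler_wsqrtr//.
by rewrite (bigD1 i)//= lerDl sumr_ge0// => j _; exact: sqr_ge0.
Qed.

(** Used with L = 1 for an orthonormal coordinate, where any t in [0, 1] may be the end point, and
    with a small L for the vertical coordinate of a short path. *)
Lemma horizontal_linear_le M c (f : heis R n -> R^o) (L : R) (k : R^o) (t : R) :
  (forall x y, f (x + y) = f x + f y) -> (forall a x, f (a *: x) = a *: f x) ->
  0 < L -> 0 <= t <= 1 -> horizontal M c ->
  (forall s, s \in `]0, t[ -> derivable c s 1 -> left_velocity c s \in sr_space M ->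
    `|f (derive1 c s)| <= L * sr_norm M (left_velocity c s)) ->
  (`|f (c t) - f (c 0)|%:E <= L%:E * sr_length M c)%E.
Proof.
move=> fD fZ L0 /andP[t0 t1] [acc hc] fL.
have acf : ac 0 t (fun s => f (c s)).
  have := ac_linear 0 fD fZ acc => /(ac_sub t1).
  by congr (ac _ _ _); apply/funext => s; rewrite add0r.
pose h s := L * sr_norm M (left_velocity c s).
have h0 s : 0 <= h s by rewrite mulr_ge0 ?(ltW L0)// sqrtr_ge0.
have aeh : {ae leb, forall s, s \in `]0, t[ ->
    derivable (fun s => f (c s)) s 1 /\ `|derive1 (fun s => f (c s)) s| <= h s}.
  apply: ae_mono hc => s hs sI; have [|dc lc] := hs.
    by move: sI; rewrite !in_itv /= => /andP[-> /lt_le_trans]; apply.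
  have : has_deriv (fun s => f (c s)) s (f (derive1 c s)).
    have := has_deriv_linear 0 fD fZ (derivable_has_deriv dc).
    by congr (has_deriv _ _ _); apply/funext => r; rewrite add0r.
  move=> fd; split; first exact: has_deriv_derivable fd.
  by rewrite (has_deriv_derive1 fd); exact: fL.
apply: le_trans (ac_le_integral t0 acf h0 aeh) _.
apply: (@le_trans _ _ (\int[leb]_(s in `[0%R, 1%R]) (h s)%:E)%E); last first.
  by apply: ae_le_integral => //; exact: aeW.
rewrite integral_mkcond [leRHS]integral_mkcond; apply: ge0_le_integral_nomeas => s.
  by rewrite patchE; case: ifP => // _; rewrite lee_fin.
rewrite !patchE; case: ifPn => [|_]; last by case: ifP => // _; rewrite lee_fin.
rewrite inE /= in_itv /= => /andP[s0 st]; rewrite ifT// inE /= in_itv /= s0.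
exact: le_trans st t1.
Qed.

Lemma hw_left_velocity c t : derivable c t 1 -> hw (left_velocity c t) = hw (derive1 c t).
Proof. by move=> dc; rewrite left_velocityE// hwB hw_center subr0. Qed.

Lemma horizontal_coord_le M S Q c i t : sr_coord M S Q -> horizontal M c -> 0 <= t <= 1 ->
  (`|((hw (c t) - hw (c 0)) *m Q) 0 i|%:E <= sr_length M c)%E.
Proof.
move=> MQ hc t01; pose f (x : heis R n) : R^o := (hw x *m Q) 0 i.
have fD x y : f (x + y) = f x + f y by rewrite /f hwD mulmxDl [LHS]mxE.
have fZ a x : f (a *: x) = a *: f x by rewrite /f hwZ -scalemxAl [LHS]mxE.
have := @horizontal_linear_le M c f 1 0 t fD fZ ltr01 t01 hc.
rewrite mul1e => H; rewrite mulmxBl mxE [X in _ + X]mxE; apply: H => s _ dc lc.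
by rewrite mul1r /f -hw_left_velocity//; exact: src_coord_le MQ _.
Qed.

(** The path s |-> x (s w), a translated one-parameter subgroup, has constant left velocity w. *)
Lemma straight_line_length M S Q (G : set (heis R n)) (A B : heis_quot G) x w :
  sr_coord M S Q -> w \in sr_space M -> sval A x -> sval B (hmul x w) ->
  (sr_dist M A B <= (sr_norm M w)%:E)%E.
Proof.
move=> MQ wM Ax Bxw; pose c (s : R) : heis R n := hmul x (s *: w).
pose d := w + hcenter (hsymp x w / 2).
have cE s : c s = x + s *: d.
  by rewrite /c /hmul /d hsympZr -mulrA hcenterZ scalerDr addrA.
have cd t : has_deriv c t d.
  rewrite /has_deriv; apply: (@cvg_trans _ ((fun=> d) @ (0 : R)^')); last exact: cvg_cst.
  apply: near_eq_cvg; near=> h.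
  rewrite !cE opprD addrACA subrr add0r -scalerBl addrK scalerA mulVf ?scale1r//.
  by near: h; exact: nbhs_dnbhs_neq.
have lc t : left_velocity c t = w.
  rewrite left_velocityE ?(has_deriv_derive1 (cd t)); last exact: has_deriv_derivable (cd t).
  have -> : hsymp (c t) d = hsymp x w.
    by rewrite /c hsymp_mull hsympZl /d !hsympDr !hsymp_centerr hsymp_diag !addr0 mulr0 addr0.
  by rewrite /d addrK.
have acc : abs_continuous 0 1 c.
  apply: (@ac_lip R _ _ 0 1 `|d| (fun t : R => t : R^o) c (ac_id 0 1)) => s t _ _.
  by rewrite !cE opprD addrACA subrr add0r -scalerBl normrZ mulrC.
apply: (@le_trans _ _ (sr_length M c)).
  apply: ereal_inf_lbound; exists c => //; split.
  - split => //; apply: aeW => t _; split; first exact: has_deriv_derivable (cd t).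
    by rewrite lc.
  - by rewrite /c scale0r hmulg0.
  - by rewrite /c scale1r.
rewrite /sr_length; under eq_integral do rewrite lc.
rewrite integral_cst//= lebesgue_measure_itv /= lte_fin ltr01 sube0.
by rewrite mule1.
Unshelve. all: by end_near.
Qed.

Lemma horizontal_left_translate M c a : horizontal M c ->
  horizontal M (fun s => hmul a (c s)) /\
  sr_length M (fun s => hmul a (c s)) = sr_length M c.
Proof.
have lv b t : left_velocity (fun s => hmul b (c s)) t = left_velocity c t.
  rewrite /left_velocity; congr (derive1 _ t); apply/funext => s.
  by rewrite hinvM -hmulA hmulKg.
move=> hc; split; last by apply: eq_integral => t _; rewrite lv.
have aut1 : automorphism (1%:M : 'M[R]_(n + n + 1)) 1.
  by split=> [x y|r]; rewrite ?mulmx1 mul1r.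
have := @affine_horizontal R n 1%:M 1 a aut1 M M c.
have -> : (fun x : heis R n => hmul a (x *m 1%:M)) \o c = (fun s => hmul a (c s)).
  by apply/funext => s; rewrite /= mulmx1.
by apply => // w wM; rewrite mulmx1.
Qed.

(** Translate the path to start at 0. Its projection modulo the centre stays within a multiple of d.
    The vertical deviation from the image of [S] has derivative [hsymp] of the position and the
    velocity, halved, which is at most a multiple of d times the speed; so the total deviation is of
    order d^2. *)
Lemma horizontal_small M S Q (e : R) : sr_coord M S Q -> 0 < e ->
  exists2 d : R, 0 < d & forall c, horizontal M c -> (sr_length M c < d%:E)%E ->
    `|hmul (hinv (c 0)) (c 1)| < e.
Proof.
move=> MQ e0.
pose Cq := \sum_i \sum_j `|invmx Q i j|.
have Cq0 : 0 <= Cq by rewrite sumr_ge0// => i _; rewrite sumr_ge0.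
have [Cs Cs0 CsP] : exists2 C, 0 <= C & forall x : 'rV[R]_(n + n), `|x *m S| <= C * `|x|.
  apply: linear_bounded => [x y|a x]; [exact: mulmxDl|by rewrite scalemxAl].
have hlift_le (x : 'rV[R]_(n + n)) : `|hlift x| <= `|x|.
  apply: norm_le_coord => // i; have [j ->|j ->] := split_ordP i.
    by rewrite row_mxEl coord_le_norm.
  by rewrite row_mxEr mxE normr0.
have hw_le (x : 'rV[R]_(n + n)) a : 0 <= a -> (forall i, `|(x *m Q) 0 i| <= a) -> `|x| <= a * Cq.
  move=> a0 xa; rewrite -[x](mulmxK (src_unit MQ)); exact: norm_mulmx_le.
(* Half of the factor 2 n in [hsymp_le], with [Cq] once for the position and once for the velocity;
   the 1 keeps [C1] positive. *)
pose C1 := n%:R * Cq ^+ 2 + 1.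
have C1E : C1 = n%:R * Cq ^+ 2 + 1 by [].
have C10 : 0 < C1 by rewrite ltr_wpDl// mulr_ge0// exprn_ge0.
pose C := Cq * Cs + C1.
have C0 : 0 < C by rewrite ltr_wpDl// mulr_ge0.
have [d [d0 d1 dC]] : exists d : R, [/\ 0 < d, d <= 1 & d * C <= e / 2].
  exists (Num.min 1 (e / (2 * C))); split.
  - by rewrite lt_min ltr01 divr_gt0// mulr_gt0.
  - by rewrite ge_min lexx.
  - by rewrite -ler_pdivlMr// -mulrA -invfM ge_min lexx orbT.
exists d => // c0 hc0 lc0; pose c s := hmul (hinv (c0 0)) (c0 s).
have [hc lcE] := horizontal_left_translate (hinv (c0 0)) hc0.
rewrite -/c in hc lcE; rewrite -lcE in lc0; rewrite -/(c 1).
have c00 : c 0 = 0 by rewrite /c hmulVg.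
clearbody c C1 Cq => {lcE hc0}.
have ct t : 0 <= t <= 1 -> `|hw (c t)| <= d * Cq.
  move=> t01; apply: hw_le => [|i]; first exact: ltW.
  have := horizontal_coord_le i MQ hc t01; rewrite c00 hw0 subr0 => /le_lt_trans/(_ lc0).
  by rewrite lte_fin => /ltW.
pose f (x : heis R n) : R^o := hz (x - hw x *m S).
have fD x y : f (x + y) = f x + f y.
  by rewrite /f -hzD addrACA -opprD -mulmxDl -hwD.
have fZ a x : f (a *: x) = a *: f x.
  by rewrite /f hwZ -scalemxAl -scalerBr; exact: hzZ.
have L0 : 0 < C1 * d by exact: mulr_gt0.
have fc1 : `|f (c 1)| <= C1 * d * d.
  have t01 : 0 <= (1 : R) <= 1 by rewrite ler01 lexx.
  suff fL s : s \in `]0, 1[ -> derivable c s 1 -> left_velocity c s \in sr_space M ->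
      `|f (derive1 c s)| <= C1 * d * sr_norm M (left_velocity c s).
    have := @horizontal_linear_le M c f (C1 * d) 0 1 fD fZ L0 t01 hc fL.
    rewrite c00 (_ : f 0 = 0) ?subr0; last by rewrite /f hw0 mul0mx subr0 hz0.
    move=> H; rewrite -lee_fin; apply: (le_trans H).
    rewrite [leRHS]EFinM; apply: lee_wpmul2l; last exact: ltW.
    by rewrite lee_fin ltW.
  rewrite in_itv /= => /andP[s0 s1] dc lv.
  have lvE := left_velocityE dc.
  have -> : derive1 c s = left_velocity c s + hcenter (hsymp (c s) (left_velocity c s) / 2).
    have -> : hsymp (c s) (left_velocity c s) = hsymp (c s) (derive1 c s).
      by rewrite (hsymp_hw _ (left_velocity c s)) hw_left_velocity// -hsymp_hw.
    by rewrite lvE subrK.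
  rewrite fD {1}/f -(src_eq MQ lv) subrr hz0 add0r /f hw_center mul0mx subr0 hcenterEr.
  rewrite normrM [`|2^-1|]ger0_norm ?invr_ge0// ler_pdivrMr//.
  rewrite hsymp_hw; apply: le_trans (hsymp_le _ _) _.
  have h1 : `|hlift (hw (c s))| <= d * Cq.
    by apply: le_trans (hlift_le _) _; apply: ct; rewrite !ltW.
  have h2 : `|hlift (hw (left_velocity c s))| <= sr_norm M (left_velocity c s) * Cq.
    apply: le_trans (hlift_le _) _; apply: hw_le => [|i]; first exact: sqrtr_ge0.
    exact: src_coord_le MQ lv.
  have := ler_pM (normr_ge0 _) (normr_ge0 _) h1 h2.
  move=> /(ler_wpM2l (ler0n R (2 * n))) /le_trans; apply.
  rewrite natrM C1E; have N0 : 0 <= sr_norm M (left_velocity c s) by exact: sqrtr_ge0.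
  have : 0 <= 2 * d * sr_norm M (left_velocity c s) by rewrite mulr_ge0// mulr_ge0// ltW.
  by rewrite -subr_ge0 => ?; rewrite -subr_ge0; nra.
have -> : c 1 = hw (c 1) *m S + hcenter (f (c 1)).
  apply: heisP; rewrite ?hwD ?(src_hw MQ) ?hw_center ?addr0//.
  by rewrite hzD hcenterEr /f hzD hzN addrC subrK.
apply: le_lt_trans (ler_normD _ _) _.
have n1 : `|hw (c 1) *m S| <= Cs * (d * Cq).
  apply: le_trans (CsP _) _; apply: ler_wpM2l => //; apply: ct.
  by rewrite ler01 lexx.
have n2 : `|hcenter (f (c 1)) : heis R n| <= C1 * d * d.
  exact: le_trans (norm_hcenter _) fc1.
apply: le_lt_trans (lerD n1 n2) _.
have h : Cs * (d * Cq) + C1 * d * d <= d * C.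
  rewrite /C mulrDr mulrCA [Cs * Cq]mulrC lerD2l [C1 * d]mulrC -mulrA ler_pM2l//.
  by rewrite -[leRHS]mulr1 ler_pM2l.
apply: (le_lt_trans h); apply: (le_lt_trans dC); lra.
Qed.
End Coordinates.

(** * Ultralimits and isometries *)

Section Ultrafilters.

Lemma ultra_fmap (T U : Type) (f : T -> U) (F : set_system T) :
  UltraFilter F -> UltraFilter (f @ F).
Proof.
move=> FU; split; first exact: fmap_proper_filter.
move=> G GP FG; apply/seteqP; split => // A GA.
have [//|FnA] := in_ultra_setVsetC (f @^-1` A) FU.
have GnA : G (~` A) by apply: FG.
have G0 : G set0 by rewrite -(setICr A); exact: filterI.
by case: (@filter_not_empty _ G GP G0).
Qed.

Lemma ultra_cvg (T : Type) (X : topologicalType) (K : set X) (f : T -> X) (F : set_system T) :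
  UltraFilter F -> compact K -> F (f @^-1` K) -> exists2 x, K x & f @ F --> x.
Proof.
move=> FU; rewrite compact_ultra => cK FK.
by have [x [Kx fx]] := cK (f @ F) (ultra_fmap f FU) FK; exists x.
Qed.

Lemma ultra_oo : exists U : set_system nat, UltraFilter U /\ \oo `<=` U.
Proof. exact: ultraFilterLemma. Qed.
End Ultrafilters.

Section GromovHausdorffLimit.
Context {R : realType}.

Lemma ultra_squeeze (U : set_system nat) (a b : R) (e : nat -> R) : UltraFilter U ->
  (forall k, 0 < k -> U [set j | e j < k]) -> U [set j | `|a - b| <= e j] -> a = b.
Proof.
move=> UU e0 ab; apply/eqP; rewrite -subr_eq0 -normr_eq0; apply/eqP/le_anti.
rewrite normr_ge0 andbT leNgt; apply/negP => h.
have [j [/= h1 h2]] := filter_ex (filterI (e0 _ h) ab).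
by have := le_lt_trans h2 h1; rewrite ltxx.
Qed.

(** The isometry is the pointwise ultralimit of approximations [F j]. It is onto because approximate
    preimages of y have an ultralimit in the compact X. Since [Y] carries only a function [d], its
    compactness is expressed by limits along ultrafilters. *)
Lemma isometry_of_approx (X : metricType R) (Y : Type) (d : Y -> Y -> R) :
  compact [set: X] ->
  (forall y y', d y y' = d y' y) -> (forall x y z, d x z <= d x y + d y z) ->
  (forall y y', d y y' = 0 -> y = y') ->
  (forall (U : set_system nat) (u : nat -> Y), UltraFilter U ->
     exists y, forall e, 0 < e -> U [set j | d (u j) y < e]) ->
  (forall e, 0 < e -> exists F : X -> Y,
     (forall x x', `|d (F x) (F x') - mdist x x'| <= e) /\
     (forall y, exists x, d (F x) y <= e)) ->
  exists2 f : X -> Y, bijective f & forall x x', d (f x) (f x') = mdist x x'.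
Proof.
move=> cX dC dT d0 cY approx.
have dge0 x y : 0 <= d x y.
  have := dT x y x; have := dT x x x; rewrite (dC y x) => h1 h2.
  by have := dT x x y; lra.
have dB x y x' y' : `|d x y - d x' y'| <= d x x' + d y y'.
  have := dT x x' y; have := dT x' y' y; have := dT x' x y'; have := dT x y y'.
  rewrite (dC x' x) (dC y' y) => h1 h2 h3 h4; rewrite ler_norml; apply/andP; split; lra.
have e0 (j : nat) : 0 < j.+1%:R^-1 :> R by rewrite invr_gt0.
have /choice[F FP] := fun j : nat => approx j.+1%:R^-1 (e0 j).
have [U [UU ooU]] := ultra_oo.
have Ue (e : R) : 0 < e -> U [set j : nat | j.+1%:R^-1 < e].
  by move=> e1; apply: ooU; exact: near_infty_natSinv_lt (PosNum e1).
have /choice[f fP] : forall x, exists y, forall e, 0 < e -> U [set j | d (F j x) y < e].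
  by move=> x; exact: cY.
have fiso x x' : d (f x) (f x') = mdist x x'.
  apply: (@ultra_squeeze U _ _ (fun j => d (F j x) (f x) + d (F j x') (f x') + j.+1%:R^-1)) => //.
    move=> e e1; have e3 : 0 < e / 3 by lra.
    apply: filterS3 (fP x _ e3) (fP x' _ e3) (Ue _ e3) => j /= h1 h2.
    by move: (j.+1%:R^-1) => w h3; lra.
  apply: filterS filterT => j _ /=.
  have := (FP j).1 x x'; have := dB (F j x) (F j x') (f x) (f x').
  move: (j.+1%:R^-1) => w.
  rewrite !ler_norml => /andP[h1 h2] /andP[h3 h4]; apply/andP; split; lra.
have fsurj y : exists x, f x = y.
  have /choice[x xP] := fun j => (FP j).2 y.
  have [a _ xa] := ultra_cvg UU cX (filterT : U (x @^-1` setT)).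
  exists a; apply: d0; apply: (@ultra_squeeze U _ _
    (fun j => d (F j a) (f a) + 2 * j.+1%:R^-1 + mdist (x j) a)) => //.
    move=> e e1; have e4 : 0 < e / 4 by lra.
    have Ux : U [set j | mdist (x j) a < e / 4].
      have := xa [set z | mdist z a < e / 4]; apply.
      rewrite (_ : [set z | _] = ball a (e / 4)); first exact: nbhsx_ballx.
      by apply/seteqP; rewrite ballEmdist; split => z /=; rewrite metric_sym.
    apply: filterS3 (fP a _ e4) Ux (Ue _ e4) => j /= h1 h2; move: (j.+1%:R^-1) => w h3; lra.
  apply: filterS filterT => j _ /=; rewrite subr0 ger0_norm//.
  have := xP j; have := (FP j).1 (x j) a; move: (j.+1%:R^-1) => w.
  rewrite ler_norml => /andP[h1 h2] h3.
  have := dT (f a) (F j a) y; have := dT (F j a) (F j (x j)) y.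
  rewrite (dC (f a) (F j a)) (dC (F j a) (F j (x j))); lra.
have finj : injective f.
  move=> x x' fxx; apply: mdist_positivity; rewrite -fiso fxx.
  by have := fiso x' x'; rewrite mdistxx.
exists f => //; have /choice[g gP] := fsurj.
by exists g => // x; apply: finj; rewrite gP.
Qed.
End GromovHausdorffLimit.

(** * Bounds from the diameter and the Popp measure *)

Section Frames.
Context {R : realType} {n : nat}.
Implicit Types (M : sr_metric R n) (U : 'M[R]_(n + n + 1)).

(** A nonzero central vector in the horizontal space puts the whole centre there; all brackets are
    central, so the space would be closed under brackets and equal to the Lie algebra, against
    corank 1. *)
Lemma center_not_horizontal M : bracket_generating M -> corank M = 1%N ->
  {in sr_space M, forall w, hw w = 0 -> w = 0}.
Proof.
move=> [us usM us_full] cM w wM w0; apply: contrapT => /eqP wn0.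
have cenM r : hcenter r \in sr_space M.
  have z0 : hz w != 0.
    by apply: contra_neq wn0 => z0; rewrite (hw0_center w0) z0 hcenter0.
  have -> : hcenter r = (r / hz w) *: w.
    by rewrite -{1}[r](divfK z0) hcenterZ -(hw0_center w0).
  exact: memvZ.
have brM u : iterated_bracket (sr_space M) u -> u \in sr_space M.
  by elim=> // ? ? _ _ _ _; exact: cenM.
have : (fullv <= sr_space M)%VS.
  by rewrite -us_full; apply/span_subvP => u /usM; exact: brM.
by move=> /dimvS; rewrite -subn_eq0 -/(corank M) cM.
Qed.

Lemma sr_prod_suml M (I : Type) (s : seq I) (a : I -> R) (u : I -> heis R n) w :
  (forall i, u i \in sr_space M) -> w \in sr_space M ->
  sr_prod M (\sum_(i <- s) a i *: u i) w = \sum_(i <- s) a i * sr_prod M (u i) w.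
Proof.
move=> uM wM; have p0 : sr_prod M 0 w = 0.
  have := sr_prod_linear 1 (mem0v (sr_space M)) (mem0v (sr_space M)) wM.
  rewrite scaler0 addr0 mul1r => /eqP.
  by rewrite -subr_eq0 opprD addrA subrr sub0r oppr_eq0 => /eqP.
elim: s => [|i s IH]; first by rewrite !big_nil.
rewrite !big_cons sr_prod_linear ?IH//.
by apply: memv_suml => j _; exact: memvZ.
Qed.

Definition frame_hw U : 'M[R]_(n + n) := \matrix_i hw (row (lshift 1 i) U).

Definition frame_symp U : 'M[R]_(n + n) :=
  \matrix_(i, j) hsymp (row (lshift 1 i) U) (row (lshift 1 j) U).

Lemma frame_mulE U (y : 'rV[R]_(n + n)) :
  y *m usubmx U = \sum_i y 0 i *: row (lshift 1 i) U.
Proof.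
rewrite mulmx_sum_row; apply: eq_bigr => i _; congr (_ *: _).
by apply/rowP => j; rewrite !mxE.
Qed.

Lemma frame_mul_hw U (y : 'rV[R]_(n + n)) : hw (y *m usubmx U) = y *m frame_hw U.
Proof.
rewrite frame_mulE hw_sum mulmx_sum_row; apply: eq_bigr => i _.
by rewrite hwZ rowK.
Qed.

Section Adapted.
Variables (M : sr_metric R n) (U : 'M[R]_(n + n + 1)).
Hypothesis aU : adapted_frame M U.
Hypothesis cM : {in sr_space M, forall w, hw w = 0 -> w = 0}.

Lemma frame_mem (y : 'rV[R]_(n + n)) : y *m usubmx U \in sr_space M.
Proof.
rewrite frame_mulE; apply: memv_suml => i _; apply: memvZ.
by case: aU => _ + _; exact.
Qed.

Lemma frame_hw_unit : frame_hw U \in unitmx.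
Proof.
have [uU _ _] := aU; apply: unitmx_inj => y y0.
have U0 : y *m usubmx U = 0 by apply: cM (frame_mem _) _; rewrite frame_mul_hw.
have : row_mx y 0 *m U = 0 by rewrite -[U]vsubmxK mul_row_col mul0mx addr0 U0.
move=> /(congr1 (mulmx^~ (invmx U))); rewrite mulmxK// mul0mx => /(congr1 lsubmx).
by rewrite row_mxKl => ->; rewrite linear0.
Qed.

Lemma frame_sr_coord : sr_coord M (invmx (frame_hw U) *m usubmx U) (invmx (frame_hw U)).
Proof.
have uH := frame_hw_unit; have [uU uM uo] := aU; split.
- by rewrite unitmx_inv.
- by move=> x; rewrite mulmxA; exact: frame_mem.
- by move=> x; rewrite mulmxA frame_mul_hw mulmxKV.
- move=> w wM; apply/eqP; rewrite -subr_eq0; apply/eqP/cM.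
    by apply: memvB => //; rewrite mulmxA; exact: frame_mem.
  by rewrite hwB mulmxA frame_mul_hw mulmxKV// subrr.
- move=> w wM; have wE : w = (hw w *m invmx (frame_hw U)) *m usubmx U.
    apply/eqP; rewrite -subr_eq0; apply/eqP/cM; first by rewrite memvB// frame_mem.
    by rewrite hwB frame_mul_hw mulmxKV// subrr.
  move: (hw w *m invmx (frame_hw U)) wE => y wE; rewrite frame_mulE in wE.
  have pw u : u \in sr_space M ->
      sr_prod M w u = \sum_i y 0 i * sr_prod M (row (lshift 1 i) U) u.
    by move=> uM'; rewrite {1}wE sr_prod_suml.
  rewrite pw//; apply: eq_bigr => i _; rewrite expr2; congr (_ * _).
  rewrite sr_prodC// pw// (bigD1 i)//= uo eqxx mulr1 big1 ?addr0// => j ji.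
  by rewrite uo (negbTE ji) mulr0.
Qed.

Lemma frame_symp_bilinear (x y : 'rV[R]_(n + n)) :
  hsymp (hlift (x *m frame_hw U)) (hlift (y *m frame_hw U)) =
  (x *m frame_symp U *m y^T) 0 0.
Proof.
rewrite -!frame_mul_hw -hsymp_hw !frame_mulE hsymp_suml.
rewrite -mulmxA mxE; apply: eq_bigr => i _.
rewrite hsympZl hsymp_sumr mxE; congr (_ * _); apply: eq_bigr => j _.
by rewrite hsympZr !mxE mulrC.
Qed.

Lemma frame_symp_unit : frame_symp U \in unitmx.
Proof.
have uH := frame_hw_unit; apply: unitmx_inj => y y0.
suff : y *m frame_hw U = 0.
  by move=> /(congr1 (mulmx^~ (invmx (frame_hw U)))); rewrite mulmxK// mul0mx.
rewrite -[LHS]hw_hlift; apply: hsymp_nondegenerate => h; rewrite hsymp_hw hw_hlift.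
by rewrite -[hw h](mulmxKV uH) frame_symp_bilinear y0 mul0mx mxE.
Qed.

(** [kap] is the last component of the central vector in the frame. The structure constants are
    [kap] times [frame_symp], and [kap * \det U] is [\det (frame_hw U)], so [kap] cancels and the
    vector completing the frame disappears from the formula. *)
Lemma popp_density_inE : popp_density_in U =
  (Num.sqrt (\sum_i \sum_j frame_symp U i j ^+ 2) * `|\det (frame_hw U)|)^-1.
Proof.
have [uU _ _] := aU.
pose e : heis R n := hcenter 1.
pose kap := (e *m invmx U) 0 (rshift (n + n) 0).
have scE i j : structure_const U i j = frame_symp U i j * kap.
  rewrite /structure_const /hbracket -[hsymp _ _]mulr1 hcenterZ -scalemxAl.
  by rewrite [LHS]mxE [frame_symp U i j]mxE.
have detE : kap * \det U = \det (frame_hw U).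
  pose U' : 'M[R]_(n + n + 1) := col_mx (usubmx U) e.
  have -> : \det (frame_hw U) = \det U'.
    rewrite /U' -[usubmx U]hsubmxK /e /hcenter -[col_mx _ _]/(block_mx _ _ _ _).
    rewrite det_ublock det_scalar1 mulr1; congr (\det _).
    by apply/matrixP => i j; rewrite !mxE.
  have -> : U' = col_mx (row_mx 1%:M 0) (e *m invmx U) *m U.
    rewrite mul_col_mx mulmxKV//; congr col_mx.
    by rewrite -{2}[U]vsubmxK mul_row_col mul1mx mul0mx addr0.
  rewrite det_mulmx; congr (_ * _).
  rewrite -[e *m invmx U]hsubmxK -[col_mx _ _]/(block_mx _ _ _ _) det_lblock det1 mul1r.
  by rewrite [rsubmx _]mx11_scalar det_scalar1 mxE.
rewrite /popp_density_in -detE normrM mulrA invfM; congr (_ * _); congr (_^-1).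
under eq_bigr do under eq_bigr do rewrite scE exprMn.
under eq_bigr do rewrite -mulr_suml.
rewrite -mulr_suml sqrtrM ?sqrtr_sqr// sumr_ge0// => i _.
by rewrite sumr_ge0// => j _; exact: sqr_ge0.
Qed.
End Adapted.
End Frames.

(** * Uniform bounds for generators and symplectic forms *)

Section LatticeData.
Context {R : realType} {n : nat}.
Implicit Types (M : sr_metric R n) (G : set (heis R n)).

Definition orbit G (x : heis R n) : heis_quot G :=
  exist _ [set hmul g x | g in G] (ex_intro _ x erefl).

Lemma det_le m (A : 'M[R]_m) C : (forall i j, `|A i j| <= C) ->
  `|\det A| <= (m`!)%:R * C ^+ m.
Proof.
move=> AC; apply: le_trans (ler_norm_sum _ _ _) _.
rewrite mulr_natl -card_Sn -sumr_const; apply: ler_sum => s _.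
rewrite normrM normrX normrN1 expr1n mul1r normr_prod -[X in C ^+ X]card_ord -prodr_const.
by apply: ler_prod => i _; rewrite normr_ge0 AC.
Qed.

(** A path of length less than D + 1, the infimum being possibly not attained, joins the orbit of 0
    to that of x; it moves each orthonormal coordinate by at most its length. *)
Lemma diam_cover M G S Q (D : R) x : hsubgroup G -> sr_coord M S Q ->
  (sr_diam M G <= D%:E)%E ->
  exists2 g, G g & forall i, `|((hw x - hw g) *m Q) 0 i| <= D + 1.
Proof.
move=> [G0 GM GV] MQ dD.
have : (sr_dist M (orbit G 0) (orbit G x) < (D + 1)%:E)%E.
  apply: (@le_lt_trans _ _ D%:E); last by rewrite lte_fin ltrDl.
  by apply: le_trans dD; apply: ereal_sup_ubound; exists (orbit G 0), (orbit G x).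
move=> /ereal_inf_lt [_ [c [hc [g0 Gg0 c0] [g1 Gg1 c1]] <-] lc].
exists (hmul (hinv g1) g0) => [|i]; first by apply: GM => //; exact: GV.
have t01 : 0 <= (1 : R) <= 1 by rewrite ler01 lexx.
have := horizontal_coord_le i MQ hc t01.
rewrite -c0 -c1 !hw_mul hw_inv hw0 addr0 => /le_lt_trans/(_ lc); rewrite lte_fin => /ltW.
by congr (`|(_ *m _) 0 i| <= _); rewrite opprD opprK addrCA addrA.
Qed.

(* The points T times an orthonormal frame are at distance at most D from the
   orbit of 0; once T is large, T%:M + E is diagonally dominant. *)
Lemma short_lattice_vectors M G S Q (D T : R) : hsubgroup G -> sr_coord M S Q ->
  (sr_diam M G <= D%:E)%E ->
  exists2 l : 'I_(n + n) -> heis R n, forall i, G (l i) &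
    exists2 E : 'M[R]_(n + n), forall i j, `|E i j| <= D + 1 &
      (\matrix_i hw (l i)) *m Q = T%:M + E.
Proof.
move=> sG MQ dD; pose x i : heis R n := hlift (row i (T *: invmx Q)).
have /choice[l lP] : forall i, exists g, G g /\ forall j, `|((hw (x i) - hw g) *m Q) 0 j| <= D + 1.
  by move=> i; have [g Gg gD] := diam_cover (x i) sG MQ dD; exists g.
exists l => [i|]; first by case: (lP i).
exists ((\matrix_i hw (l i)) *m Q - T%:M); last by rewrite addrC subrK.
move=> i j; have [_ /(_ j)] := lP i; rewrite -normrN; congr (`|_| <= _).
have xQ : hw (x i) *m Q = row i T%:M.
  by rewrite hw_hlift -row_mul -scalemxAl mulVmx ?(src_unit MQ)// scalemx1.
have lQ : hw (l i) *m Q = row i (\matrix_i hw (l i) *m Q) by rewrite row_mul rowK.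
rewrite mulmxBl xQ lQ; move: (_ *m Q) => Z.
by rewrite !mxE opprB.
Qed.

(* Without a frame or a fundamental domain, get returns 0 or the empty set, and
   popp_measure M G would be 0. *)
Lemma popp_measure_get M G (V : R) : 0 < V -> (V%:E <= popp_measure M G)%E ->
  exists U F, [/\ adapted_frame M U, fundamental_domain G F &
    popp_measure M G = ((popp_density_in U)%:E * leb_volume F)%E].
Proof.
move=> V0 Vp; exists (get [set U | adapted_frame M U]), (get [set F | fundamental_domain G F]).
split => //.
  have [[U aU]|noU] := pselect (exists U, adapted_frame M U).
    exact: (@getPex _ [set U | adapted_frame M U] (ex_intro _ U aU)).
  exfalso; move: Vp; rewrite /popp_measure /popp_density getPN; last first.
    by move=> U aU; apply: noU; exists U.
  have det00 k : (0 < k)%N -> \det (0 : 'M[R]_k) = 0 by case: k => // k _; rewrite det0.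
  have -> : popp_density_in (point : 'M[R]_(n + n + 1)) = 0.
    rewrite /popp_density_in (_ : \det _ = 0) ?normr0 ?invr0 ?mulr0//.
    have -> : (point : 'M[R]_(n + n + 1)) = 0.
      by apply/matrixP => i j; rewrite !mxE.
    by rewrite det00// addn1.
  by rewrite mul0e lee_fin leNgt V0.
have [[F fF]|noF] := pselect (exists F, fundamental_domain G F).
  exact: (@getPex _ [set F | fundamental_domain G F] (ex_intro _ F fF)).
exfalso; move: Vp; rewrite /popp_measure (@getPN _ [set F | _]); last first.
  by move=> F fF; apply: noF; exists F.
rewrite /leb_volume (@eq_leb_integral _ _ _ (fun=> 0%E)) ?leb_integral0.
  by rewrite mule0 lee_fin leNgt V0.
by move=> x; rewrite indicE memNset.
Qed.

(* A = ld_B *m ld_Q lists the generators in an orthonormal frame and ld_W is the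
   symplectic form in that frame, divided by ld_z.  A lower bound for the Popp
   measure bounds ld_W, and A W A^T is an integer matrix. *)
Record lattice_data M G (C : R) : Type := LatticeData {
  ld_S : 'M[R]_(n + n, n + n + 1);
  ld_Q : 'M[R]_(n + n);
  ld_coord : sr_coord M ld_S ld_Q;
  ld_z : R;
  ld_z_gt0 : 0 < ld_z;
  ld_zG : G (hcenter ld_z);
  ld_gam : 'I_(n + n) -> heis R n;
  ld_gamG : forall i, G (ld_gam i);
  ld_gen : forall P : heis R n -> Prop, hsubgroup P -> P (hcenter ld_z) ->
        (forall i, P (ld_gam i)) -> forall g, G g -> P g;
  ld_B := \matrix_i hw (ld_gam i);
  ld_B_unit : ld_B \in unitmx;
  ld_N : 'M[int]_(n + n);
  ld_NE : forall i j, hsymp (ld_gam i) (ld_gam j) = (ld_N i j)%:~R * ld_z;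
  ld_A_le : forall i j, `|(ld_B *m ld_Q) i j| <= C;
  ld_W : 'M[R]_(n + n);
  ld_W_le : forall i j, `|ld_W i j| <= C;
  ld_AWA : (ld_B *m ld_Q) *m ld_W *m (ld_B *m ld_Q)^T = map_mx intr ld_N;
  ld_N_unit : (map_mx intr ld_N : 'M[R]_(n + n)) \in unitmx }.

Lemma lattice_data_exists (D V : R) : (1 <= n)%N -> 0 < D -> 0 < V ->
  exists C : R, forall M G, lattice G -> bracket_generating M -> corank M = 1%N ->
    (sr_diam M G <= D%:E)%E -> (V%:E <= popp_measure M G)%E ->
    $| lattice_data M G C |.
Proof.
(* [T] is twice the threshold m (D + 1) of diagonal dominance. [CA] bounds the entries of the
   generators A' (T + E), where A' has entries of absolute value at most 1. The second term of [C]
   comes from |W| <= |det A| / V and the Leibniz bound for det A. None of them depends on the metric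
   or the lattice. *)
move=> n1 D0 V0; pose m := (n + n)%N; pose T := 2 * m%:R * (D + 1).
pose CA := m%:R * (T + (D + 1)).
pose C := Num.max CA ((m`!)%:R * CA ^+ m / V).
exists C => M G lG bM cM dM pM.
have cenM := center_not_horizontal bM cM; have sG := lattice_hsubgroup lG.
have [U [F [aU fF pE]]] := popp_measure_get V0 pM.
set H := frame_hw U; have uH : H \in unitmx := frame_hw_unit aU cenM.
have MQ := frame_sr_coord aU cenM; rewrite -/H in MQ.
have [l Gl [E ED lQ]] := short_lattice_vectors T sG MQ dM.
have m0 : 0 < m%:R :> R by rewrite ltr0n addn_gt0 n1.
have D10 : 0 < D + 1 by lra.
have uTE : T%:M + E \in unitmx.
  apply: (unitmx_scalar_perturbation ED); rewrite -/m /T.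
  by have := mulr_gt0 m0 D10; rewrite -mulrA; lra.
have lE : \matrix_i hw (l i) = (T%:M + E) *m H by rewrite -lQ mulmxKV.
have ul : \matrix_i hw (l i) \in unitmx by rewrite lE unitmx_mul uTE.
have [z [gam [A' [[z0 Gz zP] [Ggam A1 uA' gamE] gen]]]] := lattice_generators n1 lG Gl ul.
set B := \matrix_i hw (gam i) in gamE.
have uB : B \in unitmx by rewrite gamE unitmx_mul uA'.
pose A := B *m invmx H.
have AE : A = A' *m (T%:M + E) by rewrite /A gamE lE -mulmxA mulmxK.
have T0 : 0 <= T by rewrite !mulr_ge0// ltW.
have CA0 : 0 <= CA by rewrite mulr_ge0// addr_ge0// ltW.
have A_le i j : `|A i j| <= CA.
  rewrite AE mxE; apply: le_trans (ler_norm_sum _ _ _) _.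
  rewrite /CA mulr_natl -[X in _ *+ X]card_ord -sumr_const; apply: ler_sum => k _.
  rewrite normrM -[leRHS]mul1r; apply: ler_pM => //.
  rewrite !mxE; apply: le_trans (ler_normD _ _) _; apply: lerD => //.
  by case: eqP => _; rewrite ?mulr1n ?mulr0n ?normr0// ger0_norm.
pose W := z^-1 *: frame_symp U.
have /choice[N0 N0E] : forall p : 'I_(n + n) * 'I_(n + n), exists k : int,
    hsymp (gam p.1) (gam p.2) = k%:~R * z.
  by move=> p; apply: zP; exact: hsubgroup_commutator.
pose N : 'M[int]_(n + n) := \matrix_(i, j) N0 (i, j).
have NE i j : hsymp (gam i) (gam j) = (N i j)%:~R * z by rewrite mxE (N0E (i, j)).
have BE i : hw (gam i) = row i A *m H by rewrite -row_mul mulmxKV// rowK.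
have AWA : A *m W *m A^T = map_mx intr N.
  have zn0 : z != 0 by rewrite gt_eqF.
  apply/matrixP => i j; rewrite [RHS]mxE -[RHS](mulfK zn0) -NE.
  rewrite hsymp_hw !BE frame_symp_bilinear// /W -scalemxAr -scalemxAl [LHS]mxE mulrC.
  congr (_ / _); rewrite !mxE; apply: eq_bigr => k _; rewrite !mxE; congr (_ * _).
  by apply: eq_bigr => k' _; rewrite !mxE.
have uN : (map_mx intr N : 'M[R]_(n + n)) \in unitmx.
  have uA : A \in unitmx by rewrite unitmx_mul uB unitmx_inv.
  rewrite -AWA unitmx_mul unitmx_tr uA andbT unitmx_mul uA /=.
  rewrite /W unitmxZ; first exact: frame_symp_unit aU cenM.
  by rewrite unitfE invr_eq0 gt_eqF.
pose s2 := \sum_i \sum_j frame_symp U i j ^+ 2.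
have s20 i : 0 <= \sum_j frame_symp U i j ^+ 2 by rewrite sumr_ge0// => j _; exact: sqr_ge0.
have detA : `|\det A| <= (m`!)%:R * CA ^+ m by exact: det_le.
(* The volume is at most |det B| z with B = A H, and |det H| cancels against the Popp density. *)
have VW : V <= `|\det A| * z / Num.sqrt s2.
  rewrite -lee_fin; apply: (le_trans pM); rewrite pE.
  apply: (@le_trans _ _ ((popp_density_in U)%:E * (`|\det B| * z)%:E)%E).
    apply: lee_wpmul2l; last exact: lattice_volume_le lG fF z0 Gz Ggam uB.
    by rewrite lee_fin (popp_density_inE aU) invr_ge0 mulr_ge0// sqrtr_ge0.
  rewrite -EFinM lee_fin (popp_density_inE aU) -/H -/s2.
  have -> : B = A *m H by rewrite /A mulmxKV.
  have H0 : `|\det H| != 0 by rewrite normr_eq0 -unitfE -unitmxE.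
  rewrite det_mulmx normrM invfM.
  move: (Num.sqrt s2)^-1 (`|\det A|) (`|\det H|) H0 => q a h h0.
  suff -> : q * h^-1 * (a * h * z) = a * z * q by [].
  by field.
have sq0 : 0 < Num.sqrt s2.
  rewrite lt_def sqrtr_ge0 andbT; apply/eqP => q0; move: VW.
  by rewrite q0 invr0 mulr0 leNgt V0.
have W_le i j : `|W i j| <= (m`!)%:R * CA ^+ m / V.
  rewrite /W mxE normrM [`|z^-1|]gtr0_norm ?invr_gt0// mulrC ler_pdivrMr//.
  apply: (@le_trans _ _ (Num.sqrt s2)).
    rewrite -sqrtr_sqr ler_wsqrtr// /s2 (bigD1 i)//=.
    apply: (@le_trans _ _ (\sum_j frame_symp U i j ^+ 2)).
      by rewrite (bigD1 j)//= lerDl sumr_ge0// => k _; exact: sqr_ge0.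
    by rewrite lerDl sumr_ge0.
  rewrite mulrAC ler_pdivlMr// mulrC.
  by move: VW; rewrite ler_pdivlMr// => /le_trans; apply; apply: ler_wpM2r => //; exact: ltW.
apply: squash; apply: (@LatticeData M G C _ (invmx H) MQ z z0 Gz gam Ggam gen uB N NE _ W _ AWA uN).
- by move=> i j; apply: le_trans (A_le i j) _; rewrite le_max lexx.
- by move=> i j; apply: le_trans (W_le i j) _; rewrite le_max lexx orbT.
Qed.
End LatticeData.

(** * Comparison of quotients *)

Section AffineComparison.
Context {R : realType} {n : nat}.
Implicit Types (M : sr_metric R n) (G : set (heis R n)).

(* The linear map acting as T on the quotient by the centre, sending the image of
   S to that of S', and multiplying the centre by rho. *)
Definition hauto (S : 'M[R]_(n + n, n + n + 1)) (T : 'M[R]_(n + n))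
    (S' : 'M[R]_(n + n, n + n + 1)) (rho : R) : 'M[R]_(n + n + 1) :=
  col_mx (T *m S' - rho *: (rsubmx S *m (hcenter 1 : heis R n))) (hcenter rho).

Lemma hautoE S T S' rho (x : heis R n) :
  x *m hauto S T S' rho = hw x *m T *m S' + hcenter (rho * (hz x - hz (hw x *m S))).
Proof.
have scal (v : 'rV[R]_1) : v = (v 0 0)%:M by exact: mx11_scalar.
rewrite /hauto -{1}[x]hsubmxK mul_row_col -/(hw x) mulmxBr mulmxA.
rewrite -scalemxAr mulmxA (scal (hw x *m _)) (scal (rsubmx x)) !mul_scalar_mx.
have -> : rsubmx x 0 0 = hz x by rewrite mxE.
have -> : (hw x *m rsubmx S) 0 0 = hz (hw x *m S).
  by rewrite /hz [LHS]mxE [RHS]mxE; apply: eq_bigr => i _; congr (_ * _); rewrite mxE.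
rewrite -!hcenterZ mulr1 -hcenterN -addrA -hcenterD; congr (_ + hcenter _).
by ring.
Qed.

Lemma hconj (a g : heis R n) : hmul (hmul a g) (hinv a) = g + hcenter (hsymp a g).
Proof.
apply: heisP; rewrite ?hwD ?hw_center ?addr0 ?hw_mul ?hw_inv; first by rewrite addrC addKr.
rewrite hzD hcenterEr !hz_mul /hinv hzN hsympNr hsymp_mull hsymp_diag (hsympC g a); lra.
Qed.

Section TwoData.
Variables (M M0 : sr_metric R n) (G G0 : set (heis R n)) (C C0 : R).
Variables (L : lattice_data M G C) (L0 : lattice_data M0 G0 C0).

(** [ld_T] matches the projected generators of the two lattices and [ld_rho] the generators of their
    centres. When the integer matrices of commutators agree, the two are compatible, and [ld_P] is
    an automorphism preserving horizontality. *)
Definition ld_T := invmx (ld_B L) *m ld_B L0.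
Definition ld_rho := ld_z L0 / ld_z L.
Definition ld_P := hauto (ld_S L) ld_T (ld_S L0) ld_rho.

Lemma ld_BT : ld_B L *m ld_T = ld_B L0.
Proof. by rewrite /ld_T mulmxA mulmxV ?mul1mx// ld_B_unit. Qed.

Lemma ld_hwP (x : heis R n) : hw (x *m ld_P) = hw x *m ld_T.
Proof. by rewrite hautoE hwD hw_center addr0 (src_hw (ld_coord L0)). Qed.

Lemma ld_P_mem : {in sr_space M, forall w, w *m ld_P \in sr_space M0}.
Proof.
move=> w wM; rewrite hautoE -(src_eq (ld_coord L) wM) subrr mulr0 hcenter0 addr0.
exact: src_mem (ld_coord L0) _.
Qed.

Hypothesis NN : ld_N L = ld_N L0.

(** On combinations of generators both forms are given by the same integer matrix, scaled by the
    respective central generators. *)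
Lemma ld_hsymp (x y : 'rV[R]_(n + n)) :
  hsymp (hlift (x *m ld_B L0)) (hlift (y *m ld_B L0)) =
  ld_rho * hsymp (hlift (x *m ld_B L)) (hlift (y *m ld_B L)).
Proof.
have key M' G' C' (L' : lattice_data M' G' C') :
    hsymp (hlift (x *m ld_B L')) (hlift (y *m ld_B L')) =
    (\sum_i \sum_j x 0 i * (y 0 j * (ld_N L' i j)%:~R)) * ld_z L'.
  have hl u : hlift (u *m ld_B L') = hlift (hw (\sum_i u 0 i *: ld_gam L' i)).
    congr hlift; rewrite hw_sum mulmx_sum_row; apply: eq_bigr => i _.
    by rewrite hwZ rowK.
  rewrite !hl -hsymp_hw hsymp_suml mulr_suml; apply: eq_bigr => i _.
  rewrite hsympZl hsymp_sumr mulr_sumr mulr_suml; apply: eq_bigr => j _.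
  by rewrite hsympZr ld_NE; ring.
rewrite !key NN /ld_rho; have z0 := ld_z_gt0 L; field.
by rewrite gt_eqF.
Qed.

Lemma ld_automorphism : automorphism ld_P ld_rho.
Proof.
split=> [x y|r]; last first.
  by rewrite hautoE hw_center !mul0mx hz0 subr0 hcenterEr add0r.
have e (u : 'rV[R]_(n + n)) : u *m ld_T = u *m invmx (ld_B L) *m ld_B L0.
  by rewrite mulmxA.
by rewrite hsymp_hw !ld_hwP !e ld_hsymp !mulmxKV ?ld_B_unit// -hsymp_hw.
Qed.

Definition ld_conj (a g : heis R n) := hmul (hmul a (g *m ld_P)) (hinv a).

(* ld_P matches the generators modulo the centre; the remaining central
   discrepancies are removed by an inner automorphism, because the symplectic
   form is nondegenerate. *)
Lemma ld_translation : exists a, forall i, ld_conj a (ld_gam L i) = ld_gam L0 i.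
Proof.
pose sig : 'rV[R]_(n + n) := \row_i (hz (ld_gam L i *m ld_P) - hz (ld_gam L0 i)).
pose Nr : 'M[R]_(n + n) := map_mx intr (ld_N L0).
have uN : Nr \in unitmx := ld_N_unit L0.
(* Conjugation by [a] adds [hsymp a] of an element to its central coordinate; [al] solves the linear
   system asking that this be [- sig] on the generators. *)
pose al := - (ld_z L0)^-1 *: (sig *m invmx Nr).
pose a := \sum_j al 0 j *: ld_gam L0 j.
have hwg i : hw (ld_gam L i *m ld_P) = hw (ld_gam L0 i).
  rewrite ld_hwP -[hw (ld_gam L i)](rowK (fun i => hw (ld_gam L i))).
  by rewrite -row_mul ld_BT rowK.
have z0 : ld_z L0 != 0 by rewrite gt_eqF ?ld_z_gt0.
have ag i : hsymp a (ld_gam L0 i) = - sig 0 i.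
  have -> : sig 0 i = (sig *m invmx Nr *m Nr) 0 i by rewrite mulmxKV.
  rewrite mxE -sumrN hsymp_suml; apply: eq_bigr => j _.
  rewrite hsympZl ld_NE /al mxE [Nr j i]mxE; by field.
exists a => i; rewrite /ld_conj hconj hsymp_hw hwg -hsymp_hw ag.
apply: heisP; first by rewrite hwD hw_center addr0.
by rewrite hzD hcenterEr mxE opprB addrC subrK.
Qed.

Lemma ld_conjM a g h : ld_conj a (hmul g h) = hmul (ld_conj a g) (ld_conj a h).
Proof.
by rewrite /ld_conj -(automorphismM _ _ ld_automorphism) !hmulA hmulgKV.
Qed.

Lemma ld_conj0 a : ld_conj a 0 = 0.
Proof. by rewrite /ld_conj mul0mx hmulg0 hmulgV. Qed.

Lemma ld_conjV a g : ld_conj a (hinv g) = hinv (ld_conj a g).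
Proof. by rewrite /ld_conj !hinvM hinvK hinv_mulmx hmulA. Qed.

Lemma ld_conj_center a : ld_conj a (hcenter (ld_z L)) = hcenter (ld_z L0).
Proof.
have [_ Pc] := ld_automorphism.
rewrite /ld_conj Pc hconj hsymp_centerr hcenter0 addr0 /ld_rho divfK//.
by rewrite gt_eqF ?ld_z_gt0.
Qed.

Lemma ld_conj_mul a g x : hmul a (hmul g x *m ld_P) = hmul (ld_conj a g) (hmul a (x *m ld_P)).
Proof.
by rewrite /ld_conj -(automorphismM _ _ ld_automorphism) !hmulA hmulgKV.
Qed.

(** The elements sent into [G0], and the images of elements of [G], form subgroups; they contain the
    generators of [G] and of [G0] respectively. *)
Lemma ld_conj_image a : hsubgroup G -> hsubgroup G0 ->
  (forall i, ld_conj a (ld_gam L i) = ld_gam L0 i) ->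
  (forall g, G g -> G0 (ld_conj a g)) /\ (forall g0, G0 g0 -> exists2 g, G g & ld_conj a g = g0).
Proof.
move=> [G1 GM GV] [G01 G0M G0V] ag; split.
  apply: (ld_gen (l := L) (P := fun g => G0 (ld_conj a g))) => [||i].
  - split; first by rewrite ld_conj0.
      by move=> g h Gg Gh; rewrite ld_conjM; exact: G0M.
    by move=> g Gg; rewrite ld_conjV; exact: G0V.
  - by rewrite ld_conj_center; exact: ld_zG.
  - by rewrite ag; exact: ld_gamG.
apply: (ld_gen (l := L0) (P := fun g0 => exists2 g, G g & ld_conj a g = g0)) => [||i].
- split; first by exists 0 => //; rewrite ld_conj0.
    move=> _ _ [g Gg <-] [h Gh <-]; exists (hmul g h); first exact: GM.
    by rewrite ld_conjM.
  by move=> _ [g Gg <-]; exists (hinv g); [exact: GV|rewrite ld_conjV].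
- by exists (hcenter (ld_z L)); [exact: ld_zG|exact: ld_conj_center].
- by exists (ld_gam L i); [exact: ld_gamG|exact: ag].
Qed.
End TwoData.

Lemma ld_PK M M0 G G0 C C0 (L : lattice_data M G C) (L0 : lattice_data M0 G0 C0) (x : heis R n) :
  x *m ld_P L L0 *m ld_P L0 L = x.
Proof.
have z0 := ld_z_gt0 L0; have z := ld_z_gt0 L.
have TT : ld_T L L0 *m ld_T L0 L = 1%:M.
  rewrite /ld_T mulmxA -[_ *m invmx (ld_B L0)]mulmxA mulmxV ?ld_B_unit// mulmx1.
  by rewrite mulVmx// ld_B_unit.
rewrite [_ *m ld_P L0 L]hautoE ld_hwP -!(mulmxA (hw x) (ld_T L L0) (ld_T L0 L)) TT mulmx1.
have -> : ld_rho L0 L * (hz (x *m ld_P L L0) - hz (hw x *m ld_T L L0 *m ld_S L0)) =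
    hz x - hz (hw x *m ld_S L).
  rewrite hautoE hzD hcenterEr addrAC subrr add0r /ld_rho; field.
  by rewrite !gt_eqF.
apply: heisP; first by rewrite hwD hw_center addr0 (src_hw (ld_coord L)).
by rewrite hzD hcenterEr addrC subrK.
Qed.
End AffineComparison.

(** * Scalar products on a fixed horizontal space *)

Section LimitMetric.
Context {R : realType}.

Definition norm2 m (y : 'rV[R]_m) : R := Num.sqrt (\sum_i y 0 i ^+ 2).

Lemma norm2_coord m (y : 'rV[R]_m) i : `|y 0 i| <= norm2 y.
Proof.
rewrite /norm2 -sqrtr_sqr ler_wsqrtr// (bigD1 i)//= lerDl sumr_ge0// => j _.
exact: sqr_ge0.
Qed.

(** Each coordinate changes by at most m eta |y|; expanding the squares and summing gives the factor
    1 + 2 m^2 eta + m^3 eta^2, which is at most (1 + (m^2 + m^3) eta)^2 since eta <= 1. *)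
Lemma norm2_perturb m (y : 'rV[R]_m) (F : 'M[R]_m) (eta : R) : 0 <= eta -> eta <= 1 ->
  (forall i j, `|F i j - (i == j)%:R| <= eta) ->
  norm2 (y *m F) <= (1 + (m ^ 2 + m ^ 3)%:R * eta) * norm2 y.
Proof.
move=> e0 e1 Fe; set s := norm2 y; have s0 : 0 <= s by exact: sqrtr_ge0.
have s2 : \sum_i y 0 i ^+ 2 = s ^+ 2.
  by rewrite /s /norm2 sqr_sqrtr// sumr_ge0// => j _; exact: sqr_ge0.
pose e j := (y *m F) 0 j - y 0 j.
have me (j : 'I_m) : `|e j| <= m%:R * eta * s.
  have -> : e j = \sum_i y 0 i * (F i j - (i == j)%:R).
    rewrite /e mxE; under [RHS]eq_bigr do rewrite mulrBr.
    rewrite sumrB; congr (_ - _); rewrite (bigD1 j)//= eqxx mulr1 big1 ?addr0// => i ij.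
    by rewrite (negbTE ij) mulr0.
  apply: le_trans (ler_norm_sum _ _ _) _.
  rewrite -mulrA mulr_natl -[X in _ *+ X]card_ord -sumr_const; apply: ler_sum => i _.
  by rewrite normrM mulrC; apply: ler_pM => //; exact: norm2_coord.
have K0 : 0 <= 1 + (m ^ 2 + m ^ 3)%:R * eta by rewrite addr_ge0// mulr_ge0.
rewrite {1}/norm2 -[leRHS]ger0_norm ?mulr_ge0// -sqrtr_sqr ler_wsqrtr//.
have h j : (y *m F) 0 j ^+ 2 <= y 0 j ^+ 2 + (2 * (m%:R * eta) + (m%:R * eta) ^+ 2) * s ^+ 2.
  have -> : (y *m F) 0 j = y 0 j + e j by rewrite /e addrC subrK.
  have h1 := me j; have h2 := norm2_coord y j; rewrite -/s in h2.
  have p1 : y 0 j * e j <= s * (m%:R * eta * s).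
    by apply: le_trans (ler_norm _) _; rewrite normrM; exact: ler_pM.
  have p2 : e j ^+ 2 <= (m%:R * eta * s) ^+ 2.
    by rewrite -(real_normK (num_real (e j))) ler_sqr ?nnegrE// mulr_ge0// mulr_ge0.
  move: p2 p1; move: (e j) (y 0 j) (m%:R * eta) => ej yj k p2 p1.
  have -> : (2 * k + k ^+ 2) * s ^+ 2 = 2 * (s * (k * s)) + (k * s) ^+ 2 by ring.
  have -> : (yj + ej) ^+ 2 = yj ^+ 2 + (2 * (yj * ej) + ej ^+ 2) by ring.
  by rewrite lerD2l lerD// ler_pM2l.
apply: le_trans (ler_sum _ (fun j _ => h j)) _.
rewrite big_split /= s2 sumr_const card_ord natrD !natrX -[X in _ + X <= _]mulr_natl.
have : 0 <= eta * (1 - eta) by rewrite mulr_ge0// subr_ge0.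
have m0 : 0 <= m%:R :> R by [].
move: (m%:R) m0 => k k0 ee.
have k3 : 0 <= k ^+ 3 by rewrite exprn_ge0.
have s20 : 0 <= s ^+ 2 by exact: sqr_ge0.
rewrite [leRHS]exprMn.
have -> : s ^+ 2 + k * ((2 * (k * eta) + (k * eta) ^+ 2) * s ^+ 2) =
  (1 + k * (2 * (k * eta) + (k * eta) ^+ 2)) * s ^+ 2 by ring.
apply: ler_wpM2r => //.
have h1 : 0 <= k ^+ 3 * (eta * (1 - eta)) by rewrite mulr_ge0.
have h2 : 0 <= ((k ^+ 2 + k ^+ 3) * eta) ^+ 2 by exact: sqr_ge0.
have h3 : 0 <= k ^+ 3 * eta by rewrite mulr_ge0.
rewrite -subr_ge0.
have -> : (1 + (k ^+ 2 + k ^+ 3) * eta) ^+ 2 - (1 + k * (2 * (k * eta) + (k * eta) ^+ 2)) =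
  k ^+ 3 * (eta * (1 - eta)) + ((k ^+ 2 + k ^+ 3) * eta) ^+ 2 + k ^+ 3 * eta by ring.
by rewrite !addr_ge0.
Qed.

Context {n : nat}.
Implicit Types (M : sr_metric R n) (G : set (heis R n)).

Definition coord_prod (Q : 'M[R]_(n + n)) (u w : heis R n) : R :=
  \sum_i (hw u *m Q) 0 i * (hw w *m Q) 0 i.

Section MetricOf.
Variables (M : sr_metric R n) (S : 'M[R]_(n + n, n + n + 1)) (Q0 Q : 'M[R]_(n + n)).
Hypotheses (MQ : sr_coord M S Q0) (uQ : Q \in unitmx).

Lemma coord_prodC : {in sr_space M &, forall u v, coord_prod Q u v = coord_prod Q v u}.
Proof. by move=> u v _ _; apply: eq_bigr => i _; rewrite mulrC. Qed.

Lemma coord_prod_linear (a : R) : {in sr_space M & &, forall u v w,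
  coord_prod Q (a *: u + v) w = a * coord_prod Q u w + coord_prod Q v w}.
Proof.
move=> u v w _ _ _; rewrite /coord_prod mulr_sumr -big_split; apply: eq_bigr => i _ /=.
rewrite hwD hwZ mulmxDl -scalemxAl.
have -> : (a *: (hw u *m Q) + hw v *m Q) 0 i = a * (hw u *m Q) 0 i + (hw v *m Q) 0 i.
  by rewrite [LHS]mxE [X in X + _]mxE.
by ring.
Qed.

Lemma coord_prod_gt0 : {in sr_space M, forall u, u != 0 -> 0 < coord_prod Q u u}.
Proof.
move=> u uM u0; have sq i : 0 <= (hw u *m Q) 0 i * (hw u *m Q) 0 i.
  by rewrite -expr2 sqr_ge0.
rewrite lt_def sumr_ge0 ?andbT//; apply: contra u0.
rewrite /coord_prod psumr_eq0// => /allP h.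
have : hw u *m Q = 0.
  apply/rowP => i; rewrite [RHS]mxE; apply/eqP.
  by have := h i (mem_index_enum i); rewrite /= mulf_eq0 orbb.
move=> /(congr1 (mulmx^~ (invmx Q))); rewrite mulmxK// mul0mx => hu0.
by rewrite (src_eq MQ uM) hu0 mul0mx.
Qed.

(** The scalar product for which [Q] reads orthonormal components, on the unchanged horizontal space
    of [M]. *)
Definition metric_of : sr_metric R n :=
  SRMetric coord_prodC coord_prod_linear coord_prod_gt0.

Lemma metric_of_coord : sr_coord metric_of S Q.
Proof.
split=> [//|x|x|w wM|].
- exact: (src_mem MQ).
- exact: (src_hw MQ).
- exact: (src_eq MQ).
by move=> w _; apply: eq_bigr => i _; rewrite expr2.
Qed.
End MetricOf.

Lemma sr_norm_coord M S Q w : sr_coord M S Q -> w \in sr_space M ->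
  sr_norm M w = norm2 (hw w *m Q).
Proof. by move=> MQ wM; rewrite /sr_norm (src_prod MQ). Qed.

Lemma orbit_surj G (A : heis_quot G) : exists x, A = orbit G x.
Proof. by case: A => A [x AE]; exists x; apply: eq_exist. Qed.

Lemma orbit_eq G g x : hsubgroup G -> G g -> orbit G (hmul g x) = orbit G x.
Proof.
move=> [G0 GM GV] Gg; apply: eq_exist; apply/seteqP; split => _ [h Gh <-].
  by exists (hmul h g); [exact: GM|rewrite hmulA].
by exists (hmul h (hinv g)); [apply: GM => //; exact: GV|rewrite -hmulA hmulKg].
Qed.

(** [A1] lists the generators of [G0] in the orthonormal frame of the new metric. The affine map
    matching generators therefore acts on orthonormal coordinates as
    [invmx (ld_B L *m ld_Q L) *m A1], and the two norm bounds make it and its inverse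
    K-Lipschitz. *)
Lemma ld_dist_compare M M0 G G0 (C C0 K : R)
    (L : lattice_data M G C) (L0 : lattice_data M0 G0 C0)
    (A1 : 'M[R]_(n + n)) (uQ : invmx (ld_B L0) *m A1 \in unitmx) :
  hsubgroup G -> hsubgroup G0 -> ld_N L = ld_N L0 -> 0 < K ->
  (forall y, norm2 (y *m (invmx (ld_B L *m ld_Q L) *m A1)) <= K * norm2 y) ->
  (forall y, norm2 (y *m (invmx A1 *m (ld_B L *m ld_Q L))) <= K * norm2 y) ->
  exists F : heis_quot G -> heis_quot G0,
  [/\ forall A B, (sr_dist (metric_of (ld_coord L0) uQ) (F A) (F B) <= K%:E * sr_dist M A B)%E,
      forall A B, (sr_dist M A B <= K%:E * sr_dist (metric_of (ld_coord L0) uQ) (F A) (F B))%E &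
      forall A', exists A, F A = A'].
Proof.
move=> sG sG0 NN K0 K1 K2; set M' := metric_of (ld_coord L0) uQ.
have M'Q : sr_coord M' (ld_S L0) (invmx (ld_B L0) *m A1) by exact: metric_of_coord.
have [a ag] := ld_translation L L0.
have [im1 im2] := ld_conj_image NN sG sG0 ag.
pose P := ld_P L L0; pose P' := ld_P L0 L.
have aP : automorphism P (ld_rho L L0) by exact: ld_automorphism.
have aP' : automorphism P' (ld_rho L0 L) by exact: ld_automorphism.
pose Phi x : heis R n := hmul a (x *m P).
pose Phi' y : heis R n := hmul (hinv a *m P') (y *m P').
have PhiK x : Phi' (Phi x) = x.
  by rewrite /Phi' /Phi (automorphismM _ _ aP') hmulKg ld_PK.
have Phi'K y : Phi (Phi' y) = y.
  by rewrite /Phi' /Phi (automorphismM _ _ aP') ld_PK hmulVKg.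
have PhiM g x : Phi (hmul g x) = hmul (ld_conj L L0 a g) (Phi x) by exact: ld_conj_mul.
have memP : {in sr_space M, forall w, w *m P \in sr_space M'} := @ld_P_mem _ _ _ _ _ _ _ _ L L0.
have memP' : {in sr_space M', forall w, w *m P' \in sr_space M} := @ld_P_mem _ _ _ _ _ _ _ _ L0 L.
have hwP w : hw (w *m P) = hw w *m ld_T L L0 := ld_hwP L L0 w.
have hwP' w : hw (w *m P') = hw w *m ld_T L0 L := ld_hwP L0 L w.
clearbody P P' M'.
have /choice[F FP] : forall A : heis_quot G, exists A' : heis_quot G0, exists2 x,
    A = orbit G x & A' = orbit G0 (Phi x).
  by move=> A; have [x ->] := orbit_surj A; exists (orbit G0 (Phi x)), x.
have Fin A x : sval A x -> sval (F A) (Phi x).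
  have [y -> ->] := FP A => -[g Gg <-]; rewrite PhiM.
  by exists (ld_conj L L0 a g) => //; exact: im1.
have Fout A y : sval (F A) y -> sval A (Phi' y).
  have [x -> ->] := FP A => -[g0 /im2[g Gg <-] <-]; rewrite -PhiM PhiK.
  by exists g.
have uB := ld_B_unit L; have uB0 := ld_B_unit L0; have uQL := src_unit (ld_coord L).
have uA : ld_B L *m ld_Q L \in unitmx by rewrite unitmx_mul uB.
have uA1 : A1 \in unitmx by have := uQ; rewrite unitmx_mul unitmx_inv uB0.
exists F; split.
- move=> A B; apply: (@sr_dist_affine R n P (ld_rho L L0) a aP M M' G G0 K) => //.
  + move=> w wM; rewrite -!/(sr_norm _ _) (sr_norm_coord M'Q (memP w wM)).
    rewrite (sr_norm_coord (ld_coord L) wM) hwP.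
    apply: le_trans (K1 (hw w *m ld_Q L)); rewrite le_eqVlt; apply/orP; left; apply/eqP.
    have QBQ : ld_Q L *m invmx (ld_B L *m ld_Q L) = invmx (ld_B L).
      by rewrite -[LHS](mulKmx uB) (mulmxA (ld_B L)) mulmxV// mulmx1.
    congr norm2; rewrite /ld_T [RHS]mulmxA -[_ *m ld_Q L *m _]mulmxA QBQ.
    by rewrite !mulmxA mulmxK.
  + by move=> x; exact: Fin.
  + by move=> x; exact: Fin.
- move=> A B; apply: (@sr_dist_affine R n P' (ld_rho L0 L) (hinv a *m P') aP' M' M G0 G K) => //.
  + move=> w wM; rewrite -!/(sr_norm _ _) (sr_norm_coord M'Q wM).
    rewrite (sr_norm_coord (ld_coord L) (memP' w wM)) hwP'; apply: le_trans (K2 _).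
    rewrite le_eqVlt; apply/orP; left; apply/eqP.
    by congr norm2; rewrite /ld_T !mulmxA mulmxK.
  + by move=> y; exact: Fout.
  + by move=> y; exact: Fout.
- move=> A'; have [y ->] := orbit_surj A'; exists (orbit G (Phi' y)).
  have [x xE ->] := FP (orbit G (Phi' y)).
  have : sval (orbit G x) (Phi' y).
    by rewrite -xE; exists 0; [case: sG|rewrite hmul0g].
  move=> [g Gg e]; rewrite -(Phi'K y) -e PhiM orbit_eq//; exact: im1.
Qed.
End LimitMetric.

(** * From comparison with factors tending to 1 to an isometry *)

Section LimitOfApproximations.
Context {R : realType}.

Lemma hausdorff_dist_lt (Z : metricType R) (A B : set Z) (e : R) :
  (hausdorff_dist A B < e%:E)%E ->
  (forall a, A a -> exists2 b, B b & mdist a b < e) /\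
  (forall b, B b -> exists2 a, A a & mdist a b < e).
Proof.
rewrite /hausdorff_dist gt_max => /andP[h1 h2]; split=> [a Aa|b Bb].
  have : (ereal_inf [set (mdist a b)%:E | b in B] < e%:E)%E.
    by apply: le_lt_trans h1; apply: ereal_sup_ubound; exists a.
  by move=> /ereal_inf_lt [_ [b Bb <-]]; rewrite lte_fin; exists b.
have : (ereal_inf [set (mdist a b)%:E | a in A] < e%:E)%E.
  by apply: le_lt_trans h2; apply: ereal_sup_ubound; exists b.
by move=> /ereal_inf_lt [_ [a Aa <-]]; rewrite lte_fin; exists a.
Qed.

(* d inherits symmetry and the triangle inequality, up to factors K^2 tending to
   1, from the spaces W, which embed in metric spaces. *)
Lemma isometric_limit (X : metricType R) (Y : Type) (d : Y -> Y -> \bar R) (D : R) :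
  compact [set: X] -> 0 < D ->
  (forall y y', (0 <= d y y')%E) -> (forall y y', d y y' = 0%E -> y = y') ->
  (forall (d' : Y -> Y -> R), (forall y y', (d' y y')%:E = d y y') ->
     (forall y y', d' y y' = d' y' y) -> (forall x y z, d' x z <= d' x y + d' y z) ->
     forall (U : set_system nat) (u : nat -> Y), UltraFilter U ->
     exists y, forall e, 0 < e -> U [set j | d' (u j) y < e]) ->
  (forall K e : R, 1 < K -> 0 < e ->
    exists (W : Type) (dW : W -> W -> \bar R) (F : W -> Y),
    [/\ (gh_dist dW (fun x y : X => (mdist x y)%:E) < e%:E)%E,
        forall A B, (dW A B <= D%:E)%E,
        forall A B, (d (F A) (F B) <= K%:E * dW A B)%E,
        forall A B, (dW A B <= K%:E * d (F A) (F B))%E &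
        forall y, exists A, F A = y]) ->
  exists2 f : X -> Y, bijective f & forall x y, d (f x) (f y) = (mdist x y)%:E.
Proof.
move=> cX D0 d0 dsep dU approx.
have emb K e : 1 < K -> 0 < e ->
    exists (W : Type) (Z : metricType R) (f : W -> Z) (g : X -> Z) (F : W -> Y),
    [/\ [/\ forall x x', mdist (g x) (g x') = mdist x x',
            forall A B, mdist (f A) (f B) <= D,
            forall A B, (d (F A) (F B) <= (K * mdist (f A) (f B))%:E)%E &
            forall A B, ((mdist (f A) (f B))%:E <= K%:E * d (F A) (F B))%E],
        forall y, exists A, F A = y,
        forall x, exists A, mdist (f A) (g x) < e &
        forall A, exists x, mdist (f A) (g x) < e].
  move=> K1 e0; have [W [dW [F [gh dWD dF1 dF2 Fs]]]] := approx K e K1 e0.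
  have [_ [Z [f [g [fE gE ->]]]] hd] := ereal_inf_lt gh.
  have [h1 h2] := hausdorff_dist_lt hd.
  exists W, Z, f, g, F; split => //.
  - split=> [x x'|A B|A B|A B].
    + by have := gE x x' => -[].
    + by rewrite -lee_fin fE.
    + by rewrite EFinM fE.
    + by rewrite fE.
  - move=> x; have [|_ [A _ <-] fa] := h2 (g x); first by exists x.
    by exists A.
  - move=> A; have [|_ [x _ <-] ga] := h1 (f A); first by exists A.
    by exists x.
have dfin y y' : d y y' \is a fin_num.
  have [|W [Z [f [g [F [[_ fD h1 _] Fs _ _]]]]]] := emb 2 1 _ ltr01; first by lra.
  have [A <-] := Fs y; have [B <-] := Fs y'.
  by rewrite ge0_fin_numE//; apply: le_lt_trans (h1 A B) _; rewrite ltry.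
pose d' y y' := fine (d y y').
have d'E y y' : (d' y y')%:E = d y y' by rewrite fineK.
have {}emb K e : 1 < K -> 0 < e ->
    exists (W : Type) (Z : metricType R) (f : W -> Z) (g : X -> Z) (F : W -> Y),
    [/\ [/\ forall x x', mdist (g x) (g x') = mdist x x',
            forall A B, mdist (f A) (f B) <= D,
            forall A B, d' (F A) (F B) <= K * mdist (f A) (f B) &
            forall A B, mdist (f A) (f B) <= K * d' (F A) (F B)],
        forall y, exists A, F A = y,
        forall x, exists A, mdist (f A) (g x) < e &
        forall A, exists x, mdist (f A) (g x) < e].
  move=> K1 e0; have [W [Z [f [g [F [[h1 h2 h3 h4] h5 h6 h7]]]]]] := emb K e K1 e0.
  exists W, Z, f, g, F; split => //; split => // A B.
    by have := h3 A B; rewrite -d'E lee_fin.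
  by have := h4 A B; rewrite -d'E -EFinM lee_fin.
have d'0 y y' : 0 <= d' y y' by rewrite -lee_fin d'E.
(* Lets K tend to 1: for t <= 1, (1 + t)^2 b <= b + 3 t b. Writing b + 1 in the denominator covers b
   = 0. *)
have leK (a b : R) : 0 <= b -> (forall K, 1 < K -> a <= K * (K * b)) -> a <= b.
  move=> b0 h; apply/ler_addgt0Pr => e e0.
  pose t := Num.min 1 (e / (3 * (b + 1))).
  have b1 : 0 < 3 * (b + 1) by lra.
  have t0 : 0 < t by rewrite lt_min ltr01 divr_gt0.
  have t1 : t <= 1 by rewrite ge_min lexx.
  have te : t * (3 * (b + 1)) <= e by rewrite -ler_pdivlMr// ge_min lexx orbT.
  have := h (1 + t); rewrite ltrDl => /(_ t0) /le_trans; apply.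
  have : 0 <= t * (1 - t) * b by rewrite mulr_ge0// mulr_ge0// ?subr_ge0// ltW.
  nra.
have dC y y' : d' y y' <= d' y' y.
  apply: leK => // K K1; have [W [Z [f [g [F [[_ _ h1 h2] Fs _ _]]]]]] := emb K 1 K1 ltr01.
  have [A <-] := Fs y; have [B <-] := Fs y'.
  have K0 : 0 < K by lra.
  apply: le_trans (h1 A B) _; rewrite metric_sym; apply: ler_wpM2l; [exact: ltW|exact: h2].
have dT x y z : d' x z <= d' x y + d' y z.
  apply: leK => [|K K1]; first exact: addr_ge0.
  have [W [Z [f [g [F [[_ _ h1 h2] Fs _ _]]]]]] := emb K 1 K1 ltr01.
  have [A <-] := Fs x; have [B <-] := Fs y; have [C <-] := Fs z.
  have K0 : 0 <= K by lra.
  apply: le_trans (h1 A C) _; apply: ler_wpM2l => //.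
  apply: le_trans (metric_triangle _ (f B) _) _.
  by rewrite mulrDr; apply: lerD; exact: h2.
have dC' y y' : d' y y' = d' y' y by apply/le_anti; rewrite !dC.
have [||f fb fE] := @isometry_of_approx R X Y d' cX dC' dT _ (dU d' d'E dC' dT).
- by move=> y y' yy; apply: dsep; rewrite -d'E yy.
(* Distances in [W] are at most D, so the factor 1 + t costs at most t D <= e / 4; the rest of e is
   for the Hausdorff errors e / 8. The approximation sends x to the image under [F] of a nearby
   point [a x] of [W]. *)
- move=> e e0; pose t := Num.min 1 (e / (4 * (D + 1))).
  have D1 : 0 < 4 * (D + 1) by lra.
  have t0 : 0 < t by rewrite lt_min ltr01 divr_gt0.
  have t1 : t <= 1 by rewrite ge_min lexx.
  have te : t * (4 * (D + 1)) <= e by rewrite -ler_pdivlMr// ge_min lexx orbT.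
  have e80 : 0 < e / 8 by lra.
  have K1 : 1 < 1 + t by rewrite ltrDl.
  have [W [Z [f [g [F [[gE fD h1 h2] Fs Xa Wa]]]]]] := emb (1 + t) (e / 8) K1 e80.
  have /choice[a aP] := Xa.
  have tD : t * D <= e / 4 by nra.
  exists (fun x => F (a x)); split.
    move=> x x'; have H1 := h1 (a x) (a x'); have H2 := h2 (a x) (a x').
    have H3 := fD (a x) (a x'); have H0 := d'0 (F (a x)) (F (a x')).
    have T1 := metric_triangle (f (a x)) (g x) (f (a x')).
    have T2 := metric_triangle (g x) (g x') (f (a x')).
    have T3 := metric_triangle (g x) (f (a x)) (g x').
    have T4 := metric_triangle (f (a x)) (f (a x')) (g x').
    have A1 := aP x; have A2 := aP x'.
    rewrite (metric_sym (g x') (f (a x'))) in T2; rewrite (metric_sym (g x) (f (a x))) in T3.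
    rewrite !gE in T2 T3.
    have m0 : 0 <= mdist (f (a x)) (f (a x')) by exact: mdist_ge0.
    move: H1 H2 H3 H0 T1 T2 T3 T4 A1 A2 m0.
    move: (mdist (f (a x)) (f (a x'))) (d' _ _) (mdist x x') => p q r.
    move=> H1 H2 H3 H0 T1 T2 T3 T4 A1 A2 m0.
    have tp : t * p <= e / 4 by apply: le_trans tD; rewrite ler_pM2l.
    have tq : t * q <= e / 2.
      have : t * q <= t * ((1 + t) * p) by rewrite ler_pM2l.
      have : t * (t * p) <= 1 * (t * p) by rewrite ler_wpM2r// mulr_ge0// ltW.
      by lra.
    by rewrite ler_norml; apply/andP; split; lra.
  move=> y; have [A <-] := Fs y; have [x xP] := Wa A; exists x.
  apply: le_trans (h1 _ _) _.
  have T1 := metric_triangle (f (a x)) (g x) (f A); have A1 := aP x.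
  rewrite (metric_sym (g x) (f A)) in T1.
  have m0 : 0 <= mdist (f (a x)) (f A) by exact: mdist_ge0.
  have : (1 + t) * mdist (f (a x)) (f A) <= 2 * mdist (f (a x)) (f A).
    by apply: ler_wpM2r => //; lra.
  by lra.
by exists f => // x y; rewrite -d'E fE.
Qed.
End LimitOfApproximations.

(** * The limit *)

Section QuotientDistance.
Context {R : realType} {n : nat}.
Implicit Types (M : sr_metric R n) (G : set (heis R n)).

Lemma sr_dist_ge0 M G (A B : heis_quot G) : (0 <= sr_dist M A B)%E.
Proof.
apply: le_ereal_inf_tmp => _ [c _ <-]; apply: integral_ge0 => t _.
by rewrite lee_fin sqrtr_ge0.
Qed.

Lemma hmul_le (g h : heis R n) : `|hmul g h| <= `|g| + `|h| + n%:R * (`|g| * `|h|).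
Proof.
rewrite /hmul; apply: le_trans (ler_normD _ _) _; apply: lerD; first exact: ler_normD.
apply: le_trans (norm_hcenter _) _; rewrite normrM [`|2^-1|]ger0_norm ?invr_ge0//.
by rewrite ler_pdivrMr//; apply: le_trans (hsymp_le _ _) _; rewrite natrM; lra.
Qed.

(** Short paths give elements g of G with x^-1 g y arbitrarily close to 0. Such g are bounded, hence
    finitely many, so the minimum of |x^-1 g y| is attained, and it is 0. *)
Lemma sr_dist_eq0 M S Q G (A B : heis_quot G) : lattice G -> sr_coord M S Q ->
  sr_dist M A B = 0%E -> A = B.
Proof.
move=> lG MQ; have [x ->] := orbit_surj A; have [y ->] := orbit_surj B => d0.
have sG := lattice_hsubgroup lG; have [G0 GM GV] := sG.
have near e : 0 < e -> exists2 g, G g & `|hmul (hinv x) (hmul g y)| < e.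
  move=> e0; have [d dpos Hd] := horizontal_small MQ e0.
  have : (sr_dist M (orbit G x) (orbit G y) < d%:E)%E by rewrite d0 lte_fin.
  move=> /ereal_inf_lt [_ [c [hc [g0 Gg0 c0] [g1 Gg1 c1]] <-] lc].
  exists (hmul (hinv g0) g1); first by apply: GM => //; exact: GV.
  by have := Hd c hc lc; rewrite -c0 -c1 hinvM -!hmulA.
pose f g := hmul (hinv x) (hmul g y).
pose K1 := `|hinv y| + 1 + n%:R * `|hinv y|.
have K10 : 0 <= K1 by rewrite !addr_ge0// mulr_ge0.
pose K := `|x| + K1 + n%:R * (`|x| * K1).
have gK g : `|f g| <= 1 -> `|g| <= K.
  move=> fg; have -> : g = hmul x (hmul (f g) (hinv y)).
    by rewrite /f hmulA hmulVKg hmulgK.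
  have h1 : `|hmul (f g) (hinv y)| <= K1.
    apply: le_trans (hmul_le _ _) _; rewrite /K1 [`|f g| + _]addrC.
    apply: lerD; first by rewrite lerD2l.
    by apply: ler_wpM2l => //; rewrite ler_piMl.
  apply: le_trans (hmul_le _ _) _; rewrite /K; apply: lerD; first by rewrite lerD2l.
  by do 2 apply: ler_wpM2l => //.
pose T := G `&` [set g | `|g| <= K].
have fT : finite_set T by exact: lattice_finite.
have T0 : T !=set0.
  have [g Gg fg] := near 1 ltr01; exists g; split => //; apply: gK; exact: ltW.
have [g [Gg _] gmin] := finite_argmin (fun g => `|f g|) fT T0.
have [fg0|fg0] := eqVneq (`|f g|) 0.
  move/eqP: fg0; rewrite normr_eq0 => /eqP fg0.
  by rewrite -(orbit_eq y sG Gg) -[hmul g y](hmulVKg x) -/(f g) fg0 hmulg0.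
have e0 : 0 < Num.min 1 `|f g| by rewrite lt_min ltr01 lt_def fg0 normr_ge0.
have [h Gh] := near _ e0; rewrite lt_min -/(f h) => /andP[h1 h2].
have : T h by split => //; apply: gK; exact: ltW.
by move=> /gmin; rewrite leNgt h2.
Qed.

Lemma exists_symplectic_pair M S Q : (1 <= n)%N -> sr_coord M S Q ->
  exists e f, [/\ e \in sr_space M, f \in sr_space M & hsymp e f = 1].
Proof.
move=> n1 MQ; pose l i : heis R n := delta_mx 0 i *m S.
have lE : \matrix_i hw (l i) = 1%:M.
  by apply/row_matrixP => i; rewrite rowK (src_hw MQ) row1.
have [i [j ij]] : exists i j, hsymp (l i) (l j) != 0.
  by apply: hsymp_basis => //; rewrite lE unitmx1.
exists ((hsymp (l i) (l j))^-1 *: l i), (l j); split.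
- by apply: memvZ; exact: (src_mem MQ).
- exact: (src_mem MQ).
- by rewrite hsympZl mulVf.
Qed.

Lemma sr_normZ M S Q (a : R) w : sr_coord M S Q -> w \in sr_space M ->
  sr_norm M (a *: w) = `|a| * sr_norm M w.
Proof.
move=> MQ wM; rewrite !(sr_norm_coord MQ)//; last exact: memvZ.
rewrite hwZ -scalemxAl /norm2 -sqrtr_sqr -sqrtrM ?sqr_ge0//; congr Num.sqrt.
by rewrite mulr_sumr; apply: eq_bigr => i _; rewrite mxE exprMn.
Qed.

Section Compactness.
Variables (M : sr_metric R n) (S : 'M[R]_(n + n, n + n + 1)) (Q : 'M[R]_(n + n)).
Variables (G : set (heis R n)) (d : heis_quot G -> heis_quot G -> R).
Hypotheses (n1 : (1 <= n)%N) (MQ : sr_coord M S Q) (lG : lattice G).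
Hypothesis dE : forall A B, (d A B)%:E = sr_dist M A B.
Hypothesis dC : forall A B, d A B = d B A.
Hypothesis dT : forall A B C, d A C <= d A B + d B C.

Lemma straight_line_dist x w : w \in sr_space M ->
  d (orbit G x) (orbit G (hmul x w)) <= sr_norm M w.
Proof.
move=> wM; rewrite -lee_fin dE; have [G0 _ _] := lattice_hsubgroup lG.
by apply: (straight_line_length MQ wM); exists 0; rewrite ?hmul0g.
Qed.

(* The commutator of a e and b f is central, with centre coordinate a b. *)
Lemma center_dist : exists2 C, 0 <= C & forall x t,
  d (orbit G x) (orbit G (hmul x (hcenter t))) <= C * Num.sqrt `|t|.
Proof.
have [e [f [eM fM ef]]] := exists_symplectic_pair n1 MQ.
exists (2 * (sr_norm M e + sr_norm M f)); first by rewrite mulr_ge0// addr_ge0// sqrtr_ge0.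
move=> x t; have [a aE] : exists a, a = Num.sqrt `|t| by exists (Num.sqrt `|t|).
(* The product of a and b is t, while both are at most the square root of |t| in absolute value. *)
pose b := Num.sg t * a.
have ab : a * b = t.
  by rewrite /b mulrCA -expr2 aE sqr_sqrtr// -numEsg.
have a0 : 0 <= a by rewrite aE sqrtr_ge0.
have ag : `|a| = a by rewrite ger0_norm.
have bg : `|b| <= a.
  by rewrite normrM ag normr_sg ler_piMl//; case: (t != 0).
pose g := a *: e; pose h := b *: f.
have gM : g \in sr_space M by exact: memvZ.
have hM : h \in sr_space M by exact: memvZ.
have gV : hinv g \in sr_space M by rewrite memvN.
have hV : hinv h \in sr_space M by rewrite memvN.
have ng : sr_norm M g = a * sr_norm M e by rewrite (sr_normZ _ MQ)// ag.
have nh : sr_norm M h <= a * sr_norm M f.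
  by rewrite (sr_normZ _ MQ)//; apply: ler_wpM2r => //; exact: sqrtr_ge0.
have nV w : w \in sr_space M -> sr_norm M (hinv w) = sr_norm M w.
  by move=> wM; rewrite /hinv -scaleN1r (sr_normZ _ MQ)// normrN1 mul1r.
have -> : hmul x (hcenter t) = hmul (hmul (hmul (hmul x g) h) (hinv g)) (hinv h).
  rewrite -ab -[a * b]mulr1 -ef -mulrA -hsympZr -hsympZl -/g -/h -hcommutator.
  by rewrite !hmulA.
have s1 := straight_line_dist x gM.
have s2 := straight_line_dist (hmul x g) hM.
have s3 := straight_line_dist (hmul (hmul x g) h) gV.
have s4 := straight_line_dist (hmul (hmul (hmul x g) h) (hinv g)) hV.
rewrite nV// in s3; rewrite nV// in s4.
set x1 := hmul x g in s1 s2 s3 s4 *; set x2 := hmul x1 h in s2 s3 s4 *.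
set x3 := hmul x2 _ in s3 s4 *.
have t1 := dT (orbit G x) (orbit G x1) (orbit G (hmul x3 (hinv h))).
have t2 := dT (orbit G x1) (orbit G x2) (orbit G (hmul x3 (hinv h))).
have t3 := dT (orbit G x2) (orbit G x3) (orbit G (hmul x3 (hinv h))).
apply: le_trans t1 _.
apply: le_trans (lerD s1 (le_trans t2 (lerD s2 (le_trans t3 (lerD s3 s4))))) _.
rewrite -aE ng mulrDr mulrDl.
move: nh; move: (sr_norm M h) => p.
have -> : 2 * sr_norm M e * a = 2 * (a * sr_norm M e) by ring.
have -> : 2 * sr_norm M f * a = 2 * (a * sr_norm M f) by ring.
move: (a * sr_norm M e) (a * sr_norm M f) => q r pr.
have -> : q + (p + (q + p)) = 2 * q + 2 * p by ring.
by rewrite lerD2l ler_pM2l.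
Qed.

(** Write x^-1 x' as a horizontal vector times a central element. The former is reached by a
    straight line, the latter by a commutator, which accounts for the square root. *)
Lemma dist_near x : exists C1 C2, [/\ 0 <= C1, 0 <= C2 & forall x',
  d (orbit G x) (orbit G x') <= C1 * `|x' - x| + C2 * Num.sqrt `|x' - x|].
Proof.
have [Cc Cc0 HC] := center_dist.
have [Cs Cs0 CsP] : exists2 C, 0 <= C & forall y : 'rV[R]_(n + n), `|y *m S| <= C * `|y|.
  by apply: linear_bounded => [y z|a y]; [exact: mulmxDl|rewrite scalemxAl].
have [Cq Cq0 CqP] : exists2 C, 0 <= C & forall y : 'rV[R]_(n + n), `|y *m Q| <= C * `|y|.
  by apply: linear_bounded => [y z|a y]; [exact: mulmxDl|rewrite scalemxAl].
pose k := 1 + n%:R * `|x|.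
have k0 : 0 <= k by rewrite addr_ge0// mulr_ge0.
pose m := (n + n)%N.
exists ((m.+1)%:R * Cq * k), (Cc * Num.sqrt ((1 + Cs) * k)); split.
- by rewrite !mulr_ge0.
- by rewrite mulr_ge0// sqrtr_ge0.
move=> x'; pose q := hmul (hinv x) x'.
have qle : `|q| <= k * `|x' - x| by exact: hmul_inv_le.
pose w := hw q *m S; pose t := hz q - hz w.
have wM : w \in sr_space M by exact: (src_mem MQ).
have qE : q = hmul w (hcenter t).
  rewrite hmul_centerr; apply: heisP; first by rewrite hwD hw_center addr0 (src_hw MQ).
  by rewrite hzD hcenterEr addrC subrK.
have hwq : `|hw q| <= `|q|.
  by apply: norm_le_coord => // i; rewrite hwE; exact: coord_le_norm.
have -> : x' = hmul (hmul x w) (hcenter t) by rewrite -hmulA -qE hmulVKg.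
rewrite [in leRHS](_ : hmul _ _ = x'); last by rewrite -hmulA -qE hmulVKg.
apply: le_trans (dT _ (orbit G (hmul x w)) _) _; apply: lerD.
  apply: le_trans (straight_line_dist x wM) _; rewrite (sr_norm_coord MQ wM) (src_hw MQ).
  apply: (@le_trans _ _ ((m.+1)%:R * `|hw q *m Q|)).
    have : 0 <= (m.+1)%:R * `|hw q *m Q| by rewrite mulr_ge0.
    move=> h0; rewrite /norm2 -[leRHS]ger0_norm// -sqrtr_sqr ler_wsqrtr//.
    apply: (@le_trans _ _ (\sum_(i < m) `|hw q *m Q| ^+ 2)).
      apply: ler_sum => i _; rewrite -(real_normK (num_real ((hw q *m Q) 0 i))).
      by rewrite ler_sqr ?nnegrE//; exact: coord_le_norm.
    rewrite sumr_const card_ord -[leLHS]mulr_natl [leRHS]exprMn.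
    apply: ler_wpM2r; first exact: sqr_ge0.
    by rewrite -natrX ler_nat; nia.
  rewrite -!mulrA; apply: ler_wpM2l => //; apply: le_trans (CqP _) _.
  by apply: ler_wpM2l => //; exact: le_trans qle.
apply: le_trans (HC _ _) _; rewrite -mulrA; apply: ler_wpM2l => //.
rewrite -sqrtrM ?ler_wsqrtr//; last by rewrite mulr_ge0// addr_ge0.
have tle : `|t| <= (1 + Cs) * `|q|.
  have hzle (g : heis R n) : `|hz g| <= `|g| by exact: coord_le_norm.
  apply: le_trans (ler_normB _ _) _; rewrite mulrDl mul1r; apply: lerD => //.
  apply: le_trans (hzle _) _; apply: le_trans (CsP _) _; exact: ler_wpM2l.
by apply: (le_trans tle); rewrite -mulrA; apply: ler_wpM2l => //; rewrite addr_ge0.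
Qed.

(** Representatives in the compact set of the lattice converge in coordinates along the ultrafilter,
    and [dist_near] turns this into convergence for [d]. *)
Lemma heis_quot_ultra_compact (U : set_system nat) (u : nat -> heis_quot G) :
  UltraFilter U -> exists y, forall e, 0 < e -> U [set j | d (u j) y < e].
Proof.
move=> UU; have [_ _ _ _ [K cK KP]] := lG; have sG := lattice_hsubgroup lG.
have /choice[k kP] : forall j, exists k, K k /\ u j = orbit G k.
  move=> j; have [x ->] := orbit_surj (u j); have [g [k [Gg Kk ->]]] := KP x.
  by exists k; split => //; rewrite orbit_eq.
have [x Kx kx] : exists2 x, K x & k @ U --> x.
  by apply: ultra_cvg => //; apply: filterS filterT => j _; case: (kP j).
exists (orbit G x) => e e0.
have [C1 [C2 [C10 C20 dx]]] := dist_near x.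
pose r := Num.min (e / (2 * (C1 + 1))) ((e / (2 * (C2 + 1))) ^+ 2).
have c1 : 0 < 2 * (C1 + 1) by lra.
have c2 : 0 < 2 * (C2 + 1) by lra.
have r0 : 0 < r by rewrite lt_min divr_gt0//= exprn_gt0// divr_gt0.
have : \forall j \near U, `|x - k j| < r by move/cvgrPdist_lt : kx; exact.
apply: filterS => j; rewrite distrC => kj /=; have [_ ->] := kP j; rewrite dC.
apply: le_lt_trans (dx _) _.
set p := `|k j - x| in kj *; have p0 : 0 <= p by exact: normr_ge0.
move: kj; rewrite lt_min => /andP[p1 p2].
have s0 : 0 <= Num.sqrt p by exact: sqrtr_ge0.
have p3 : Num.sqrt p < e / (2 * (C2 + 1)).
  have q0 : 0 <= e / (2 * (C2 + 1)) by rewrite divr_ge0// ltW.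
  by rewrite -[ltRHS]ger0_norm// -sqrtr_sqr ltr_sqrt// exprn_gt0// divr_gt0.
move: p1 p3; rewrite !ltr_pdivlMr// => p1 p3.
have : C1 * p <= (C1 + 1) * p by rewrite ler_wpM2r// lerDl.
have : C2 * Num.sqrt p <= (C2 + 1) * Num.sqrt p by rewrite ler_wpM2r// lerDl.
move: (Num.sqrt p) s0 p3 => s s0 p3 ? ?; nra.
Qed.
End Compactness.
End QuotientDistance.

(** * Entrywise limits of matrices along an ultrafilter *)

Section MatrixLimits.
Context {R : realType} (U : set_system nat) {UU : UltraFilter U}.

Definition mx_cvg m p (A : nat -> 'M[R]_(m, p)) (L : 'M[R]_(m, p)) :=
  forall i j, (fun k => A k i j) @ U --> L i j.

Lemma mx_cvg_cst m p (L : 'M[R]_(m, p)) : mx_cvg (fun=> L) L.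
Proof. by move=> i j; exact: cvg_cst. Qed.

Lemma mx_cvgM m p q (A : nat -> 'M[R]_(m, p)) (B : nat -> 'M[R]_(p, q)) L L' :
  mx_cvg A L -> mx_cvg B L' -> mx_cvg (fun k => A k *m B k) (L *m L').
Proof.
move=> AL BL i j.
have -> : (fun k => (A k *m B k) i j) = (fun k => \sum_l A k i l * B k l j).
  by apply/funext => k; rewrite mxE.
rewrite mxE; apply: (cvg_big (op := +%R) (P := xpredT)) => [|l _]; first exact: add_continuous.
exact: cvgM.
Qed.

Lemma mx_cvg_tr m p (A : nat -> 'M[R]_(m, p)) L :
  mx_cvg A L -> mx_cvg (fun k => (A k)^T) L^T.
Proof.
move=> AL i j; have -> : (fun k => (A k)^T i j) = (fun k => A k j i).
  by apply/funext => k; rewrite mxE.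
by rewrite mxE; exact: AL.
Qed.

Lemma mx_cvg_unique m p (A : nat -> 'M[R]_(m, p)) L L' :
  mx_cvg A L -> mx_cvg A L' -> L = L'.
Proof.
move=> AL AL'; apply/matrixP => i j.
exact: (@norm_cvg_unique _ _ _ (fmap_proper_filter (fun k => A k i j) _) _ _ (AL i j) (AL' i j)).
Qed.

Lemma mx_cvg_eq m p (A B : nat -> 'M[R]_(m, p)) L :
  U [set k | A k = B k] -> mx_cvg A L -> mx_cvg B L.
Proof.
move=> AB AL i j; apply: cvg_trans (AL i j); apply: near_eq_cvg.
by apply: filterS AB => k /= ->.
Qed.

Lemma mx_cvg_near m p (A : nat -> 'M[R]_(m, p)) L (e : R) : 0 < e -> mx_cvg A L ->
  U [set k | forall i j, `|A k i j - L i j| < e].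
Proof.
move=> e0 AL; have h (ij : 'I_m * 'I_p) : U [set k | `|A k ij.1 ij.2 - L ij.1 ij.2| < e].
  have /cvgrPdist_lt/(_ e e0) := AL ij.1 ij.2.
  by apply: filterS => k /=; rewrite distrC.
have hU : U [set k | forall ij, [set k | `|A k ij.1 ij.2 - L ij.1 ij.2| < e] k].
  exact: filter_forall.
by apply: filterS hU => k /= kP i j; exact: (kP (i, j)).
Qed.

Lemma mx_cvg_bounded m p (A : nat -> 'M[R]_(m, p)) C :
  (forall k i j, `|A k i j| <= C) -> exists L, mx_cvg A L.
Proof.
move=> AC; have /choice[L LP] : forall ij : ('I_m * 'I_p)%type, exists l : R,
    (fun k => A k ij.1 ij.2) @ U --> l.
  move=> ij; have [|l _ lP] := @ultra_cvg _ R `[- C, C] (fun k => A k ij.1 ij.2) U UU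
    (@segment_compact _ _ _).
    by apply: filterS filterT => k _ /=; rewrite in_itv/= -ler_norml.
  by exists l.
by exists (\matrix_(i, j) L (i, j)) => i j; rewrite mxE; exact: (LP (i, j)).
Qed.

Lemma mx_cvg1_norm2 m (F : nat -> 'M[R]_m) (K : R) : 1 < K -> mx_cvg F 1%:M ->
  U [set k | forall y, norm2 (y *m F k) <= K * norm2 y].
Proof.
move=> K1 F1; pose c : R := (m ^ 2 + m ^ 3)%:R.
have c0 : 0 <= c by [].
pose eta := Num.min 1 ((K - 1) / (c + 1)).
have c1 : 0 < c + 1 by lra.
have eta0 : 0 < eta by rewrite lt_min ltr01 divr_gt0// subr_gt0.
apply: filterS (mx_cvg_near eta0 F1) => k /= kP y.
have etac : eta * (c + 1) <= K - 1 by rewrite -ler_pdivlMr// ge_min lexx orbT.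
apply: le_trans (@norm2_perturb R m y (F k) eta (ltW eta0) _ _) _.
- by rewrite ge_min lexx.
- by move=> i j; have := kP i j; rewrite !mxE => /ltW.
apply: ler_wpM2r; first exact: sqrtr_ge0.
by rewrite -/c; clearbody eta c; nra.
Qed.

End MatrixLimits.

Lemma int_eq_near (R : realType) (a b : int) (l : R) :
  `|a%:~R - l| < 2^-1 -> `|b%:~R - l| < 2^-1 -> a = b.
Proof.
move=> al bl; have : `|a%:~R - b%:~R : R| < 1.
  have -> : a%:~R - b%:~R = (a%:~R - l) - (b%:~R - l) :> R by ring.
  by apply: le_lt_trans (ler_normB _ _) _; lra.
rewrite -intrB -intr_norm (ltr_int _ _ 1); lia.
Qed.

Theorem theorem1p2 (R : realType) (n : nat) (n_ge1 : (1 <= n)%N)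
    (Gamma : nat -> set (heis R n)) (M : nat -> sr_metric R n)
    (latticeGamma : forall k, lattice (Gamma k))
    (bracketM : forall k, bracket_generating (M k))
    (corankM : forall k, corank (M k) = 1%N)
    (X : metricType R) (compactX : compact [set: X])
    (cvgX : (fun k => gh_dist (sr_dist (M k) (G := Gamma k))
                              (fun x y : X => (mdist x y)%:E))
              @ \oo --> (0%R%:E : \bar R))
    (D V : R) (D_gt0 : 0 < D) (V_gt0 : 0 < V)
    (diam_le : forall k, (sr_diam (M k) (Gamma k) <= D%:E)%E)
    (meas_ge : forall k, (V%:E <= popp_measure (M k) (Gamma k))%E) :
  exists (Gamma' : set (heis R n)) (M' : sr_metric R n),
    [/\ lattice Gamma', bracket_generating M' &
        exists2 f : X -> heis_quot Gamma', bijective f &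
          forall x y, sr_dist M' (f x) (f y) = (mdist x y)%:E].
Proof.
have [C CP] := lattice_data_exists n_ge1 D_gt0 V_gt0.
pose ld k : lattice_data (M k) (Gamma k) C := unsquash
  (CP _ _ (latticeGamma k) (bracketM k) (corankM k) (diam_le k) (meas_ge k)).
have [U [UU ooU]] := ultra_oo.
pose A k := ld_B (ld k) *m ld_Q (ld k); pose W k := ld_W (ld k).
pose Nr k : 'M[R]_(n + n) := map_mx intr (ld_N (ld k)).
have AWA k : A k *m W k *m (A k)^T = Nr k by exact: ld_AWA.
have uNr k : Nr k \in unitmx by exact: ld_N_unit.
have uA k : A k \in unitmx by have := uNr k; rewrite -AWA !unitmx_mul => /andP[/andP[]].
have [Ao AoP] := @mx_cvg_bounded R U UU _ _ A C (fun k => ld_A_le (ld k)).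
have [Wo WoP] := @mx_cvg_bounded R U UU _ _ W C (fun k => ld_W_le (ld k)).
have NrP : mx_cvg U Nr (Ao *m Wo *m Ao^T).
  apply: mx_cvg_eq (mx_cvgM (mx_cvgM AoP WoP) (mx_cvg_tr AoP)).
  by apply: filterS filterT => k _ /=.
(* Integers within 1/2 of the same limit are equal; this makes the commutator matrices constant
   along [U]. *)
have US := mx_cvg_near (e := 2^-1) ltac:(lra) NrP.
have [k0 k0S] := filter_ex US.
have {}US : U [set k | ld_N (ld k) = ld_N (ld k0)].
  apply: filterS US => k /= kS; apply/matrixP => i j.
  apply: (@int_eq_near R _ _ ((Ao *m Wo *m Ao^T) i j)).
    by have := kS i j; rewrite [Nr k i j]mxE.
  by have := k0S i j; rewrite [Nr k0 i j]mxE.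
have NoE : Ao *m Wo *m Ao^T = Nr k0.
  apply: (mx_cvg_unique NrP); apply: (@mx_cvg_eq _ U UU _ _ (fun=> Nr k0)); last exact: mx_cvg_cst.
  by apply: filterS US => k /= ek; rewrite /Nr ek.
have uAo : Ao \in unitmx by move: (uNr k0); rewrite -NoE !unitmx_mul => /andP[/andP[]].
(* Expresses an inverse by products and transposes, so that convergence of the inverses of [A k]
   follows from that of [A k] and [W k]. *)
have invE (B Z : 'M[R]_(n + n)) : B \in unitmx -> B *m Z *m B^T = Nr k0 ->
    invmx B = Z *m B^T *m invmx (Nr k0).
  move=> uB BZB; apply: (can_inj (mulKmx uB)).
  by rewrite mulmxV// !mulmxA BZB mulmxV.
(* With this choice the generators of [Gamma k0] have the matrix [Ao] in the frame of the limit
   metric. *)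
have uQ : invmx (ld_B (ld k0)) *m Ao \in unitmx.
  by rewrite unitmx_mul unitmx_inv ld_B_unit.
pose M' := metric_of (ld_coord (ld k0)) uQ.
have M'Q := metric_of_coord (ld_coord (ld k0)) uQ.
(* [M'] has the horizontal space of [M k0], on which alone bracket generation depends. *)
exists (Gamma k0), M'; split => //; first exact: bracketM.
apply: (@isometric_limit R X _ _ D) => //.
- exact: sr_dist_ge0.
- by move=> y y'; exact: sr_dist_eq0 M'Q.
- by move=> d' dE dC dT U' u UU'; exact: (heis_quot_ultra_compact n_ge1 M'Q).
move=> K e K1 e0.
have U1 : U [set k | forall y, norm2 (y *m (invmx (A k) *m Ao)) <= K * norm2 y].
  apply: (mx_cvg1_norm2 K1); rewrite -(mulVmx uAo).
  apply: mx_cvgM; last exact: mx_cvg_cst.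
  rewrite (invE _ _ uAo NoE).
  apply: (@mx_cvg_eq _ U UU _ _ (fun k => W k *m (A k)^T *m invmx (Nr k0))); last first.
    by apply: mx_cvgM; [apply: mx_cvgM => //; exact: mx_cvg_tr|exact: mx_cvg_cst].
  by apply: filterS US => k /= ek; apply/esym/invE => //; rewrite AWA /Nr ek.
have U2 : U [set k | forall y, norm2 (y *m (invmx Ao *m A k)) <= K * norm2 y].
  apply: (mx_cvg1_norm2 K1); rewrite -(mulVmx uAo).
  by apply: mx_cvgM => //; exact: mx_cvg_cst.
(* [U] refines convergence at infinity, so the Gromov-Hausdorff convergence holds along [U] and can
   be combined with the other conditions at a single index k. *)
have U3 : U [set k | (gh_dist (sr_dist (M k) (G := Gamma k))
    (fun x y : X => (mdist x y)%:E) < e%:E)%E].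
  apply: ooU; apply: (cvgX [set r | (r < e%:E)%E]).
  by apply: open_nbhs_nbhs; split; [exact: open_ereal_lt_ereal|rewrite /= lte_fin].
have [k [[k1 k2] [k3 k4]]] := filter_ex (filterI (filterI U1 U2) (filterI U3 US)).
have [F [F1 F2 F3]] := ld_dist_compare uQ (lattice_hsubgroup (latticeGamma k))
  (lattice_hsubgroup (latticeGamma k0)) k4 (lt_trans ltr01 K1) k1 k2.
exists (heis_quot (Gamma k)), (sr_dist (M k) (G := Gamma k)), F; split => //.
by move=> x y; apply: le_trans (diam_le k); apply: ereal_sup_ubound; exists x, y.
Qed.
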